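(* Let $Z$ be a standard normal random variable. Then the distribution of $\ln|Z|$ is infinitely divisible. More specifically, if $E_0,E_1,E_2,\dots$ are independent identically distributed standard exponential random variables (i.e. $\mathbb P(E_j>x)=e^{-x}$ for $x\ge 0$) and $\tilde E_j:=E_j-1$, then the series below converge almost surely and $$\ln|Z|\overset{D}{=}\frac{\ln 2}{2}-E_0-\sum_{j=1}^\infty\Big[\frac{E_j}{2j+1}-\frac12\ln\Big(1+\frac1j\Big)\Big] = -\frac{\gamma+\ln 2}{2}-\tilde E_0-\sum_{j=1}^\infty\frac{\tilde E_j}{2j+1},$$ where $\gamma$ is Euler's constant.
   Context: $\overset{D}{=}$ denotes equality in distribution. The distribution of $\ln|Z|$ for standard normal $Z$ is called the exp-normal distribution. *)

(* Defs.v *)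
From HB Require Import structures.
From mathcomp Require Import all_boot all_order all_algebra finmap.
From mathcomp Require Import all_classical all_reals all_analysis.
From mathcomp Require Import probability.
Set Implicit Arguments. Unset Strict Implicit. Unset Printing Implicit Defensive.
Import Order.TTheory GRing.Theory Num.Theory.
Import numFieldTopology.Exports numFieldNormedType.Exports.
Local Open Scope classical_set_scope.
Local Open Scope ring_scope.

Definition euler_gamma {R : realType} : R :=
  limn (fun n : nat => \sum_(1 <= k < n.+1) (k%:R : R)^-1 - ln (n%:R : R)).

Definition mutually_independent {I : choiceType} d (T : measurableType d)
    {R : realType} (P : probability T R) (X : I -> T -> R) : Prop :=
  forall (J : {fset I}) (B : I -> set R), (forall i, measurable (B i)) ->
    P (\bigcap_(i in [set` J]) (X i @^-1` B i)) =
    (\prod_(i <- J) P (X i @^-1` B i))%E.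

Definition eq_in_law d (T : measurableType d) d' (T' : measurableType d')
    {R : realType} (P : probability T R) (Q : probability T' R)
    (X : T -> R) (Y : T' -> R) : Prop :=
  forall B : set R, measurable B -> P (X @^-1` B) = Q (Y @^-1` B).

Definition infinitely_divisible {R : realType} (mu : set R -> \bar R) : Prop :=
  forall n : nat, (0 < n)%N ->
    exists (d : measure_display) (T : measurableType d) (Q : probability T R)
           (Y : 'I_n -> {RV Q >-> R}),
      mutually_independent Q (fun i => (Y i : T -> R)) /\
      (forall (i j : 'I_n) (B : set R), measurable B ->
         Q (Y i @^-1` B) = Q (Y j @^-1` B)) /\
      (forall B : set R, measurable B ->
         Q ((fun w => \sum_(i < n) Y i w) @^-1` B) = mu B).

Definition standard_normal d (T : measurableType d) {R : realType}
    (P : probability T R) (Z : {RV P >-> R}) : Prop :=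
  forall B : set R, measurable B -> distribution P Z B = normal_prob 0 1 B.

Definition standard_exponential d (T : measurableType d) {R : realType}
    (P : probability T R) (E : {RV P >-> R}) : Prop :=
  forall B : set R, measurable B -> distribution P E B = exponential_prob 1 B.

Definition series1 d (T : measurableType d) {R : realType}
    (E : nat -> T -> R) (w : T) (n : nat) : R :=
  \sum_(1 <= j < n) (E j w / (2 * j + 1)%:R - 2^-1 * ln (1 + (j%:R)^-1)).

Definition series2 d (T : measurableType d) {R : realType}
    (E : nat -> T -> R) (w : T) (n : nat) : R :=
  \sum_(1 <= j < n) ((E j w - 1) / (2 * j + 1)%:R).

(* Main.v *)
Require Import Defs.
From HB Require Import structures.
From mathcomp Require Import all_boot all_order all_algebra finmap.
From mathcomp Require Import all_classical all_reals all_analysis.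
From mathcomp Require Import probability measurable_realfun.
From mathcomp Require Import ring lra zify.
Set Implicit Arguments.
Unset Strict Implicit.
Unset Printing Implicit Defensive.
Import Order.TTheory GRing.Theory Num.Theory.
Import numFieldTopology.Exports numFieldNormedType.Exports.
Local Open Scope classical_set_scope.
Local Open Scope ring_scope.

(* Let nu_n be the probability on ]0, +oo[ with density proportional to
   x^(2n) exp(-x^2/2).  Integrating by parts, if W has law nu_(n+1) and E is an
   independent standard exponential variable, then W exp(-E/(2n+1)) has law nu_n.
   Iterating from nu_0, the law of |Z|, gives
   ln|Z| = ln W_n - sum_(j<n) E_j/(2j+1) in law.  Chebyshev's inequality for
   W_n^2/(2n+1) shows that ln W_n - ln(2n+1)/2 tends to 0 in probability, hence
   the series representations.  For infinite divisibility, split each E_j into n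
   independent Gamma(1/n) variables G_(j,i) and sum the series over j for each i
   separately. *)

(** * Grouping of independent families *)

(** The variables W_n are never built; only their tails occur. [gauss_ratio n s] stands for the
    probability that ln W_n exceeds s, and the iterated identity says that the mean of
    [gauss_ratio n (s + S_n)], with S_n the sum of E_j/(2j+1) over j < n, does not depend on n.
    Almost sure convergence of S_n - ln(2n+1)/2 drives these bounded integrands to 1 or to 0, and
    Fatou's lemma turns this into the law of the limit. Almost sure convergence is obtained from
    second moments and nonnegativity: blocks between cubes are controlled in mean square, and
    nonnegative terms cannot make the partial sums stray inside a block. The argument therefore
    applies to exponential and to Gamma(1/n) variables alike. Infinite divisibility asks for actual
    variables on some probability space. A countable independent array of Gamma(1/n) variables is
    produced from the binary digits of one uniform variable and a quantile transform. Its row sums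
    are exponential, its columns are independent copies of one another, and the moments of its
    entries are read off from the row sums. *)

Lemma finite_measure_unique d (T : measurableType d) (R : realType)
    (G : set (set T)) (m1 m2 : {measure set T -> \bar R}) :
  @measurable _ T = <<s G >> -> setI_closed G -> G setT ->
  (forall A, G A -> m1 A = m2 A) -> (m1 setT < +oo)%E ->
  forall A, measurable A -> m1 A = m2 A.
Proof.
move=> mG GI GT m12 m1T A mA.
apply: (@measure_unique _ R T G (fun=> setT) mG GI (fun=> GT)) => //.
by apply/seteqP; split=> // x _; exists 0%N.
Qed.

Section Cylinders.
Context (R : realType) (I : choiceType).

Definition cylinder (A : set I) : set (set (I -> R)) :=
  [set S | exists (J : {fset I}) (B : I -> set R),
    [/\ (forall i, i \in J -> A i), (forall i, measurable (B i)) &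
        S = [set f | forall i, i \in J -> B i (f i)]]].

(** Every [A] gives a sigma-algebra on the same carrier [I -> R]. Measurability of a function on
    [pathType A] then says that it depends only on the coordinates in [A], with no restriction map
    between product spaces. *)
Definition pathType (A : set I) := g_sigma_algebraType (cylinder A).

Lemma cylinderI A : setI_closed (cylinder A).
Proof.
move=> _ _ [J1 [B1 [JA1 mB1 ->]]] [J2 [B2 [JA2 mB2 ->]]].
exists (J1 `|` J2)%fset.
exists (fun i => (if i \in J1 then B1 i else setT) `&`
                 (if i \in J2 then B2 i else setT)); split.
- by move=> i; rewrite in_fsetU => /orP[/JA1|/JA2].
- by move=> i; apply: measurableI; case: ifP.
- apply/seteqP; split=> f /=.
    by move=> [f1 f2] i _; split; case: ifP => // ?; [exact: f1|exact: f2].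
  move=> f12; split=> i iJ; have := f12 i; rewrite in_fsetU iJ ?orbT /=.
    by case/(_ isT).
  by case/(_ isT).
Qed.

Lemma cylinderT A : cylinder A setT.
Proof.
exists fset0, (fun=> setT); split => //.
by apply/seteqP; split.
Qed.

Lemma measurable_coord A i : A i ->
  measurable_fun [set: pathType A] (fun f : pathType A => f i).
Proof.
move=> Ai _ B mB; rewrite setTI; apply: sub_sigma_algebra.
exists [fset i]%fset, (fun=> B); split => //.
  by move=> j /fset1P ->.
apply/seteqP; split=> f /=; first by move=> Bf j /fset1P ->.
by apply; rewrite fset11.
Qed.

Lemma measurable_path d (T : measurableType d) (X : I -> T -> R) A :
  (forall i, measurable_fun setT (X i)) ->
  measurable_fun setT (fun w => (fun i => X i w) : pathType A).
Proof.
move=> mX; apply: (@measurability _ _ T (pathType A) setT _ (cylinder A) erefl).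
move=> _ [_ [J [B [JA mB ->]] <-]]; rewrite setTI.
rewrite (_ : _ @^-1` _ = \bigcap_(i in [set` J]) (X i @^-1` B i)).
  apply: fin_bigcap_measurable; first exact: finite_fset.
  by move=> i _; rewrite -[X in measurable X]setTI; exact: mX.
by apply/seteqP; split.
Qed.

End Cylinders.

(** Both sides are finite measures in [S]: the image of [P] restricted to [D], and the image of [P]
    scaled by [P D]. They agree on a generating pi-system, hence everywhere. *)
Lemma independent_event_dynkin d (T : measurableType d) (R : realType)
    (P : probability T R) d' (T' : measurableType d') (f : T -> T')
    (G : set (set T')) (D : set T) :
  measurable_fun setT f -> @measurable _ T' = <<s G >> -> setI_closed G ->
  G setT -> measurable D ->
  (forall S, G S -> P (f @^-1` S `&` D) = P (f @^-1` S) * P D)%E ->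
  forall S, measurable S -> P (f @^-1` S `&` D) = (P (f @^-1` S) * P D)%E.
Proof.
move=> mf mG GI GT mD PG S mS.
pose pm1 : {measure set T' -> \bar R} := pushforward (mrestr P mD) f.
pose m1 := pm1 mf.
have PD0 : (0 <= fine (P D))%R by rewrite fine_ge0.
pose pm2 : {measure set T' -> \bar R} := pushforward P f.
pose m2 : {measure set T' -> \bar R} := mscale (NngNum PD0) (pm2 mf).
have m12 A : G A -> m1 A = m2 A.
  move=> GA; rewrite /m1 /m2 /pm1 /pm2 /= /mscale/= /pushforward /mrestr PG//.
  by rewrite muleC fineK// fin_num_measure.
have m1T : (m1 setT < +oo)%E.
  rewrite /m1 /pm1 /= /pushforward /mrestr preimage_setT setTI.
  by rewrite ltey_eq fin_num_measure.
have := finite_measure_unique mG GI GT m12 m1T mS.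
rewrite /m1 /m2 /pm1 /pm2 /= /mscale/= /pushforward /mrestr => ->.
by rewrite muleC fineK// fin_num_measure.
Qed.

Section Grouping.
Context (R : realType) (I L : choiceType) d (T : measurableType d).
Variables (P : probability T R) (X : I -> T -> R) (h : I -> L).
Hypothesis mX : forall i, measurable_fun setT (X i).
Hypothesis indX : mutually_independent P X.

Let path w i := X i w.

Let measurable_pre l (S : set (I -> R)) :
  measurable (S : set (pathType R (h @^-1` [set l]))) ->
  measurable (path @^-1` S).
Proof.
move=> mS; rewrite -[X in measurable X]setTI.
exact: (@measurable_path R I _ T X (h @^-1` [set l]) mX).
Qed.

(** The finite set [F] of single coordinates outside the groups of [s] is what lets the induction
    run. To treat a new group [l], its event is first taken to be a cylinder, which is absorbed into
    [F]; [independent_event_dynkin] then passes to all events of the group. *)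
Lemma independent_groups_seq (s : seq L) (F : {fset I}) (B : I -> set R)
    (S : L -> set (I -> R)) :
  uniq s -> (forall i, i \in F -> h i \notin s) ->
  (forall i, measurable (B i)) ->
  (forall l, l \in s -> measurable (S l : set (pathType R (h @^-1` [set l])))) ->
  P (\bigcap_(i in [set` F]) (X i @^-1` B i) `&`
     \bigcap_(l in [set` s]) (path @^-1` S l)) =
  ((\prod_(i <- F) P (X i @^-1` B i)) *
   \prod_(l <- s) P (path @^-1` S l))%E.
Proof.
elim: s F B => [|l s IH] F B /=.
  move=> _ _ mB _; rewrite big_nil mule1 -indX//.
  by rewrite set_nil bigcap_set0 setIT.
move=> /andP[ls us] Fs mB mS.
have mXB C i : measurable C -> measurable (X i @^-1` C).
  by move=> mC; rewrite -[X in measurable X]setTI; exact: mX.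
set D := \bigcap_(i in [set` F]) (X i @^-1` B i) `&`
         \bigcap_(l in [set` s]) (path @^-1` S l).
have mD : measurable D.
  apply: measurableI.
    apply: fin_bigcap_measurable; first exact: finite_fset.
    by move=> i _; exact: mXB.
  apply: fin_bigcap_measurable; first exact: finite_seq.
  move=> k ks; apply: (@measurable_pre k); apply: mS.
  by rewrite in_cons; apply/orP; right.
have PD : P D = ((\prod_(i <- F) P (X i @^-1` B i)) *
   \prod_(l <- s) P (path @^-1` S l))%E.
  apply: IH => // [i /Fs|k ks]; first by rewrite in_cons negb_or => /andP[].
  by apply: mS; rewrite in_cons ks orbT.
have -> : \bigcap_(i in [set` F]) (X i @^-1` B i) `&`
     \bigcap_(l in [set` l :: s]) (path @^-1` S l) = path @^-1` S l `&` D.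
  rewrite /D; apply/seteqP; split=> w /=.
    move=> [wF wS]; split; first by apply: wS; rewrite /= mem_head.
    split=> // k ks; apply: wS; rewrite /= in_cons; apply/orP; right; exact: ks.
  move=> [wl [wF wS]]; split=> // k /=.
  by rewrite in_cons => /orP[/eqP ->//|ks]; exact: wS.
rewrite big_cons muleCA -PD.
pose A := h @^-1` [set l].
apply: (@independent_event_dynkin _ T R P _ (pathType R A) path (cylinder A) D).
- exact: measurable_path.
- by [].
- exact: cylinderI.
- exact: cylinderT.
- exact: mD.
- move=> _ [J [B' [JA mB' ->]]].
  (* One family of sets serves both the cylinder and the coordinates in [F]: [J] lies in group [l],
     which [F] avoids, so [J] and [F] are disjoint. *)
  pose B2 i := if i \in J then B' i else B i.
  have FJ i : i \in J -> i \notin F.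
    move=> iJ; apply/negP => /Fs; rewrite in_cons negb_or => /andP[/eqP].
    by have := JA _ iJ; rewrite /A /= => ->.
  have mB2 i : measurable (B2 i) by rewrite /B2; case: ifP.
  have pE : path @^-1` [set f | forall i, i \in J -> B' i (f i)] =
    \bigcap_(i in [set` J]) (X i @^-1` B' i) by apply/seteqP; split.
  have := IH (J `|` F)%fset B2 us.
  have -> : \bigcap_(i in [set` (J `|` F)%fset]) (X i @^-1` B2 i) `&`
     \bigcap_(l0 in [set` s]) (path @^-1` S l0) =
     path @^-1` [set f | forall i, i \in J -> B' i (f i)] `&` D.
    rewrite pE /D /B2; apply/seteqP; split=> w /=.
      move=> [wJF wS]; split; last split => //.
        by move=> i /= iJ; have := wJF i; rewrite /= in_fsetU iJ; apply.
      move=> i /= iF; have := wJF i; rewrite /= in_fsetU iF orbT.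
      case: ifPn => [iJ|_]; last exact.
      by have := FJ _ iJ; rewrite iF.
    move=> [wJ [wF wS]]; split=> // i /=; rewrite in_fsetU.
    case: ifPn => [iJ _|iJ /= iF]; [exact: wJ|exact: wF].
  move=> ->//; last 2 first.
  - move=> i; rewrite in_fsetU => /orP[/JA|/Fs].
      by rewrite /A /= => ->.
    by rewrite in_cons negb_or => /andP[].
  - by move=> k ks; apply: mS; rewrite in_cons ks orbT.
  have /(perm_big _) -> : perm_eq (J `|` F)%fset (J ++ F).
    apply: uniq_perm; rewrite ?fset_uniq// ?cat_uniq ?fset_uniq/= ?andbT.
      by apply/hasPn => i iF; apply/negP => /FJ; rewrite iF.
    by move=> i; rewrite mem_cat in_fsetU.
  rewrite big_cat/=.
  rewrite pE indX// PD !muleA; congr (_ * _ * _)%E.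
    by apply: eq_fbigr => i iJ _; rewrite /B2 iJ.
  apply: eq_fbigr => i iF _; rewrite /B2; case: ifPn => // /FJ.
  by rewrite iF.
- by apply: mS; rewrite mem_head.
Qed.

Lemma independent_groups (phi : L -> (I -> R) -> R) :
  (forall l, measurable_fun [set: pathType R (h @^-1` [set l])] (phi l)) ->
  mutually_independent P (fun l w => phi l (fun i => X i w)).
Proof.
move=> mphi J B mB.
have := @independent_groups_seq (J : seq L) fset0 (fun=> setT)
  (fun l => phi l @^-1` B l) (fset_uniq J).
rewrite big_seq_fset0 mul1e.
rewrite [X in X `&` _](_ : _ = setT); last first.
  by apply/seteqP; split.
rewrite setTI; apply => // l lJ.
by rewrite -[X in measurable X]setTI; exact: mphi.
Qed.

End Grouping.

Lemma mutually_independent_inj (R : realType) (I K : choiceType) d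
    (T : measurableType d) (P : probability T R) (X : I -> T -> R)
    (g : K -> I) : injective g -> mutually_independent P X ->
  mutually_independent P (X \o g).
Proof.
move=> gI indX J B mB.
(* Off the image of [g] the set is [setT]; on the image, injectivity makes the chosen preimage the
   right one. *)
pose B' i := if pselect (exists k, g k = i) is left e then B (projT1 (cid e)) else setT.
have B'g k : B' (g k) = B k.
  rewrite /B'; case: pselect => [e|]; last by case; exists k.
  by congr B; apply: gI; case: cid.
have := indX (g @` J)%fset B'.
rewrite big_imfset/=; last by move=> k k' _ _; exact: gI.
rewrite (_ : \bigcap_(i in _) _ = \bigcap_(k in [set` J]) (X (g k) @^-1` B k)).
  move=> ->; last by move=> i; rewrite /B'; case: pselect.
  by apply: eq_fbigr => k _ _; rewrite B'g.
apply/seteqP; split=> w wJ i /=.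
  by move=> iJ; have := wJ (g i); rewrite /= B'g; apply; apply/imfsetP; exists i.
by move=> /imfsetP[k /= kJ ->]; rewrite B'g; exact: wJ.
Qed.

(** Independence and the marginals fix the law of the whole path on cylinders, hence on the
    sigma-algebra they generate. Any measurable functional of the path, limits of series included,
    therefore has the same law. *)
Lemma eq_in_law_path (R : realType) (I : choiceType) d (T : measurableType d)
    d' (T' : measurableType d') (P : probability T R) (P' : probability T' R)
    (X : I -> T -> R) (X' : I -> T' -> R) (phi : (I -> R) -> R) :
  (forall i, measurable_fun setT (X i)) ->
  (forall i, measurable_fun setT (X' i)) ->
  mutually_independent P X -> mutually_independent P' X' ->
  (forall i, eq_in_law P P' (X i) (X' i)) ->
  measurable_fun [set: pathType R setT] phi ->
  eq_in_law P P' (fun w => phi (fun i => X i w)) (fun w => phi (fun i => X' i w)).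
Proof.
move=> mX mX' iX iX' XX' mphi B mB.
pose f w : pathType R (@setT I) := fun i => X i w.
pose f' w : pathType R (@setT I) := fun i => X' i w.
have mf : measurable_fun setT f by exact: measurable_path.
have mf' : measurable_fun setT f' by exact: measurable_path.
pose pm1 : {measure set (pathType R (@setT I)) -> \bar R} := pushforward P f.
pose pm2 : {measure set (pathType R (@setT I)) -> \bar R} := pushforward P' f'.
pose m1 := pm1 mf; pose m2 := pm2 mf'.
have m12 A : cylinder (@setT I) A -> m1 A = m2 A.
  move=> [J [C [_ mC ->]]]; rewrite /m1 /m2 /pm1 /pm2 /= /pushforward/=.
  transitivity (P (\bigcap_(i in [set` J]) (X i @^-1` C i))); first by [].
  transitivity (P' (\bigcap_(i in [set` J]) (X' i @^-1` C i))); last by [].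
  by rewrite iX// iX'//; apply: eq_fbigr => i _ _; exact: XX'.
have m1T : (m1 setT < +oo)%E.
  by rewrite /m1 /pm1 /= /pushforward preimage_setT ltey_eq fin_num_measure.
have mS : measurable (phi @^-1` B : set (pathType R (@setT I))).
  by rewrite -[X in measurable X]setTI; exact: mphi.
exact: (@finite_measure_unique _ (pathType R (@setT I)) R (cylinder (@setT I))
  m1 m2 erefl (@cylinderI _ _ _) (@cylinderT _ _ _) m12 m1T _ mS).
Qed.

(** * Densities and independence *)

Import HBNNSimple.

(** The usual extension: indicators by hypothesis, simple functions by linearity, then monotone
    convergence on both sides. *)
Lemma ge0_integral_density d (T : measurableType d) (R : realType)
    (mu m : {measure set T -> \bar R}) (p : T -> R) :
  measurable_fun setT p -> (forall x, 0 <= p x) ->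
  (forall A, measurable A -> m A = (\int[mu]_(x in A) (p x)%:E)%E) ->
  forall f : T -> \bar R, measurable_fun setT f -> (forall x, 0 <= f x)%E ->
  (\int[m]_x f x = \int[mu]_x (f x * (p x)%:E))%E.
Proof.
move=> mp p0 mE f mf f0.
have pE x : (0 <= (p x)%:E)%E by rewrite lee_fin.
have mpE : measurable_fun setT (fun x => (p x)%:E) by exact/measurable_EFinP.
have indicE E : measurable E ->
    (\int[m]_x (\1_E x)%:E = \int[mu]_x ((\1_E x)%:E * (p x)%:E))%E.
  move=> mE'; rewrite integral_indic// setIT mE// integral_mkcond.
  apply: eq_integral => x _; rewrite patchE indicE.
  by case: ifPn => _; rewrite ?mul1e ?mul0e.
pose f_ := nnsfun_approx measurableT mf.
have simE n : (\int[m]_x (f_ n x)%:E = \int[mu]_x ((f_ n x)%:E * (p x)%:E))%E.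
  under [LHS]eq_integral do rewrite fimfunE -fsumEFin//.
  rewrite [LHS]ge0_integral_fsum//; last 2 first.
  - by move=> r; exact/measurable_EFinP/measurableT_comp.
  - by move=> k x _; rewrite EFinM nnfun_muleindic_ge0.
  under [RHS]eq_integral.
    move=> x xD; rewrite fimfunE -fsumEFin// muleC ge0_mule_fsumr; last first.
      by move=> r; rewrite EFinM nnfun_muleindic_ge0.
    over.
  rewrite [RHS]ge0_integral_fsum//; last 2 first.
  - move=> r; apply: emeasurable_funM => //.
    exact/measurable_EFinP/measurableT_comp.
  - by move=> k x _; rewrite mule_ge0// EFinM nnfun_muleindic_ge0.
  apply: eq_fsbigr => r _.
  rewrite integralZl_indic_nnsfun//=.
  have [r0|r0] := ltP r 0.
    rewrite preimage_nnfun0// indic0 integral0_eq// mule0 integral0_eq// => x _.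
    by rewrite mulr0 mule0.
  rewrite indicE// -ge0_integralZl//; last 2 first.
  - apply: emeasurable_funM => //; exact/measurable_EFinP.
  - by move=> x _; rewrite mule_ge0// lee_fin.
  by apply: eq_integral => x _; rewrite EFinM muleA muleC.
transitivity (lim (\int[m]_x (f_ n x)%:E @[n --> \oo])%E).
  rewrite -monotone_convergence//=.
  - apply: eq_integral => ? /[!inE] xD; apply/esym/cvg_lim => //=.
    exact: cvg_nnsfun_approx.
  - by move=> n; exact/measurable_EFinP/measurable_funTS.
  - by move=> n ? _; rewrite lee_fin.
  - by move=> ? _ ? ? mn; rewrite lee_fin; exact/lefP/nd_nnsfun_approx.
rewrite (_ : (\int[mu]_x (f x * (p x)%:E))%E =
    lim (\int[mu]_x ((f_ n x)%:E * (p x)%:E) @[n --> \oo])%E).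
  by apply: congr_lim; apply/funext => n /=; exact: simE.
rewrite -monotone_convergence//=.
- apply: eq_integral => x _; apply/esym/cvg_lim => //.
  by apply: cvgeZr => //; exact: cvg_nnsfun_approx.
- by move=> n; apply: emeasurable_funM => //; exact/measurable_EFinP.
- by move=> n x _; rewrite mule_ge0// lee_fin.
- move=> x _ a b ab; rewrite lee_wpmul2r// lee_fin.
  exact/lefP/nd_nnsfun_approx.
Qed.

(** The joint law is the product of the marginals, since both agree on rectangles; Tonelli's theorem
    gives the iterated form. Both integrals are taken over [P] itself, so no independent copy of [Y]
    has to be introduced. *)
Lemma independent_integral d (T : measurableType d) (R : realType)
    (P : probability T R) (X Y : T -> R) (f : R * R -> \bar R) :
  measurable_fun setT X -> measurable_fun setT Y ->
  (forall A B, measurable A -> measurable B ->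
    P (X @^-1` A `&` Y @^-1` B) = (P (X @^-1` A) * P (Y @^-1` B))%E) ->
  measurable_fun setT f -> (forall z, 0 <= f z)%E ->
  (\int[P]_w f (X w, Y w) = \int[P]_w \int[P]_v f (X w, Y v))%E.
Proof.
move=> mX mY XY mf f0.
pose X' : {mfun T >-> R} := mfun_Sub (mem_set mX).
pose Y' : {mfun T >-> R} := mfun_Sub (mem_set mY).
pose muX := distribution P X'.
pose muY := distribution P Y'.
have mXY : measurable_fun setT (fun w => (X w, Y w)) by exact/measurable_fun_pairP.
pose pm : {measure set (R * R) -> \bar R} := pushforward P (fun w => (X w, Y w)).
have -> : (\int[P]_w f (X w, Y w) = \int[pm mXY]_z f z)%E.
  by rewrite ge0_integral_pushforward.
rewrite (eq_measure_integral (muX \x muY)%E); last first.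
  move=> A mA _; apply/esym.
  apply: (@product_measure_unique _ _ _ _ R muX muY (pm mXY)) => // B C mB mC.
rewrite fubini_tonelli1//.
rewrite /fubini_F ge0_integral_distribution//; last 2 first.
- exact: measurable_fun_fubini_tonelli_F.
- by move=> x; apply: integral_ge0.
apply: eq_integral => w _ /=; rewrite ge0_integral_distribution//.
exact: measurableT_comp.
Qed.

(** [limn] is total and returns [point] on divergent sequences, so measurability must hold off the
    convergence set too. That set is where the upper and lower limits agree and are finite, which is
    a measurable condition. *)
Lemma measurable_fun_limn_real d (T : measurableType d) (R : realType)
    (u : nat -> T -> R) :
  (forall n, measurable_fun setT (u n)) ->
  measurable_fun setT (fun w => limn (u ^~ w)).
Proof.
move=> mu; pose v n w := (u n w)%:E.
have mv n : measurable_fun setT (v n) by exact/measurable_EFinP.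
pose s w := limn_esup (v ^~ w); pose i w := limn_einf (v ^~ w).
have ms : measurable_fun setT s by exact: measurable_fun_limn_esup.
have mi : measurable_fun setT i.
  apply: measurableT_comp => //; apply: measurable_fun_limn_esup => n.
  exact: measurableT_comp.
rewrite (_ : (fun w => _) = fun w =>
  if (s w == i w) && (s w == (fine (s w))%:E) then fine (s w) else point).
  apply: measurable_fun_ifT => //.
    apply: measurable_and; apply: measurable_fun_eqe => //.
    by apply/measurable_EFinP; exact: measurableT_comp.
  exact: measurableT_comp.
apply/funext => w; case: ifPn => [/andP[/eqP si /eqP sE]|].
  have vs : v ^~ w @ \oo --> s w.
    apply: (@squeeze_cvge _ _ _ _ (einfs (v ^~ w)) _ (esups (v ^~ w))).
    - apply: nearW => n; apply/andP; split.
        by apply: ereal_inf_lbound; exists n => /=.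
      by apply: ereal_sup_ubound; exists n => /=.
    - by rewrite si /i limn_einf_lim; exact: is_cvg_einfs.
    - by rewrite /s limn_esup_lim; exact: is_cvg_esups.
  apply/cvg_lim => //; move: vs; rewrite sE => /fine_cvgP[_].
  by apply: cvg_trans; apply: near_eq_cvg; apply: nearW.
move=> nsi; apply: dvgP => cu; move/negP: nsi; apply.
have vl : v ^~ w @ \oo --> (limn (u ^~ w))%:E.
  by apply: cvg_EFin; [exact: nearW|exact: cu].
have [iE sE] := cvg_limn_einf_sup vl.
by rewrite /s /i iE sE /= !eqxx.
Qed.

(** * Almost sure convergence of the centered series *)

Section OddSeries.
Context {R : realType}.

(* The series is sampled at the cubes: the variance of a block between two
   consecutive cubes is summable even after weighting by the squared index,
   while its deterministic part tends to 0. *)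
Let N (k : nat) := (k.+1 ^ 3)%N.

Let N_lt k : (N k < N k.+1)%N.
Proof. by rewrite /N ltn_exp2r. Qed.

(** The gap is 3(k+1)^2 + 3(k+1) + 1; each of its terms is absorbed by (k+1)^2, whence the constant
    7. *)
Let N_gap k : (N k.+1 - N k <= 7 * k.+1 ^ 2)%N.
Proof. by rewrite /N !expnS !expn0; lia. Qed.

Let N_block n : (0 < n)%N -> exists k, (N k <= n < N k.+1)%N.
Proof.
elim: n => // -[_ _|n /(_ isT)[k /andP[k1 k2]] _]; first by exists 0%N.
have [h|h] := ltnP n.+2 (N k.+1); first by exists k; rewrite h (leqW k1).
by exists k.+1; rewrite h (leq_ltn_trans _ (N_lt k.+1)).
Qed.

Lemma sum_inv_sqr_le n : \sum_(0 <= k < n) ((k.+1%:R : R) ^+ 2)^-1 <= 2.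
Proof.
(* The strengthened bound telescopes: 2/(n+1) - 2/(n+2) is at least 1/(n+1)^2. *)
suff h : \sum_(0 <= k < n) ((k.+1%:R : R) ^+ 2)^-1 <= 2 - n.+1%:R^-1 * 2.
  by rewrite (le_trans h)// gerBl mulr_ge0.
elim: n => [|n IH]; first by rewrite big_geq// invr1; lra.
rewrite big_nat_recr//=; apply: (le_trans (lerD IH (lexx _))).
have n1 : (1 : R) <= n.+1%:R by rewrite ler1n.
rewrite -[n.+2%:R]natr1; move: (n.+1%:R : R) n1 => a n1.
have a0 : a != 0 by rewrite gt_eqF// (lt_le_trans _ n1).
have a1 : a + 1 != 0 by rewrite gt_eqF// addr_gt0// (lt_le_trans _ n1).
rewrite -subr_ge0.
have -> : 2 - (a + 1)^-1 * 2 - (2 - a^-1 * 2 + (a ^+ 2)^-1) =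
  (a - 1) / (a ^+ 2 * (a + 1)) by field; rewrite a0 a1.
by rewrite divr_ge0 ?subr_ge0// mulr_ge0 ?sqr_ge0// addr_ge0// (le_trans _ n1).
Qed.

Definition odd_block (x : nat -> R) (m : R) (k : nat) : R :=
  \sum_(k.+1 ^ 3 <= j < k.+2 ^ 3) ((x j - m) / (2 * j + 1)%:R).

Let block_inv_le k : \sum_(N k <= j < N k.+1) ((2 * j + 1)%:R : R)^-1 <=
  7 / k.+1%:R.
Proof.
have p0 : (0 : R) < k.+1%:R by [].
apply: (@le_trans _ _ (\sum_(N k <= j < N k.+1) ((k.+1%:R : R) ^+ 3)^-1)).
  rewrite !big_nat; apply: ler_sum => j /andP[Nj _].
  rewrite lef_pV2 ?posrE ?exprn_gt0// -natrX ?ltr0n ?addn1// ler_nat.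
  by move: Nj; rewrite /N; lia.
rewrite sumr_const_nat -[leLHS]mulr_natl.
rewrite (@le_trans _ _ ((7 * k.+1 ^ 2)%:R * ((k.+1%:R : R) ^+ 3)^-1))//.
  by rewrite ler_wpM2r ?invr_ge0 ?exprn_ge0// ler_nat N_gap.
rewrite natrM natrX.
by rewrite exprS invfM -mulrA [_ ^+ 2 * _]mulrCA mulfV ?mulr1// expf_neq0// gt_eqF.
Qed.

(** Summability of the blocks gives convergence along the cubes. It extends to all indices because
    the sum of the [x j] is nondecreasing and the centring within a block is at most a constant
    times 1/(k+1). *)
Lemma cvg_odd_series (x : nat -> R) (m : R) : 0 <= m -> (forall j, 0 <= x j) ->
  cvgn (series (fun k => `|odd_block x m k|)) ->
  cvgn (fun n => \sum_(1 <= j < n) ((x j - m) / (2 * j + 1)%:R)).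
Proof.
move=> m0 x0 cD.
pose D := odd_block x m.
pose S n := \sum_(1 <= j < n) ((x j - m) / (2 * j + 1)%:R).
have SN K : S (N K) = series D K.
  rewrite /series /=; elim: K => [|K IH]; first by rewrite /S !big_geq.
  rewrite big_nat_recr//= -IH /S (@big_cat_nat _ _ _ (N K))//=.
  exact/ltnW/N_lt.
have cS : cvgn (series D) by exact: normed_cvg.
have D0 : D @ \oo --> 0 by exact: cvg_series_cvg_0.
have cSN : (S \o N) @ \oo --> limn (series D).
  by rewrite (_ : S \o N = series D)//; apply/funext => k /=; exact: SN.
pose w k := m * (7 / k.+1%:R) : R.
have w0 : w @ \oo --> 0.
  rewrite /w -(mulr0 m); apply: cvgM; first exact: cvg_cst.
  rewrite -(mulr0 7); apply: cvgM; first exact: cvg_cst.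
  exact: cvg_harmonic.
(* Dropping the nonnegative part bounds the increment below by [- w k]. Extending that part to the
   whole block bounds it above by [D k + w k]. *)
have gap k n : (N k <= n <= N k.+1)%N -> `|S n - S (N k)| <= `|D k| + w k.
  move=> /andP[kn nk].
  have N1 : (1 <= N k)%N by rewrite /N expn_gt0.
  have -> : S n - S (N k) = \sum_(N k <= j < n) ((x j - m) / (2 * j + 1)%:R).
    by rewrite /S (@big_cat_nat _ _ _ (N k))//= addrAC subrr add0r.
  have inv0 j : 0 <= ((2 * j + 1)%:R : R)^-1 by rewrite invr_ge0.
  have ble : m * \sum_(N k <= j < n) ((2 * j + 1)%:R : R)^-1 <= w k.
    rewrite /w ler_wpM2l//; apply: le_trans (block_inv_le k).
    rewrite [leRHS](@big_cat_nat _ _ _ n)//= lerDl.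
    by apply: sumr_ge0 => j _.
  have bleN : m * \sum_(N k <= j < N k.+1) ((2 * j + 1)%:R : R)^-1 <= w k.
    by rewrite /w ler_wpM2l.
  have E a b : \sum_(a <= j < b) ((x j - m) / (2 * j + 1)%:R) =
     \sum_(a <= j < b) (x j / (2 * j + 1)%:R) -
     m * \sum_(a <= j < b) ((2 * j + 1)%:R : R)^-1.
    by rewrite mulr_sumr -sumrB; apply: eq_bigr => j _; rewrite mulrBl.
  have xn0 : 0 <= \sum_(N k <= j < n) (x j / (2 * j + 1)%:R).
    by apply: sumr_ge0 => j _; rewrite mulr_ge0.
  have xle : \sum_(N k <= j < n) (x j / (2 * j + 1)%:R) <= D k + w k.
    rewrite -lerBlDr; apply: (@le_trans _ _ (\sum_(N k <= j < N k.+1)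
      (x j / (2 * j + 1)%:R) - m * \sum_(N k <= j < N k.+1) ((2 * j + 1)%:R : R)^-1)).
      rewrite lerB//.
      rewrite [leRHS](@big_cat_nat _ _ _ n)//= lerDl.
      by apply: sumr_ge0 => j _; rewrite mulr_ge0.
    by rewrite -E.
  have m0' : 0 <= m * \sum_(N k <= j < n) ((2 * j + 1)%:R : R)^-1.
    by rewrite mulr_ge0// sumr_ge0.
  rewrite E ler_norml; have := ler_norm (D k); have := normr_ge0 (D k).
  by move=> ? ?; apply/andP; split; lra.
apply/cvg_ex; exists (limn (series D)); apply/cvgrPdist_le => e e0.
have e2 : 0 < e / 3 by rewrite divr_gt0.
have [K1 _ HK1] := (@cvgrPdist_le _ _ _ _ _ _ _).1 cSN _ e2.
have [K2 _ HK2] := (@cvgrPdist_le _ _ _ _ _ _ _).1 D0 _ e2.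
have [K3 _ HK3] := (@cvgrPdist_le _ _ _ _ _ _ _).1 w0 _ e2.
pose K := maxn K1 (maxn K2 K3).
near=> n.
have Kn : (N K <= n)%N by near: n; exact: nbhs_infty_ge.
have [k /andP[kn nk]] : exists k, (N k <= n < N k.+1)%N.
  by apply: N_block; rewrite (leq_trans _ Kn)// /N expn_gt0.
have Kk : (K <= k)%N.
  have := leq_ltn_trans Kn nk; rewrite /N ltn_exp2r// ltnS.
have [k1 [k2 k3]] : [/\ (K1 <= k)%N & (K2 <= k)%N /\ (K3 <= k)%N].
  by move: Kk; rewrite /K !geq_max => /andP[-> /andP[-> ->]].
have := HK1 _ k1; have := HK2 _ k2; have := HK3 _ k3 => /= h3 h2 h1.
have g := gap k n; rewrite kn ltnW//= in g; have {}g := g isT.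
rewrite -/(S n); move: h2 h3; rewrite !sub0r !normrN => h2 h3.
have h3' : w k <= e / 3 by rewrite (le_trans (ler_norm _)).
rewrite (@le_trans _ _ (`|limn (series D) - S (N k)| + `|S n - S (N k)|))//.
  by rewrite (distrC (S n)) (le_trans _ (ler_normD _ _))// addrA subrK.
by lra.
Unshelve. all: by end_near. Qed.

Section AlmostSure.
Context d (T : measurableType d) (P : probability T R).
Variables (X : nat -> T -> R) (m q : R).
Hypothesis mX : forall j, measurable_fun setT (X j).
Hypothesis X0 : forall j w, 0 <= X j w.
Hypothesis EX : forall j, (\int[P]_w (X j w)%:E = m%:E)%E.
Hypothesis EX2 : forall j, (\int[P]_w (X j w ^+ 2)%:E = q%:E)%E.
Hypothesis EXX : forall i j, i != j ->
  (\int[P]_w (X i w * X j w)%:E = (m ^+ 2)%:E)%E.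

Let e j w := X j w - m.
Let me j : measurable_fun setT (e j).
Proof. by apply: measurable_funB. Qed.

Let intX j : P.-integrable setT (fun w => (X j w)%:E).
Proof.
apply/integrableP; split; first exact/measurable_EFinP.
by under eq_integral do rewrite gee0_abs ?lee_fin//; rewrite EX ltry.
Qed.

Let intXX i j : P.-integrable setT (fun w => (X i w * X j w)%:E).
Proof.
apply/integrableP; split; first exact/measurable_EFinP/measurable_funM.
under eq_integral do rewrite gee0_abs ?lee_fin ?mulr_ge0//.
have [<-|ij] := eqVneq i j; last by rewrite EXX// ltry.
by under eq_integral do rewrite -expr2; rewrite EX2 ltry.
Qed.

Let eeE i j w : ((e i w * e j w)%:E = (X i w * X j w)%:E +
  ((- m)%:E * (X i w)%:E + ((- m)%:E * (X j w)%:E + (m ^+ 2)%:E)))%E.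
Proof. by rewrite -!EFinM -!EFinD; congr EFin; rewrite /e; ring. Qed.

Let int_ee i j : P.-integrable setT (fun w => (e i w * e j w)%:E).
Proof.
under eq_fun do rewrite eeE.
apply: integrableD => //; apply: integrableD => //; first exact: integrableZl.
apply: integrableD => //; first exact: integrableZl.
exact: finite_measure_integrable_cst.
Qed.

Let E_ee i j : (\int[P]_w (e i w * e j w)%:E =
  (if i == j then q - m ^+ 2 else 0)%:E)%E.
Proof.
under eq_integral do rewrite eeE.
have i1 k : P.-integrable setT (fun w => ((- m)%:E * (X k w)%:E)%E).
  exact: integrableZl.
have i2 : P.-integrable setT (fun w => (m ^+ 2)%:E).
  exact: finite_measure_integrable_cst.
have i3 : P.-integrable setT (fun w => ((- m)%:E * (X j w)%:E + (m ^+ 2)%:E)%E).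
  exact: integrableD.
rewrite integralD//; last exact: integrableD.
rewrite integralD// integralD//.
have i4 : (\int[P]_w (m ^+ 2)%:E = (m ^+ 2)%:E)%E.
  by rewrite [LHS]integral_cst//= probability_setT mule1.
rewrite !integralZl// !EX i4.
have [<-|ij] := eqVneq i j.
  under eq_integral do rewrite -expr2.
  by rewrite EX2 -!EFinM -!EFinD; congr EFin; ring.
by rewrite EXX// -!EFinM -!EFinD; congr EFin; ring.
Qed.

Let D k w := odd_block (X ^~ w) m k.

Let mD k : measurable_fun setT (D k).
Proof.
apply: measurable_sum => j; apply: measurable_funM => //; exact: me.
Qed.

(** Distinct centred variables are orthogonal, so only the diagonal of the double sum survives. *)
Let E_sqr (s : seq nat) (c : nat -> R) : uniq s ->
  (\int[P]_w ((\sum_(j <- s) e j w * c j) ^+ 2)%:E =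
   ((q - m ^+ 2) * \sum_(j <- s) c j ^+ 2)%:E)%E.
Proof.
move=> us.
under eq_integral => w _.
  rewrite expr2 big_distrlr/= -sumEFin.
  under eq_bigr do rewrite -sumEFin.
  over.
rewrite integral_sum//; last first.
  move=> i; apply: integrable_sum => // j _.
  apply: (eq_integrable _ (fun w => (c i * c j)%:E * (e i w * e j w)%:E)%E) => //.
    by move=> w _; rewrite -EFinM; congr EFin; ring.
  exact: integrableZl.
rewrite mulr_sumr -sumEFin !big_seq; apply: eq_bigr => i si.
rewrite integral_sum//; last first.
  move=> j; apply: (eq_integrable _ (fun w => (c i * c j)%:E * (e i w * e j w)%:E)%E) => //.
    by move=> w _; rewrite -EFinM; congr EFin; ring.
  exact: integrableZl.
rewrite (bigD1_seq i)//= big1 ?adde0.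
  transitivity (\int[P]_w ((c i * c i)%:E * (e i w * e i w)%:E))%E.
    by apply: eq_integral => w _; rewrite -EFinM; congr EFin; ring.
  by rewrite integralZl// E_ee eqxx -EFinM; congr EFin; ring.
move=> j ji.
transitivity (\int[P]_w ((c i * c j)%:E * (e i w * e j w)%:E))%E.
  by apply: eq_integral => w _; rewrite -EFinM; congr EFin; ring.
by rewrite integralZl// E_ee eq_sym (negbTE ji) mule0.
Qed.

Let v0 : 0 <= q - m ^+ 2.
Proof.
rewrite -lee_fin; have := E_ee 0 0; rewrite eqxx => <-.
by apply: integral_ge0 => w _; rewrite lee_fin -expr2 sqr_ge0.
Qed.

(** A block has at most 7(k+1)^2 terms, each with squared weight at most (k+1)^(-6). Its variance is
    of order (k+1)^(-4), which leaves (k+1)^(-2) after the weighting. *)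
Let E_D k : (\int[P]_w ((k.+1%:R ^+ 2) * D k w ^+ 2)%:E <=
  ((q - m ^+ 2) * 7 * (k.+1%:R ^+ 2)^-1)%:E)%E.
Proof.
have p0 : (0 : R) < k.+1%:R by [].
under eq_integral do rewrite EFinM.
rewrite ge0_integralZl//; last 2 first.
- exact/measurable_EFinP/measurable_funX/mD.
- by move=> w _; rewrite lee_fin sqr_ge0.
rewrite /D /odd_block E_sqr ?iota_uniq// -EFinM lee_fin.
rewrite mulrCA -mulrA ler_wpM2l//.
rewrite -ler_pdivlMl ?exprn_gt0//.
apply: (@le_trans _ _ (\sum_(N k <= j < N k.+1) ((k.+1%:R : R) ^+ 6)^-1)).
  rewrite !big_nat; apply: ler_sum => j /andP[Nj _].
  rewrite exprVn lef_pV2 ?posrE ?exprn_gt0// ?ltr0n ?addn1//.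
  rewrite (_ : 6 = 3 * 2)%N// exprM lerXn2r ?nnegrE ?exprn_ge0//.
  by rewrite -natrX ler_nat; move: Nj; rewrite /N; lia.
rewrite sumr_const_nat -[leLHS]mulr_natl.
rewrite (@le_trans _ _ ((7 * k.+1 ^ 2)%:R * ((k.+1%:R : R) ^+ 6)^-1))//.
  by rewrite ler_wpM2r ?invr_ge0 ?exprn_ge0// ler_nat N_gap.
rewrite natrM natrX le_eqVlt; apply/orP; left; apply/eqP.
by field; rewrite gt_eqF.
Qed.

(** The series of weighted squared blocks has a finite mean by [E_D], so it is finite almost surely;
    this makes the blocks absolutely summable. *)
Lemma ae_cvg_odd_series : {ae P, forall w,
  cvgn (fun n => \sum_(1 <= j < n) ((X j w - m) / (2 * j + 1)%:R))}.
Proof.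
pose f k w := ((k.+1%:R ^+ 2) * D k w ^+ 2)%:E.
have f0 k w : (0 <= f k w)%E by rewrite lee_fin mulr_ge0 ?sqr_ge0.
have mf k : measurable_fun setT (f k).
  apply/measurable_EFinP; apply: measurable_funM => //.
  exact/measurable_funX/mD.
have mF : measurable_fun setT (fun w => \sum_(k <oo) f k w)%E.
  by apply: ge0_emeasurable_sum.
have intF : P.-integrable setT (fun w => \sum_(k <oo) f k w)%E.
  apply/integrableP; split => //.
  under eq_integral do rewrite gee0_abs ?nneseries_ge0//.
  rewrite integral_nneseries//.
  apply: (@le_lt_trans _ _ ((q - m ^+ 2) * 7 * 2)%:E); last exact: ltry.
  apply: lime_le.
    by apply: is_cvg_nneseries => k _ _; apply: integral_ge0.
  apply: nearW => n.
  apply: (@le_trans _ _ (\sum_(0 <= k < n) ((q - m ^+ 2) * 7 * (k.+1%:R ^+ 2)^-1)%:E)%E).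
    by apply: lee_sum => k _; exact: E_D.
  rewrite sumEFin lee_fin -mulr_sumr ler_wpM2l ?mulr_ge0//.
  exact: sum_inv_sqr_le.
have := integrable_ae measurableT intF.
apply: filterS => w /(_ I) Fw.
apply: cvg_odd_series => //.
  rewrite -lee_fin -(EX 0); apply: integral_ge0 => v _; rewrite lee_fin; exact: X0.
apply: nondecreasing_is_cvgn.
  by apply/nondecreasing_seqP => n; rewrite /series/= big_nat_recr//= lerDl.
exists (2 + fine (\sum_(k <oo) f k w)%E) => _ [n _ <-].
rewrite /series /=.
(* With p = (k+1)^2 and y = |D_k|, the square (py - 1)^2 being nonnegative gives y at most 1/p + p
   y^2. The first part sums to at most 2. *)
apply: (@le_trans _ _ (\sum_(0 <= k < n) ((k.+1%:R ^+ 2)^-1 +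
    k.+1%:R ^+ 2 * D k w ^+ 2))).
  apply: ler_sum => k _.
  rewrite -/(D k w); set p : R := k.+1%:R ^+ 2.
  have p0 : 0 < p by rewrite exprn_gt0.
  rewrite -(real_normK (num_real (D k w))); set y := `|D k w|.
  have y0 : 0 <= y by exact: normr_ge0.
  rewrite -(ler_pM2l p0) mulrDr mulfV ?gt_eqF//.
  by have := sqr_ge0 (p * y - 1); nra.
rewrite big_split/= lerD ?sum_inv_sqr_le//.
rewrite -lee_fin fineK// -sumEFin.
by apply: nneseries_lim_ge => k _ _; exact: f0.
Qed.

End AlmostSure.
End OddSeries.

(** * Euler's constant *)

Section EulerGamma.
Context {R : realType}.

Definition harmonic_ln (n : nat) : R :=
  \sum_(1 <= k < n.+1) (k%:R : R)^-1 - ln (n%:R : R).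

Let lnS (n : nat) : (0 < n)%N ->
  ln (n.+1%:R : R) = ln n%:R + ln (1 + n%:R^-1).
Proof.
move=> n0; have n0' : (0 : R) < n%:R by rewrite ltr0n.
rewrite -lnM ?posrE// ?addr_gt0 ?invr_gt0//.
by rewrite mulrDr mulr1 mulfV ?gt_eqF// natr1.
Qed.

Lemma ln_1Dinv_le (n : nat) : ln (1 + (n.+1%:R : R)^-1) <= n.+1%:R^-1.
Proof. by apply: le_ln1Dx; rewrite (@lt_trans _ _ 0)// invr_gt0. Qed.

(** The argument of the logarithm is the inverse of 1 - 1/(n+2), so the bound ln(1+x) <= x at x =
    -1/(n+2) gives the inequality. *)
Lemma ln_1Dinv_ge (n : nat) : (n.+2%:R : R)^-1 <= ln (1 + (n.+1%:R : R)^-1).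
Proof.
have n1 : (0 : R) < n.+1%:R by [].
have n2 : (0 : R) < n.+2%:R by [].
have -> : 1 + (n.+1%:R : R)^-1 = (1 - n.+2%:R^-1)^-1.
  have -> : 1 - (n.+2%:R : R)^-1 = n.+1%:R / n.+2%:R.
    by apply: (mulIf (lt0r_neq0 n2)); rewrite mulrBl mulVf ?gt_eqF// mul1r mulfVK ?gt_eqF// -natr1 addrK.
  by rewrite invf_div -[n.+2%:R]natr1 mulrDl mulfV ?gt_eqF// mul1r.
rewrite lnV ?posrE ?subr_gt0 ?invf_lt1 ?ltr1n// lerNr.
by apply: le_ln1Dx; rewrite ltrN2 invf_lt1// ltr1n.
Qed.

(** [euler_gamma] is a bare [limn], so it carries information only once convergence is known. From
    index 1 on, the sequence is nonincreasing and bounded below by 0. *)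
Lemma is_cvg_harmonic_ln : cvgn harmonic_ln.
Proof.
have step n : harmonic_ln n.+2 = harmonic_ln n.+1 +
    (n.+2%:R^-1 - ln (1 + (n.+1%:R)^-1)).
  by rewrite /harmonic_ln big_nat_recr//= (lnS (n:=n.+1))// opprD addrACA.
(* The shift matters: with [ln 0 = 0] the value at index 0 is 0 and the value at index 1 is 1, so
   monotonicity fails at the start. *)
suff : cvgn [sequence harmonic_ln n.+1]_n.
  by move=> h; apply/cvg_ex; exists (limn [sequence harmonic_ln n.+1]_n); rewrite -cvg_shiftS.
apply: nonincreasing_is_cvgn.
  apply/nonincreasing_seqP => n /=; rewrite step gerDl subr_le0.
  exact: ln_1Dinv_ge.
exists 0 => _ [n _ <-].
suff h : ln (n.+2%:R : R) <= \sum_(1 <= k < n.+2) (k%:R : R)^-1.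
  rewrite /harmonic_ln subr_ge0 (le_trans _ h)//.
  by rewrite ler_ln ?posrE// ler_nat.
elim: n => [|n IH].
  rewrite big_nat1 invr1; have := @ln_1Dinv_le 0%N.
  by rewrite invr1 -[1 + 1]/(2%:R).
rewrite big_nat_recr//= (lnS (n:=n.+2))//; apply: lerD => //.
exact: ln_1Dinv_le.
Qed.

Lemma cvg_harmonic_ln : harmonic_ln @ \oo --> (euler_gamma : R).
Proof. exact: is_cvg_harmonic_ln. Qed.

(** The odd reciprocals up to 2n - 1 are those up to 2n minus half of those up to n. The constant
    collects the ln 2 of ln(2n) and the omitted term 1 at j = 0. *)
Lemma odd_harmonic_ln (n : nat) : (0 < n)%N ->
  \sum_(1 <= j < n) ((2 * j + 1)%:R : R)^-1 - 2^-1 * ln n%:R =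
  harmonic_ln (2 * n) - 2^-1 * harmonic_ln n + (ln 2 - 1).
Proof.
move=> n0; have n0' : (0 : R) < n%:R by rewrite ltr0n.
have H : \sum_(1 <= k < (2 * n).+1) (k%:R : R)^-1 -
    2^-1 * \sum_(1 <= k < n.+1) (k%:R : R)^-1 =
    1 + \sum_(1 <= j < n) ((2 * j + 1)%:R : R)^-1.
  case: n n0 {n0'} => // n _; elim: n => [|n IH].
    by rewrite muln1 big_ltn// big_ltn// big_geq// big_ltn// big_geq// big_geq//; lra.
  rewrite [in LHS]mulnS big_nat_recr//= big_nat_recr//=.
  rewrite [\sum_(1 <= k < n.+3) _]big_nat_recr//=.
  rewrite [\sum_(1 <= k < n.+2) ((2 * _ + 1)%:R)^-1]big_nat_recr//=.
  rewrite addrA -IH mulrDr.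
  have -> : ((2 * n.+1).+2%:R : R)^-1 = 2^-1 * n.+2%:R^-1.
    by rewrite -invfM -natrM [in RHS]mulnS.
  rewrite addn1; ring.
rewrite /harmonic_ln natrM lnM ?posrE//.
by move: H; set a := \sum_(_ <= _ < _) _; set b := \sum_(_ <= _ < _) _;
  set c := \sum_(_ <= _ < _) _ => H; lra.
Qed.

Lemma cvg_odd_harmonic_ln :
  (fun n => \sum_(1 <= j < n) ((2 * j + 1)%:R : R)^-1 - 2^-1 * ln n%:R) @ \oo
  --> ln 2 + euler_gamma / 2 - 1.
Proof.
have -> : ln 2 + euler_gamma / 2 - 1 =
    euler_gamma - 2^-1 * euler_gamma + (ln 2 - 1) :> R by lra.
have h : (fun n => harmonic_ln (2 * n) - 2^-1 * harmonic_ln n + (ln 2 - 1)) @ \oo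
    --> euler_gamma - 2^-1 * euler_gamma + (ln 2 - 1).
  apply: cvgD; last exact: cvg_cst.
  apply: cvgB; last by apply: cvgM; [exact: cvg_cst|exact: cvg_harmonic_ln].
  apply: (cvg_comp (fun n => 2 * n)%N harmonic_ln); last exact: cvg_harmonic_ln.
  by apply/cvgnyPge => A; near=> n; rewrite (@leq_trans n)// ?leq_pmull//; near: n; exact: nbhs_infty_ge.
apply: cvg_trans h; apply: near_eq_cvg.
near=> n; rewrite odd_harmonic_ln//; near: n; exact: nbhs_infty_gt.
Unshelve. all: by end_near. Qed.

End EulerGamma.

(** * Tails of the densities x^(2n) exp(-x^2/2) *)

Section GaussTails.
Context {R : realType}.
Local Notation mu := (@lebesgue_measure R).

Definition gauss (x : R) : R := expR (- (x ^+ 2 / 2)).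

Lemma gauss_ge0 x : 0 <= gauss x. Proof. exact: expR_ge0. Qed.

Lemma is_derive_gauss (x : R) : is_derive x 1 gauss (- (x * gauss x)).
Proof.
rewrite /gauss; apply: is_derive_eq.
change (expR (- (x ^+ 2 / 2)) *
  - (x ^+ 2 * (- 2 ^- 2 * 0) + 2^-1 * (x * 1 + x * 1)) =
  - (x * expR (- (x ^+ 2 / 2)))).
by field.
Qed.

Lemma continuous_gauss : continuous gauss.
Proof.
move=> x; apply/differentiable_continuous/derivable1_diffP.
by have [] := is_derive_gauss x.
Qed.

Lemma measurable_gauss : measurable_fun setT gauss.
Proof. exact: continuous_measurable_fun continuous_gauss. Qed.

Lemma cvg_gauss : gauss x @[x --> +oo%R] --> (0 : R).
Proof.
apply: (cvg_comp (fun x : R => x ^+ 2 / 2) (fun x => expR (- x))); last exact: cvgr_expR.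
apply/cvgryPge => A.
have := @cvgr_expr2 R => /cvgryPge/(_ (A * 2)).
by apply: filterS => x; rewrite ler_pdivlMr.
Qed.

Lemma integral_gauss_tail (y : R) : 0 <= y ->
  (\int[mu]_(x in `]y, +oo[) (x * gauss x)%:E = (gauss y)%:E)%E.
Proof.
move=> y0.
have c : continuous (fun x : R => x * gauss x).
  by move=> x; apply: cvgM; [exact: cvg_id|exact: continuous_gauss].
rewrite integral_itv_obnd_cbnd; last first.
  by apply/measurable_EFinP/measurable_funTS; exact: continuous_measurable_fun.
rewrite (@ge0_continuous_FTC2y _ _ (fun x => - gauss x) y 0).
- by rewrite sub0e EFinN oppeK.
- by move=> x yx; rewrite mulr_ge0 ?gauss_ge0// (le_trans y0).
- exact: continuous_subspaceT.
- by rewrite -oppr0; apply: cvgN; exact: cvg_gauss.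
- move=> x _; apply: derivableN; by have [] := is_derive_gauss x.
- apply: cvgN; apply: cvg_at_right_filter; exact: continuous_gauss.
- move=> x _; rewrite derive1N; last by have [] := is_derive_gauss x.
  by rewrite derive1E; have [_ ->] := is_derive_gauss x; rewrite opprK.
Qed.

Lemma integral_expn (n : nat) (b x : R) : b < x ->
  (\int[mu]_(y in `]b, x[) (n.+1%:R * y ^+ n)%:E = (x ^+ n.+1 - b ^+ n.+1)%:E)%E.
Proof.
move=> bx.
have c : continuous (fun y : R => n.+1%:R * y ^+ n).
  by move=> y; apply: cvgM; [exact: cvg_cst|exact: exprn_continuous].
rewrite -(@integral_itv_bndoo _ b x _ true false)//; last first.
  by apply/measurable_EFinP/measurable_funTS; exact: continuous_measurable_fun.
have D (y : R) : is_derive y 1 (fun y : R => y ^+ n.+1) (n.+1%:R * y ^+ n).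
  apply: DeriveDef; first exact: exprn_derivable.
  by rewrite exp_derive -[LHS]/(_ * 1) mulr1.
rewrite (@continuous_FTC2 _ _ (fun y => y ^+ n.+1) b x bx) ?EFinB//.
- exact: continuous_subspaceT.
- split.
  + by move=> y _; have [] := D y.
  + by apply: cvg_at_right_filter; exact: exprn_continuous.
  + by apply: cvg_at_left_filter; exact: exprn_continuous.
- by move=> y _; rewrite derive1E; have [_ ->] := D y.
Qed.

(** The tail of nu_n before normalisation. It lives in [\bar R] so that Tonelli's theorem applies
    before finiteness is known. *)
Definition gauss_tail (n : nat) (b : R) : \bar R :=
  (\int[mu]_(x in `]b, +oo[) (x ^+ (2 * n) * gauss x)%:E)%E.

Lemma gauss_tail_ge0 n b : (0 <= gauss_tail n b)%E.
Proof.
apply: integral_ge0 => x _; rewrite lee_fin mulr_ge0 ?gauss_ge0//.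
by rewrite exprM exprn_ge0// sqr_ge0.
Qed.

Lemma measurable_gauss_weight n : measurable_fun setT 
  (fun x : R => x ^+ (2 * n) * gauss x).
Proof. by apply: measurable_funM; [exact: exprn_measurable|exact: measurable_gauss]. Qed.

(** Integration by parts carried out as Tonelli's theorem: x^a - b^a is the integral of a y^(a-1)
    over ]b, x[, and after the exchange the inner integral of x exp(-x^2/2) over ]y, +oo[ is
    exp(-y^2/2). No boundary term at infinity arises. *)
Lemma gauss_tail_parts (n : nat) (b : R) : 0 <= b ->
  (\int[mu]_(x in `]b, +oo[) ((x ^+ (2 * n).+1 - b ^+ (2 * n).+1) * (x * gauss x))%:E =
   (2 * n).+1%:R%:E * gauss_tail n b)%E.
Proof.
move=> b0; set a := (2 * n).+1.
pose g (z : measurableTypeR R * measurableTypeR R) : \bar R := (if (b < z.2) && (z.2 < z.1) then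
  z.1 * gauss z.1 * (a%:R * z.2 ^+ (2 * n)) else 0)%:E.
have g0 z : (0 <= g z)%E.
  rewrite lee_fin; case: ifPn => // /andP[bz z12].
  have z20 : 0 <= z.2 by rewrite (le_trans b0)// ltW.
  have z10 : 0 <= z.1 by rewrite (le_trans z20)// ltW.
  by rewrite !mulr_ge0 ?gauss_ge0 ?exprn_ge0.
have mg : measurable_fun setT g.
  apply/measurable_EFinP; apply: measurable_fun_ifT.
  - by apply: measurable_and; apply: measurable_fun_ltr.
  - apply: measurable_funM; first apply: measurable_funM => //.
      by apply: measurableT_comp => //; exact: measurable_gauss.
    by apply: measurable_funM => //; apply: measurable_funX.
  - by [].
transitivity (\int[mu]_x \int[mu]_y g (x, y))%E.
  rewrite integral_mkcond; apply: eq_integral => x _; rewrite patchE.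
  case: ifPn => [|].
    rewrite inE/= in_itv/= andbT => bx.
    transitivity (\int[mu]_(y in `]b, x[) ((x * gauss x)%:E * (a%:R * y ^+ (2 * n))%:E))%E.
      rewrite ge0_integralZl//; last 3 first.
      - apply/measurable_EFinP/measurable_funTS; exact: measurable_funM.
      - by move=> y _; rewrite lee_fin mulr_ge0// exprM exprn_ge0// sqr_ge0.
      - by rewrite lee_fin mulr_ge0 ?gauss_ge0// (le_trans b0)// ltW.
      by rewrite integral_expn// -EFinM mulrC.
    rewrite integral_mkcond; apply: eq_integral => y _; rewrite patchE /g /=.
    by rewrite mem_setE in_itv/=; case: ifPn => _; rewrite -?EFinM.
  rewrite notin_setE/= in_itv/= andbT => /negP; rewrite -leNgt => xb.
  rewrite integral0_eq// => y _; rewrite /g /=; case: ifPn => // /andP[by_ yx].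
  by have := lt_trans by_ yx; rewrite ltNge xb.
rewrite (fubini_tonelli g)// /gauss_tail -ge0_integralZl//; last 2 first.
- by apply/measurable_EFinP/measurable_funTS; exact: measurable_gauss_weight.
- by move=> x _; rewrite lee_fin mulr_ge0 ?gauss_ge0// exprM exprn_ge0// sqr_ge0.
rewrite [RHS]integral_mkcond; apply: eq_integral => y _; rewrite patchE.
case: ifPn => [|].
  rewrite inE/= in_itv/= andbT => by_.
  have y0 : 0 <= y by rewrite (le_trans b0)// ltW.
  transitivity (\int[mu]_(x in `]y, +oo[) ((a%:R * y ^+ (2 * n))%:E * (x * gauss x)%:E))%E.
    rewrite [RHS]integral_mkcond; apply: eq_integral => x _; rewrite patchE /g /= by_ /=.
    by rewrite mem_setE in_itv/= andbT; case: ifPn => _; rewrite -?EFinM// mulrC.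
  rewrite ge0_integralZl//; last 3 first.
  - by apply/measurable_EFinP/measurable_funTS; apply: measurable_funM => //; exact: measurable_gauss.
  - by move=> x; rewrite /= in_itv/= andbT => yx; rewrite lee_fin mulr_ge0 ?gauss_ge0// (le_trans y0)// ltW.
  - by rewrite lee_fin mulr_ge0// exprn_ge0.
  by rewrite integral_gauss_tail// -!EFinM mulrA.
rewrite notin_setE/= in_itv/= andbT => /negP/negbTE by_.
by rewrite integral0_eq// => x _; rewrite /g /= by_.
Qed.

Lemma gauss_tailS0 n : gauss_tail n.+1 0 = ((2 * n).+1%:R%:E * gauss_tail n 0)%E.
Proof.
rewrite -gauss_tail_parts// /gauss_tail; apply: eq_integral => x _.
by congr EFin; rewrite expr0n/= subr0 mulrA -exprSr mulnS.
Qed.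

Lemma exponential_prob_ltr (t : R) :
  exponential_prob 1 `]-oo, t[ = (if 0 < t then 1 - expR (- t) else 0)%:E.
Proof.
rewrite /exponential_prob; case: ifPn => t0.
  transitivity (exponential_prob 1 `[0, t]); last first.
    by rewrite exponential_prob_itv0c// mulN1r.
  rewrite integral_itv_bndo_bndc; last first.
    by apply/measurable_EFinP/measurable_funTS; exact: measurable_exponential_pdf.
  rewrite /exponential_prob integral_mkcond [RHS]integral_mkcond.
  apply: eq_integral => x _; rewrite !patchE !mem_setE !in_itv/=.
  by case: (leP 0 (x : R)) => //= x0; case: ifP => // _; rewrite lt0_exponential_pdf.
rewrite integral0_eq// => x; rewrite /= in_itv/= => xt.
by rewrite lt0_exponential_pdf// (lt_le_trans xt)// leNgt.
Qed.

(** The identity W_(n+1) exp(-E/(2n+1)) = W_n in law, read on tails. For fixed x above exp(s) the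
    threshold stays below x with probability 1 - (exp(s)/x)^(2n+1), and the product with the density
    is the integrand of [gauss_tail_parts] at b = exp(s). *)
Lemma gauss_tail_exponential (nu : probability (measurableTypeR R) R) (n : nat) (s : R) :
  (forall A, measurable A -> nu A = exponential_prob 1 A) ->
  (\int[nu]_t gauss_tail n.+1 (expR (s + t / (2 * n).+1%:R)) =
   (2 * n).+1%:R%:E * gauss_tail n (expR s))%E.
Proof.
move=> nuE; set a := (2 * n).+1.
have a0 : (0 : R) < a%:R by [].
pose g (z : measurableTypeR R * measurableTypeR R) : \bar R := (if expR (s + z.1 / a%:R) < z.2 then
  z.2 ^+ (2 * n.+1) * gauss z.2 else 0)%:E.
have g0 z : (0 <= g z)%E.
  rewrite lee_fin; case: ifPn => // _.
  by rewrite mulr_ge0 ?gauss_ge0// exprM exprn_ge0// sqr_ge0.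
have mg : measurable_fun setT g.
  apply/measurable_EFinP; apply: measurable_fun_ifT => //.
  - apply: measurable_fun_ltr => //; apply: measurableT_comp => //.
    by apply: measurable_funD => //; exact: measurable_funM.
  - apply: measurable_funM; first exact: measurable_funX.
    by apply: measurableT_comp => //; exact: measurable_gauss.
transitivity (\int[nu]_t \int[mu]_x g (t, x))%E.
  apply: eq_integral => t _; rewrite /gauss_tail integral_mkcond.
  apply: eq_integral => x _; rewrite patchE /g /=.
  by rewrite mem_setE in_itv/= andbT; case: ifPn.
rewrite (fubini_tonelli g)//.
rewrite -gauss_tail_parts ?expR_ge0// [RHS]integral_mkcond.
apply: eq_integral => x _; rewrite patchE.
case: ifPn; rewrite (inE, notin_setE)/= in_itv/= andbT; last first.
  move=> /negP; rewrite -leNgt => xs.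
  (* For x at most exp(s) only negative t contribute, and they form a null set of the exponential
     law. *)
  transitivity (\int[nu]_(t in `]-oo, 0%R[) g (t, x))%E.
    rewrite [RHS]integral_mkcond; apply: eq_integral => t _; rewrite patchE mem_setE in_itv/=.
    case: ifPn => //; rewrite -leNgt => t0; rewrite /g /=; case: ifPn => // h.
    have := lt_le_trans h xs; rewrite ltr_expR gtrDl ltNge => /negP[].
    by rewrite divr_ge0.
  apply: null_set_integral => //=.
  - by apply: measurable_funTS; exact: measurableT_comp.
  - by rewrite nuE// exponential_prob_ltr ltxx.
move=> sx.
have x0 : 0 < x by rewrite (lt_trans _ sx)// expR_gt0.
(* The value of t at which exp(s + t/a) reaches x. *)
set tau := a%:R * (ln x - s).
have tau0 : 0 < tau.
  by rewrite mulr_gt0// subr_gt0 -ltr_expR lnK ?posrE.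
transitivity (\int[nu]_(t in `]-oo, tau[)
    (x ^+ (2 * n.+1) * gauss x)%:E)%E.
  rewrite [RHS]integral_mkcond; apply: eq_integral => t _; rewrite patchE mem_setE in_itv/=.
  rewrite /g /= -{1}(lnK x0) ltr_expR addrC -ltrBrDr ltr_pdivrMr// mulrC -/tau.
  by case: ifPn.
rewrite integral_cst//= nuE// exponential_prob_ltr tau0 -EFinM; congr EFin.
rewrite mulrBr mulr1 mulrBl; congr (_ - _).
  by rewrite mulrA -exprSr mulnS.
have -> : expR (- tau) = expR s ^+ a / x ^+ a.
  rewrite -(lnK x0) -!expRM_natl -expRN -expRD /tau; congr expR; ring.
rewrite mulnS exprS -/a.
have -> : x ^+ a = x * x ^+ (2 * n) by rewrite exprS.
have alg (y u e' q : R) : u != 0 -> y != 0 ->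
    u ^+ 2 * y * q * (e' / (u * y)) = e' * (u * q).
  by move=> u0 y0; field; rewrite u0 y0.
by rewrite exprD alg// ?expf_neq0 ?gt_eqF.
Qed.

End GaussTails.

Lemma eq_in_law_tail (R : realType) d (T : measurableType d) d'
    (T' : measurableType d') (P : probability T R) (Q : probability T' R)
    (X : T -> R) (Y : T' -> R) :
  measurable_fun setT X -> measurable_fun setT Y ->
  (forall s, P [set w | s < X w] = Q [set w | s < Y w]) -> eq_in_law P Q X Y.
Proof.
move=> mX mY XY B mB.
pose X' : {mfun T >-> R} := mfun_Sub (mem_set mX).
pose Y' : {mfun T' >-> R} := mfun_Sub (mem_set mY).
have GI : setI_closed (@RGenOInfty.G R).
  move=> _ _ [x ->] [y ->]; exists (Num.max x y).
  by apply/seteqP; split=> z /=; rewrite !in_itv/= !andbT gt_max; [move=> [-> ->]|move/andP].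
apply: (@measure_unique _ R _ (@RGenOInfty.G R) (fun k => `]- k%:R, +oo[%classic)
  (RGenOInfty.measurableE R) GI _ _ (distribution P X') (distribution Q Y')) => //.
- by move=> k; exists (- k%:R).
- apply/seteqP; split=> // x _; exists (Num.truncn `|x|).+1 => //=.
  rewrite in_itv/= andbT ltrNl (le_lt_trans (ler_norm _))// normrN.
  exact: truncnS_gt.
- move=> _ [x ->].
  have preE (U : Type) (f : U -> R) : f @^-1` `]x, +oo[ = [set w | x < f w].
    by apply/seteqP; split=> w; rewrite /= in_itv/= andbT.
  by have := XY x; rewrite -(preE _ X) -(preE _ Y); apply.
- by move=> k; rewrite ltey_eq fin_num_measure.
Qed.

Lemma mutually_independent2 (R : realType) (I : choiceType) d (T : measurableType d)
    (P : probability T R) (X : I -> T -> R) (i j : I) (A B : set R) :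
  mutually_independent P X -> i != j -> measurable A -> measurable B ->
  P (X i @^-1` A `&` X j @^-1` B) = (P (X i @^-1` A) * P (X j @^-1` B))%E.
Proof.
move=> iX ij mA mB.
have := iX [fset i; j]%fset (fun k => if k == i then A else B).
rewrite big_fsetU1/= ?inE ?ij// big_seq_fset1 eqxx eq_sym (negbTE ij).
rewrite (_ : \bigcap_(_ in _) _ = X i @^-1` A `&` X j @^-1` B).
  by apply=> k; case: ifP.
apply/seteqP; split=> w /=.
  move=> h; split.
    by have := h i; rewrite /= eqxx; apply; rewrite !inE eqxx.
  by have := h j; rewrite /= eq_sym (negbTE ij); apply; rewrite !inE eqxx orbT.
move=> [wA wB] k /=; rewrite !inE => /orP[/eqP ->|/eqP ->]; first by rewrite eqxx.
by rewrite eq_sym (negbTE ij).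
Qed.

(** * Normalised tails and their concentration *)

Section GaussConcentration.
Context {R : realType}.
Local Notation mu := (@lebesgue_measure R).
Local Notation ck n := (fine (@gauss_tail R n 0)).

Lemma normal_prob_abs_tail (b : R) : 0 <= b ->
  normal_prob 0 1 [set x : R | b < `|x|] =
  ((2 * normal_peak 1)%:E * gauss_tail 0 b)%E.
Proof.
move=> b0.
have pdfE : normal_pdf 0 1 = (fun x : R => normal_peak 1 * gauss x).
  rewrite normal_pdfE ?oner_neq0//; apply/funext => x.
  by rewrite /normal_fun /gauss subr0 expr1n mulNr.
have cpdf : continuous (normal_pdf 0 1 : R -> R).
  by apply: continuous_normal_pdf; exact: oner_neq0.
have mpdf : measurable_fun setT (EFin \o normal_pdf 0 1 : R -> \bar R).
  by apply/measurable_EFinP; exact: continuous_measurable_fun.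
rewrite /normal_prob.
have -> : [set x : R | b < `|x|] = `]-oo, - b[ `|` `]b, +oo[.
  apply/seteqP; split=> x /=; rewrite !in_itv/= andbT lter_normr.
    by move=> /orP[bx|bx]; [right|left; rewrite ltrNr].
  by move=> [xb|bx]; apply/orP; [right; rewrite ltrNr|left].
rewrite ge0_integral_setU//=; last 3 first.
- exact: measurable_funTS.
- by move=> x _; rewrite lee_fin normal_pdf_ge0.
- apply/disj_setPS => x [] /=; rewrite !in_itv/= andbT => xb bx.
  by have h : b < - b := lt_trans bx xb; lra.
have eqR : (\int[mu]_(x in `]b, +oo[) (normal_pdf 0 1 x)%:E =
    (normal_peak 1)%:E * gauss_tail 0 b)%E.
  rewrite /gauss_tail -ge0_integralZl//; last 3 first.
  - by apply/measurable_EFinP/measurable_funTS; exact: measurable_gauss_weight.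
  - by move=> x _; rewrite lee_fin mulr_ge0// ?gauss_ge0.
  - by rewrite lee_fin normal_peak_ge0.
  by apply: eq_integral => x _; rewrite pdfE -EFinM mul1r.
have -> : (\int[mu]_(x in `]-oo, (- b)%R[) (normal_pdf 0 1 x)%:E =
    \int[mu]_(x in `]b, +oo[) (normal_pdf 0 1 x)%:E)%E.
  rewrite integral_itv_bndo_bndc; last exact: measurable_funTS.
  rewrite ge0_integration_by_substitutionNy; last 2 first.
  - exact: continuous_subspaceT.
  - by move=> x _; exact: normal_pdf_ge0.
  rewrite integral_itv_obnd_cbnd; last exact: measurable_funTS.
  by apply: eq_integral => x _ /=; rewrite pdfE /gauss sqrrN.
by rewrite eqR EFinM -muleA mule_natl mule2n.
Qed.

(** The Gaussian integral is read off from the total mass of [normal_prob 0 1]: take b = 0 in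
    [normal_prob_abs_tail], the point 0 being null. *)
Lemma gauss_tail00 : gauss_tail 0 (0 : R) = ((2 * normal_peak 1)^-1)%:E.
Proof.
have := @normal_prob_abs_tail 0 (lexx _).
have k0 : 0 < 2 * normal_peak (1 : R) by rewrite mulr_gt0// normal_peak_gt0 ?oner_neq0.
have -> : [set x : R | 0 < `|x|] = setT `\ 0.
  by apply/seteqP; split=> x /=; rewrite normr_gt0; [move/eqP|move=> [_ /eqP]].
rewrite /normal_prob integral_setD1; last 2 first.
- exact: measurableD.
- by apply/measurable_EFinP/measurable_funTS; exact: measurable_normal_pdf.
rewrite integral_normal_pdf// ?oner_neq0// => h.
have : (((2 * normal_peak (1:R))^-1)%:E * 1 = gauss_tail 0 0)%E.
  by rewrite h muleA -EFinM mulVf ?mul1e// gt_eqF.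
by rewrite mule1.
Qed.

Lemma gauss_tail0_fin n : gauss_tail n (0 : R) = (ck n)%:E /\ 0 < ck n.
Proof.
elim: n => [|n [IH1 IH2]].
  rewrite gauss_tail00/= invr_gt0; split=> //.
  by rewrite mulr_gt0// normal_peak_gt0 ?oner_neq0.
by rewrite gauss_tailS0 IH1 -EFinM/=; split=> //; rewrite mulr_gt0.
Qed.

Lemma ckS n : ck n.+1 = (2 * n).+1%:R * ck n.
Proof. by rewrite gauss_tailS0 (gauss_tail0_fin n).1 -EFinM. Qed.

(** The probability that ln W exceeds s when W has law nu_n; the logarithmic scale turns the factors
    exp(-E/(2n+1)) into shifts of s. *)
Definition gauss_ratio (n : nat) (s : R) : R :=
  fine (gauss_tail n (expR s)) / ck n.

Lemma gauss_tail_le n (b c : R) : b <= c -> (gauss_tail n c <= gauss_tail n b)%E.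
Proof.
move=> bc; apply: ge0_subset_integral => //.
- by apply/measurable_EFinP/measurable_funTS; exact: measurable_gauss_weight.
- by move=> x _; rewrite lee_fin mulr_ge0 ?gauss_ge0// exprM exprn_ge0// sqr_ge0.
- by move=> x /=; rewrite !in_itv/= !andbT; exact: le_lt_trans.
Qed.

Lemma gauss_tail_fin_num n (b : R) : 0 <= b -> gauss_tail n b \is a fin_num.
Proof.
move=> b0; rewrite ge0_fin_numE ?gauss_tail_ge0//.
by rewrite (le_lt_trans (gauss_tail_le n b0))// (gauss_tail0_fin n).1 ltry.
Qed.

Lemma gauss_tailE n s : gauss_tail n (expR s) = (ck n * gauss_ratio n s)%:E.
Proof.
rewrite /gauss_ratio mulrC mulfVK ?fineK ?gauss_tail_fin_num ?expR_ge0//.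
by rewrite gt_eqF// (gauss_tail0_fin n).2.
Qed.

Lemma gauss_ratio_ge0 n s : 0 <= gauss_ratio n s.
Proof.
rewrite divr_ge0 ?fine_ge0 ?gauss_tail_ge0//.
Qed.

Lemma gauss_ratio_le1 n s : gauss_ratio n s <= 1.
Proof.
rewrite /gauss_ratio ler_pdivrMr ?mul1r ?(gauss_tail0_fin n).2//.
by rewrite fine_le ?gauss_tail_fin_num ?expR_ge0// gauss_tail_le// expR_ge0.
Qed.

Lemma gauss_ratio_nonincreasing n s t : s <= t ->
  gauss_ratio n t <= gauss_ratio n s.
Proof.
move=> st; apply: ler_wpM2r; first by rewrite invr_ge0 fine_ge0 ?gauss_tail_ge0.
apply: fine_le; [exact: gauss_tail_fin_num (expR_ge0 _)..|].
by apply: gauss_tail_le; rewrite ler_expR.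
Qed.

Lemma measurable_gauss_ratio n : measurable_fun setT (gauss_ratio n).
Proof.
apply: nonincreasing_measurable; first exact: measurableT.
by move=> s t; exact: gauss_ratio_nonincreasing.
Qed.

(** The normalising constants satisfy [ckS], whose factor 2n+1 cancels the one in
    [gauss_tail_exponential]. *)
Lemma gauss_ratio_exponential (nu : probability (measurableTypeR R) R) n s :
  (forall A, measurable A -> nu A = exponential_prob 1 A) ->
  (\int[nu]_t (gauss_ratio n.+1 (s + t / (2 * n).+1%:R))%:E =
   (gauss_ratio n s)%:E)%E.
Proof.
move=> nuE; have := gauss_tail_exponential n s nuE.
have c0 := (gauss_tail0_fin n).2.
under eq_integral do rewrite gauss_tailE EFinM.
rewrite ge0_integralZl//; last 3 first.
- apply/measurable_EFinP; apply: measurableT_comp; first exact: measurable_gauss_ratio.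
  by apply: measurable_funD => //; exact: measurable_funM.
- by move=> t _; rewrite lee_fin gauss_ratio_ge0.
- by rewrite lee_fin ltW// (gauss_tail0_fin n.+1).2.
rewrite gauss_tailE ckS -EFinM mulrA [X in (X%:E * _)%E = _]mulrC => h.
have a0 : ck n * (2 * n).+1%:R != 0 by rewrite mulf_neq0 ?gt_eqF.
have := congr1 (fun z => ((ck n * (2 * n).+1%:R)^-1)%:E * z)%E h.
rewrite muleA -!EFinM mulVf// mul1e => ->; congr EFin.
by rewrite mulrA [_ * ck n]mulrC mulVf// mul1r.
Qed.

(* The two moments of x^2 under the density proportional to
   x^(2n) exp(-x^2/2) come from [gauss_tailS0]. *)
Lemma gauss_variance n :
  (\int[mu]_(x in `]0%R, +oo[) ((x ^+ 2 / (2 * n).+1%:R - 1) ^+ 2 *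
     (x ^+ (2 * n) * gauss x))%:E = (2 * ck n / (2 * n).+1%:R)%:E)%E.
Proof.
set r : R := (2 * n).+1%:R.
have r0 : 0 < r by rewrite /r.
set A := (\int[mu]_(x in _) _)%E.
have w0 k (x : R) : 0 <= x ^+ (2 * k) * gauss x.
  by rewrite mulr_ge0 ?gauss_ge0// exprM exprn_ge0// sqr_ge0.
have mw k : measurable_fun (`]0%R, +oo[%classic : set R) (EFin \o (fun x : R => x ^+ (2 * k) * gauss x)).
  by apply/measurable_EFinP/measurable_funTS; exact: measurable_gauss_weight.
have mv : measurable_fun (`]0%R, +oo[%classic : set R) (fun x : R => ((x ^+ 2 / r - 1) ^+ 2 *
     (x ^+ (2 * n) * gauss x))%:E).
  apply/measurable_EFinP/measurable_funTS; apply: measurable_funM; last first.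
    exact: measurable_gauss_weight.
  by apply: measurable_funX; apply: measurable_funB => //; apply: measurable_funM => //; exact: exprn_measurable.
have mcw k (c : R) : measurable_fun (`]0%R, +oo[%classic : set R)
    (fun x : R => (c * (x ^+ (2 * k) * gauss x))%:E).
  apply/measurable_EFinP/measurable_funTS; apply: measurable_funM => //.
  exact: measurable_gauss_weight.
have ZT k (c : R) : 0 <= c -> (c%:E * gauss_tail k 0 =
    \int[mu]_(x in `]0%R, +oo[) (c * (x ^+ (2 * k) * gauss x))%:E)%E.
  move=> c0; rewrite /gauss_tail -ge0_integralZl//; first exact: mw.
  by move=> x _; rewrite lee_fin.
(* The square is expanded with its negative term moved to the left, so that only integrals of
   nonnegative functions are added. The subtraction comes after finiteness of [A] is known. *)
have E : (A + (2 / r)%:E * gauss_tail n.+1 0 =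
    (r ^- 2)%:E * gauss_tail n.+2 0 + gauss_tail n 0)%E.
  rewrite !ZT ?invr_ge0 ?sqr_ge0 ?divr_ge0 ?(ltW r0)// /gauss_tail /A.
  have r2 : 0 <= 2 / r by rewrite divr_ge0 ?(ltW r0).
  have r3 : 0 <= r ^- 2 by rewrite invr_ge0 sqr_ge0.
  rewrite -[LHS]ge0_integralD//; last 3 first.
  - by move=> x _; rewrite lee_fin mulr_ge0// sqr_ge0.
  - by move=> x _; rewrite lee_fin mulr_ge0.
  - exact: mcw.
  rewrite -[RHS]ge0_integralD//; last 4 first.
  - by move=> x _; rewrite lee_fin mulr_ge0.
  - exact: mcw.
  - by move=> x _; rewrite lee_fin w0.
  - exact: mw.
  apply: eq_integral => x _; rewrite -!EFinD; congr EFin.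
  have alg (y z q p : R) : q != 0 -> (z ^+ 2 / q - 1) ^+ 2 * (y * p) +
      2 / q * (z ^+ 2 * y * p) = q ^- 2 * (z ^+ 2 * (z ^+ 2 * y) * p) + y * p.
    by move=> q0; field.
  by rewrite !mulnS !exprD alg// gt_eqF.
move: E; rewrite (gauss_tail0_fin n).1 (gauss_tail0_fin n.+1).1
  (gauss_tail0_fin n.+2).1 !ckS -!EFinM -!EFinD => E.
have Afin : A \is a fin_num.
  have A0 : (0 <= A)%E.
    by apply: integral_ge0 => x _; rewrite lee_fin mulr_ge0// sqr_ge0.
  rewrite ge0_fin_numE// (@le_lt_trans _ _ (A + (2 / r * ((2 * n).+1%:R * ck n))%:E)%E)//.
    rewrite leeDl// lee_fin !mulr_ge0// ?invr_ge0 ?(ltW r0)//.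
    exact: ltW (gauss_tail0_fin n).2.
  by rewrite E ltry.
move: E; rewrite -(fineK Afin) -EFinD => -[E].
congr EFin; apply: (addIr (2 / r * ((2 * n).+1%:R * ck n))); rewrite E.
have -> : (2 * n.+1).+1%:R = 2 + r :> R by rewrite /r mulnS -addnS natrD.
have alg (c q : R) : 0 < q ->
    q ^- 2 * ((2 + q) * (q * c)) + c = 2 * c / q + 2 / q * (q * c).
  by move=> q0; field; rewrite gt_eqF.
exact: alg.
Qed.

(** On [B] the weight (x^2/(2n+1) - 1)^2 is at least k^2, and its mean under nu_n is 2/(2n+1) by
    [gauss_variance]. A general [B] lets the upper and lower tails share the estimate. *)
Lemma gauss_chebyshev n (B : set R) (k : R) : measurable B ->
  B `<=` `]0, +oo[ -> 0 < k ->
  (forall x, B x -> k <= `|x ^+ 2 / (2 * n).+1%:R - 1|) ->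
  (\int[mu]_(x in B) (x ^+ (2 * n) * gauss x)%:E <=
   (ck n * (2 / (k ^+ 2 * (2 * n).+1%:R)))%:E)%E.
Proof.
move=> mB B0 k0 hB.
set r : R := (2 * n).+1%:R.
have r0 : 0 < r by rewrite /r.
have w0 (x : R) : 0 <= x ^+ (2 * n) * gauss x.
  by rewrite mulr_ge0 ?gauss_ge0// exprM exprn_ge0// sqr_ge0.
have k2 : 0 < k ^+ 2 by rewrite exprn_gt0.
rewrite (_ : ck n * _ = (k ^+ 2)^-1 * (2 * ck n / r)); last first.
  by field; rewrite !gt_eqF.
rewrite EFinM lee_pdivlMl//.
rewrite -gauss_variance -ge0_integralZl//; last 3 first.
- by apply/measurable_EFinP/measurable_funTS; exact: measurable_gauss_weight.
- by move=> x _; rewrite lee_fin w0.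
- by rewrite lee_fin ltW.
have mv (D : set R) : measurable_fun D (fun x : R => ((x ^+ 2 / r - 1) ^+ 2 *
     (x ^+ (2 * n) * gauss x))%:E).
  apply/measurable_EFinP/measurable_funTS; apply: measurable_funM; last first.
    exact: measurable_gauss_weight.
  by apply: measurable_funX; apply: measurable_funB => //; apply: measurable_funM => //; exact: exprn_measurable.
apply: (@le_trans _ _ (\int[mu]_(x in B) ((x ^+ 2 / r - 1) ^+ 2 *
     (x ^+ (2 * n) * gauss x))%:E)%E); last first.
  apply: ge0_subset_integral => //; first exact: mv.
  by move=> x _; rewrite lee_fin mulr_ge0// sqr_ge0.
apply: ge0_le_integral => //.
- by move=> x _; rewrite -EFinM lee_fin mulr_ge0// ltW.
- apply: measurable_funeM; apply/measurable_EFinP/measurable_funTS.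
  exact: measurable_gauss_weight.
- exact: mv.
- move=> x /hB kx; rewrite -EFinM lee_fin ler_wpM2r//.
  by rewrite -[leRHS]real_normK ?num_real// lerXn2r ?nnegrE// ltW.
Qed.

Let expR_shift n u : expR (2^-1 * ln (2 * n).+1%:R + u) ^+ 2 =
  (2 * n).+1%:R * expR (2 * u) :> R.
Proof.
rewrite -expRM_natl mulrDr mulrA mulfV ?pnatr_eq0// mul1r expRD lnK//.
by rewrite posrE.
Qed.

(** Above the threshold, x^2/(2n+1) exceeds exp(2u), hence 1 by at least exp(2v) - 1. The bound is
    uniform in u >= v, because later u varies with n. *)
Lemma gauss_ratio_upper n (u v : R) : 0 < v -> v <= u ->
  gauss_ratio n (2^-1 * ln (2 * n).+1%:R + u) <=
  2 / ((expR (2 * v) - 1) ^+ 2 * (2 * n).+1%:R).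
Proof.
move=> v0 vu; set b := 2^-1 * _ + u.
have r0 : (0 : R) < (2 * n).+1%:R by [].
have k0 : 0 < expR (2 * v) - 1 by rewrite subr_gt0 expR_gt1 mulr_gt0.
have := @gauss_chebyshev n `]expR b, +oo[ (expR (2 * v) - 1).
rewrite -/(gauss_tail n (expR b)) gauss_tailE lee_fin.
rewrite ler_pM2l ?(gauss_tail0_fin n).2//; apply => //.
- by move=> x /=; rewrite !in_itv/= !andbT; apply: lt_trans; exact: expR_gt0.
- move=> x; rewrite /= in_itv/= andbT => bx.
  rewrite (le_trans _ (ler_norm _))// lerD2r ler_pdivlMr// mulrC.
  rewrite (@le_trans _ _ (expR b ^+ 2))//.
    by rewrite expR_shift ler_pM2l// ler_expR ler_pM2l.
  by rewrite lerXn2r ?nnegrE ?expR_ge0// ltW// (lt_trans (expR_gt0 b)).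
Qed.

(** The mirror estimate on ]0, exp b], whose mass is the complement of the tail: there x^2/(2n+1)
    falls short of 1 by at least 1 - exp(-2v). *)
Lemma gauss_ratio_lower n (u v : R) : 0 < v -> u <= - v ->
  1 - gauss_ratio n (2^-1 * ln (2 * n).+1%:R + u) <=
  2 / ((1 - expR (- (2 * v))) ^+ 2 * (2 * n).+1%:R).
Proof.
move=> v0 vu; set b := 2^-1 * _ + u.
have r0 : (0 : R) < (2 * n).+1%:R by [].
have c0 := (gauss_tail0_fin n).2.
have k0 : 0 < 1 - expR (- (2 * v)) by rewrite subr_gt0 expR_lt1 oppr_lt0 mulr_gt0.
have := @gauss_chebyshev n `]0, expR b] (1 - expR (- (2 * v))).
have -> : (\int[mu]_(x in `]0%R, expR b]) (x ^+ (2 * n) * gauss x)%:E =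
    (ck n * (1 - gauss_ratio n b))%:E)%E.
  have : (gauss_tail n 0 = \int[mu]_(x in `]0%R, expR b]) (x ^+ (2 * n) * gauss x)%:E
      + gauss_tail n (expR b))%E.
    rewrite /gauss_tail -ge0_integral_setU//=.
    - congr (integral _ _ _); apply/seteqP; split=> x /=; rewrite !in_itv/= !andbT.
        by case: (leP x (expR b)) => [xb ->|bx _]; [left|right].
      by move=> [/andP[]//|]; apply: lt_trans; exact: expR_gt0.
    - by apply/measurable_EFinP/measurable_funTS; exact: measurable_gauss_weight.
    - by move=> x _; rewrite lee_fin mulr_ge0 ?gauss_ge0// exprM exprn_ge0// sqr_ge0.
    - apply/disj_setPS => x [] /=; rewrite !in_itv/= andbT => /andP[_ xb] bx.
      by have := lt_le_trans bx xb; rewrite ltxx.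
  set J := (\int[mu]_(x in _) _)%E; rewrite gauss_tailE (gauss_tail0_fin n).1 => h.
  have Jfin : J \is a fin_num.
    have J0 : (0 <= J)%E.
      by apply: integral_ge0 => x _; rewrite lee_fin mulr_ge0 ?gauss_ge0// exprM exprn_ge0// sqr_ge0.
    rewrite ge0_fin_numE// (@le_lt_trans _ _ (ck n)%:E) ?ltry//.
    by rewrite h leeDl// lee_fin mulr_ge0 ?gauss_ratio_ge0// ltW.
  move: h; rewrite -(fineK Jfin) -EFinD => -[h]; congr EFin.
  by rewrite mulrBr mulr1 {1}h addrK.
rewrite lee_fin ler_pM2l//; apply => //.
- by move=> x /=; rewrite !in_itv/= !andbT => /andP[].
- move=> x; rewrite /= in_itv/= => /andP[x0 xb].
  rewrite distrC (le_trans _ (ler_norm _))// lerB// ler_pdivrMr// mulrC.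
  rewrite (@le_trans _ _ (expR b ^+ 2))//.
    by rewrite lerXn2r ?nnegrE ?expR_ge0// ltW.
  by rewrite expR_shift ler_pM2l// ler_expR -mulrN ler_pM2l.
Qed.

End GaussConcentration.

(** * The law of the limit *)

Section SeriesLaw.
Context {R : realType} d (T : measurableType d) d' (T' : measurableType d').
Variables (P : probability T R) (Q : probability T' R).
Variables (Z : {RV P >-> R}) (E : nat -> {RV Q >-> R}).
Hypothesis nZ : standard_normal Z.
Hypothesis iE : mutually_independent Q (fun j => (E j : T' -> R)).
Hypothesis eE : forall j, standard_exponential (E j).

Let mE j : measurable_fun setT (E j : T' -> R).
Proof. exact: measurable_funPT. Qed.

Let S n w : R := \sum_(j < n) E j w / (2 * j).+1%:R.

Let mS n : measurable_fun setT (S n).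
Proof. by apply: measurable_sum => j; apply: measurable_funM. Qed.

Let mlnZ : measurable_fun setT (fun w => ln `|Z w|).
Proof.
apply: (measurableT_comp (@measurable_ln R)); apply: measurableT_comp => //.
Qed.

(** The indices are grouped by the Boolean [n <= j]; the partial sum uses one group and [E n]
    belongs to the other. *)
Let indep_S_E n (A B : set R) : measurable A -> measurable B ->
  Q (S n @^-1` A `&` E n @^-1` B) = (Q (S n @^-1` A) * Q (E n @^-1` B))%E.
Proof.
move=> mA mB.
pose phi (b : bool) (f : nat -> R) : R :=
  if b then f n else \sum_(j < n) f j / (2 * j).+1%:R.
have := @independent_groups R nat bool _ T' Q (fun j => E j : T' -> R)
  (fun j => (n <= j)%N) mE iE phi.
have H : forall b : bool, measurable_fun
    [set: pathType R ((fun j => (n <= j)%N) @^-1` [set b])] (phi b).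
  case; rewrite /phi; first by apply: measurable_coord => /=; rewrite leqnn.
  apply: measurable_sum => j; apply: measurable_funM => //.
  by apply: measurable_coord => /=; rewrite leqNgt ltn_ord.
move=> /(_ H) iphi.
exact: (mutually_independent2 (i := false) (j := true) iphi).
Qed.

Let law_normal s : P [set w | s < ln `|Z w|] = (gauss_ratio 0 s)%:E.
Proof.
have -> : P [set w | s < ln `|Z w|] = normal_prob 0 1 [set x : R | s < ln `|x|].
  rewrite -nZ// -[X in measurable X]setTI.
  have -> : [set x : R | s < ln `|x|] = (fun x : R => ln `|x|) @^-1` `]s, +oo[.
    by apply/seteqP; split=> x; rewrite /= in_itv/= andbT.
  have m : measurable_fun setT (fun x : R => ln `|x|).
    by apply: (measurableT_comp (@measurable_ln R)).
  exact: m.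
transitivity (normal_prob 0 1 [set x : R | expR s < `|x|]).
  have m0 (b : R -> R) : measurable_fun setT b -> forall t, measurable [set x | t < b x].
    move=> mb t; have -> : [set x : R | t < b x] = b @^-1` `]t, +oo[.
      by apply/seteqP; split=> x; rewrite /= in_itv/= andbT.
    by rewrite -[X in measurable X]setTI; exact: mb.
  have m1 : measurable [set x : R | s < ln `|x|].
    by apply: m0; apply: (measurableT_comp (@measurable_ln R)).
  have m2 : measurable [set x : R | expR s < `|x|] by exact: m0.
  have mp (D : set R) : measurable_fun D (fun x : R => (normal_pdf 0 1 x)%:E).
    by apply/measurable_EFinP/measurable_funTS; exact: measurable_normal_pdf.
  (* The origin is removed from both sets: [ln 0 = 0] may put it in the first one, whereas it never
     lies in the second. *)
  rewrite /normal_prob -(@integral_setD1 _ _ 0)//; last exact: measurableD.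
  rewrite -[RHS](@integral_setD1 _ _ 0)//; last exact: measurableD.
  congr (integral _ _ _); apply/seteqP; split=> x /= [sx x0]; split=> //.
    by move: sx; rewrite -ltr_expR lnK// posrE normr_gt0; exact/eqP.
  by rewrite -ltr_expR lnK// posrE normr_gt0; exact/eqP.
rewrite normal_prob_abs_tail ?expR_ge0// gauss_tailE gauss_tail00 -EFinM/=.
by rewrite mulrA mulfV ?mul1r// gt_eqF// mulr_gt0// normal_peak_gt0 ?oner_neq0.
Qed.

(** The iterated identity in law: ln W_n - S_n has the tail of ln|Z|. In the induction step, [E n]
    is integrated out with the partial sum frozen, by independence. *)
Let mix n s : (\int[Q]_w (gauss_ratio n (s + S n w))%:E = (gauss_ratio 0 s)%:E)%E.
Proof.
elim: n => [|n IH].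
  rewrite /S; under eq_integral do rewrite big_ord0 addr0.
  by rewrite [LHS]integral_cst//= probability_setT mule1.
pose f (z : R * R) := (gauss_ratio n.+1 (s + z.1 + z.2 / (2 * n).+1%:R))%:E.
have mf : measurable_fun setT f.
  apply/measurable_EFinP; apply: measurableT_comp; first exact: measurable_gauss_ratio.
  by apply: measurable_funD; [exact: measurable_funD|exact: measurable_funM].
have f0 z : (0 <= f z)%E by rewrite lee_fin gauss_ratio_ge0.
rewrite -IH; transitivity (\int[Q]_w f (S n w, E n w))%E.
  by apply: eq_integral => w _; rewrite /f /S big_ord_recr/= addrA.
rewrite (independent_integral (mS n) (mE n) (@indep_S_E n) mf f0).
apply: eq_integral => w _.
have mX : @measurable_fun _ _ T' (measurableTypeR R) setT (E n) by exact: mE.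
pose X : {mfun T' >-> measurableTypeR R} :=
  @mfun_Sub _ _ T' (measurableTypeR R) (E n) (mem_set mX).
pose nu : probability (measurableTypeR R) R := distribution Q X.
rewrite -(@gauss_ratio_exponential R nu)//.
rewrite ge0_integral_distribution; first by [].
  apply/measurable_EFinP; apply: measurableT_comp; first exact: measurable_gauss_ratio.
  by apply: measurable_funD; [exact: measurable_cst|exact: measurable_funM].
  by move=> y; rewrite lee_fin gauss_ratio_ge0.
by move=> A mA; exact: eE.
Qed.

(** Where V > s, the point [s + S n w] eventually lies below ln(2n+1)/2 by a fixed margin, so
    [gauss_ratio] tends to 1 there; where V < s it tends to 0. Since the means are fixed by [mix],
    Fatou's lemma bounds Q(V > s) and Q(V < s) from above, and these two bounds determine the
    law. *)
Lemma eq_in_law_limit (V : T' -> R) : measurable_fun setT V ->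
  {ae Q, forall w, (fun n => S n w - 2^-1 * ln (2 * n).+1%:R) @ \oo --> - V w} ->
  eq_in_law P Q (fun w => ln `|Z w|) V.
Proof.
move=> mV cV.
have mset d0 (U : measurableType d0) (g : U -> R) s : measurable_fun setT g ->
    measurable [set w | s < g w] /\ measurable [set w | g w < s].
  move=> mg; split.
    have -> : [set w | s < g w] = g @^-1` `]s, +oo[.
      by apply/seteqP; split=> w; rewrite /= in_itv/= andbT.
    by rewrite -[X in measurable X]setTI; exact: mg.
  have -> : [set w | g w < s] = g @^-1` `]-oo, s[.
    by apply/seteqP; split=> w; rewrite /= in_itv/=.
  by rewrite -[X in measurable X]setTI; exact: mg.
pose r n : R := (2 * n).+1%:R.
have cvgr (c : R) : 0 < c -> (fun n => 2 / (c * r n)) @ \oo --> (0 : R).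
  move=> c0; have -> : (fun n => 2 / (c * r n)) = (fun n => (2 / c) * (r n)^-1).
    by apply/funext => n; rewrite invfM mulrA.
  rewrite -(mulr0 (2 / c)); apply: cvgM; first exact: cvg_cst.
  apply: (squeeze_cvgr (f := cst 0) (h := fun n : nat => n.+1%:R^-1)).
  - apply: nearW => n; rewrite invr_ge0 ler0n/= lef_pV2 ?posrE// ler_nat ltnS.
    by rewrite leq_pmull.
  - exact: cvg_cst.
  - exact: cvg_harmonic.
have mH n s : measurable_fun setT (fun w => gauss_ratio n (s + S n w)).
  apply: measurableT_comp; first exact: measurable_gauss_ratio.
  exact: measurable_funD.
(* The indicator of [A] is at most the lower limit of the [f n]: that limit is 1 on [A] and
   nonnegative elsewhere. *)
have fatou_bound (f : nat -> T' -> R) (A : set T') (p : R) : measurable A ->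
    (forall n, measurable_fun setT (f n)) -> (forall n w, 0 <= f n w) ->
    (forall n, (\int[Q]_w (f n w)%:E = p%:E)%E) ->
    {ae Q, forall w, A w -> (f ^~ w) @ \oo --> (1 : R)} -> (Q A <= p%:E)%E.
  move=> mA mf f0 fp fA.
  pose g n w := (f n w)%:E.
  have mg n : measurable_fun setT (g n) by exact/measurable_EFinP.
  have g0 n w : setT w -> (0 <= g n w)%E by rewrite lee_fin.
  have := @fatou _ _ _ Q setT measurableT g mg g0.
  have -> : (fun n => \int[Q]_w g n w)%E = cst p%:E.
    by apply/funext => n; exact: fp.
  have [-> _] := cvg_limn_einf_sup (cvg_cst (p%:E) : cst p%:E @ \oo --> p%:E).
  have einf0 w : (0 <= limn_einf (g ^~ w))%E.
    rewrite limn_einf_lim; apply: lime_ge; first exact: is_cvg_einfs.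
    by apply: nearW => n; apply: le_ereal_inf_tmp => _ [m _ <-]; rewrite lee_fin.
  apply: le_trans; rewrite -[Q A](_ : (\int[Q]_w (\1_A w)%:E = _)%E); last first.
    by rewrite integral_indic// setIT.
  apply: ae_ge0_le_integral => //.
  - exact/measurable_EFinP/measurable_indic.
  - apply: measurableT_comp => //; apply: measurable_fun_limn_esup => n.
    exact: measurableT_comp.
  apply: filterS fA => w fA _; rewrite indicE; case: (boolP (w \in A)) => wA.
    have gw : g ^~ w @ \oo --> (1 : R)%:E.
      by apply: cvg_EFin; [exact: nearW|apply: fA; exact: set_mem].
    by have [-> _] := cvg_limn_einf_sup gw.
  exact: einf0.
have lower s : (Q [set w | (s < V w)%R] <= (gauss_ratio 0 s)%:E)%E.
  apply: (fatou_bound (fun n w => gauss_ratio n (s + S n w))) => //.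
  - by have [] := mset _ _ V s mV.
  - by move=> n w; exact: gauss_ratio_ge0.
  apply: filterS cV => w cw /= sV.
  (* Half of the gap between [V w] and [s] absorbs the error of convergence; the other half is the
     margin fed to the concentration bound. *)
  pose v := (V w - s) / 2; have v0 : 0 < v by rewrite divr_gt0// subr_gt0.
  have k0 : 0 < (1 - expR (- (2 * v))) ^+ 2.
    by rewrite exprn_gt0// subr_gt0 expR_lt1 oppr_lt0 mulr_gt0.
  apply: (squeeze_cvgr (f := fun n => 1 - 2 / ((1 - expR (- (2 * v))) ^+ 2 * r n))
    (h := cst 1)); last 2 first.
  - by rewrite -[X in _ --> X]subr0; apply: cvgB; [exact: cvg_cst|exact: cvgr].
  - exact: cvg_cst.
  have nv : - V w < - v - s by rewrite /v; lra.
  have [N _ hN] : \forall n \near \oo, S n w - 2^-1 * ln (2 * n).+1%:R <= - v - s.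
    exact: (cvgr_le _ cw).
  exists N => // n /hN /= hn; apply/andP; split; last first.
    exact: gauss_ratio_le1.
  rewrite lerBlDr -lerBlDl.
  have -> : s + S n w = 2^-1 * ln (2 * n).+1%:R + (s + (S n w - 2^-1 * ln (2 * n).+1%:R)) by ring.
  apply: gauss_ratio_lower => //; move: hn => /=; lra.
have upper s : (Q [set w | (V w < s)%R] <= (1 - gauss_ratio 0 s)%:E)%E.
  apply: (fatou_bound (fun n w => 1 - gauss_ratio n (s + S n w))) => //.
  - by have [] := mset _ _ V s mV.
  - by move=> n; apply: measurable_funB.
  - by move=> n w; rewrite subr_ge0 gauss_ratio_le1.
  - move=> n.
    have : (\int[Q]_w (1 - gauss_ratio n (s + S n w))%:E +
        \int[Q]_w (gauss_ratio n (s + S n w))%:E = 1)%E.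
      rewrite -ge0_integralD//=; last 4 first.
      - by move=> w _; rewrite lee_fin subr_ge0 gauss_ratio_le1.
      - by apply/measurable_EFinP; apply: measurable_funB.
      - by move=> w _; rewrite lee_fin gauss_ratio_ge0.
      - exact/measurable_EFinP.
      under eq_integral do rewrite -EFinD subrK.
      by rewrite [LHS]integral_cst//= probability_setT mule1.
    rewrite mix => h; rewrite EFinB -h addeK//.
  apply: filterS cV => w cw /= sV.
  pose v := (s - V w) / 2; have v0 : 0 < v by rewrite divr_gt0// subr_gt0.
  have k0 : 0 < (expR (2 * v) - 1) ^+ 2.
    by rewrite exprn_gt0// subr_gt0 expR_gt1 mulr_gt0.
  apply: (squeeze_cvgr (f := fun n => 1 - 2 / ((expR (2 * v) - 1) ^+ 2 * r n))
    (h := cst 1)); last 2 first.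
  - by rewrite -[X in _ --> X]subr0; apply: cvgB; [exact: cvg_cst|exact: cvgr].
  - exact: cvg_cst.
  have nv : v - s < - V w by rewrite /v; lra.
  have [N _ hN] : \forall n \near \oo, v - s <= S n w - 2^-1 * ln (2 * n).+1%:R.
    exact: (cvgr_ge _ cw).
  exists N => // n /hN /= hn; apply/andP; split; last first.
    by rewrite gerBl gauss_ratio_ge0.
  rewrite lerD2l lerN2.
  have -> : s + S n w = 2^-1 * ln (2 * n).+1%:R + (s + (S n w - 2^-1 * ln (2 * n).+1%:R)) by ring.
  apply: gauss_ratio_upper => //; move: hn => /=; lra.
apply: eq_in_law_tail => // s; apply/eqP; rewrite eq_le; apply/andP; split; last first.
  by rewrite law_normal; exact: lower.
(* The bound on Q(V < t) controls only Q(V >= t), so the strict inequality at [s] is approached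
   through levels t = s + 1/(k+1). *)
pose F k := [set w | s + k.+1%:R^-1 < ln `|Z w|].
have mF k : measurable (F k) by have [] := mset _ _ _ (s + k.+1%:R^-1) mlnZ.
have FE : [set w | s < ln `|Z w|] = \bigcup_k F k.
  apply/seteqP; split=> w /=; first by move=> /ltr_add_invr[k sk]; exists k.
  by move=> [k _]; apply: lt_trans; rewrite ltrDl invr_gt0.
have cF : (P \o F) @ \oo --> P (\bigcup_k F k).
  apply: nondecreasing_cvg_mu => //; first exact: bigcup_measurable.
  move=> m n mn; rewrite subsetEset => w; apply: le_lt_trans.
  by rewrite lerD2l lef_pV2 ?posrE// ler_nat.
rewrite FE -(cvg_lim _ cF)//; apply: lime_le; first by apply/cvg_ex; eexists; exact: cF.
apply: nearW => k /=; rewrite law_normal; set t := s + _.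
apply: (@le_trans _ _ (Q (~` [set w | V w < t]))).
  rewrite probability_setC; last by have [] := mset _ _ V t mV.
  have Qfin : Q [set w | V w < t] \is a fin_num.
    by apply: fin_num_measure; have [] := mset _ _ V t mV.
  have := upper t; rewrite -(fineK Qfin) -EFinB !lee_fin; lra.
apply: le_measure; rewrite ?inE.
- by apply: measurableC; have [] := mset _ _ V t mV.
- by have [] := mset _ _ V s mV.
move=> w /= /negP; rewrite -leNgt; apply: lt_le_trans.
by rewrite /t ltrDl invr_gt0.
Qed.

End SeriesLaw.

(** * Moments of the exponential law and convergence of the centred series *)

Lemma cvg_expn_expRN (R : realType) (k : nat) :
  (x ^+ k * expR (- x) : R) @[x --> +oo%R] --> (0 : R).
Proof.
(* The majorant comes from exp(x) >= 1 + x^(k+1)/(k+1)! for nonnegative x. *)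
have h : ((k.+1)`!%:R * x^-1 : R) @[x --> +oo%R] --> (0 : R).
  rewrite -(mulr0 (k.+1)`!%:R); apply: cvgM; [exact: cvg_cst|].
  apply/cvgrPdist_le => e e0; near=> x.
  have ex : e^-1 <= x by near: x; apply: nbhs_pinfty_ge; rewrite num_real.
  have x0 : 0 < x by rewrite (lt_le_trans _ ex)// invr_gt0.
  by rewrite sub0r normrN gtr0_norm ?invr_gt0// invf_ple.
apply: (squeeze_cvgr (f := cst 0) (h := fun x => (k.+1)`!%:R * x^-1)); last 2 first.
- exact: cvg_cst.
- exact: h.
near=> x.
have x0 : 0 < x by near: x; exact: nbhs_pinfty_gt.
rewrite mulr_ge0 ?expR_ge0 ?exprn_ge0 ?(ltW x0)//= expRN.
have f0 : (0 : R) < (k.+1)`!%:R by rewrite ltr0n fact_gt0.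
rewrite ler_pdivrMr ?expR_gt0// mulrAC ler_pdivlMr// -exprSr -ler_pdivrMl//.
apply: le_trans (expR_ge1Dxn k (ltW x0)).
by rewrite mulrC lerDr.
Unshelve. all: by end_near. Qed.

Section ExponentialMoments.
Context {R : realType}.
Local Notation mu := (@lebesgue_measure R).

Lemma integral_mul_expRN : (\int[mu]_(x in `[0%R, +oo[) (x * expR (- x))%:E = 1)%E.
Proof.
have D (x : R) : is_derive x 1 (fun x : R => - ((x + 1) * expR (- x))) (x * expR (- x)).
  apply: is_derive_eq.
  rewrite -[_ *: _]/(_ * _) -[X in - (_ + X)]/(_ * _); ring.
have c : continuous (fun x : R => x * expR (- x)).
  move=> x; apply: cvgM; first exact: cvg_id.
  by apply: (cvg_comp (fun x : R => - x) expR); [apply: cvgN; exact: cvg_id|exact: continuous_expR].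
have cF : continuous (fun x : R => - ((x + 1) * expR (- x))).
  move=> x; apply/differentiable_continuous/derivable1_diffP.
  by have [] := D x.
rewrite (@ge0_continuous_FTC2y _ _ (fun x : R => - ((x + 1) * expR (- x))) 0 0).
- by rewrite -EFinB sub0r opprK add0r oppr0 expR0 mulr1.
- by move=> x x0; rewrite mulr_ge0 ?expR_ge0.
- exact: continuous_subspaceT.
- rewrite -oppr0; apply: cvgN.
  have -> : (fun x : R => (x + 1) * expR (- x)) =
      (fun x => x ^+ 1 * expR (- x) + x ^+ 0 * expR (- x)).
    by apply/funext => x; rewrite expr1 expr0 mulrDl.
  by rewrite -(addr0 0); apply: cvgD; exact: cvg_expn_expRN.
- by move=> x _; have [] := D x.
- by apply: cvg_at_right_filter; exact: cF.
- by move=> x _; rewrite derive1E; have [_ ->] := D x.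
Qed.

Lemma integral_sqr_expRN : (\int[mu]_(x in `[0%R, +oo[) (x ^+ 2 * expR (- x))%:E = 2%:E)%E.
Proof.
have D (x : R) : is_derive x 1 (fun x : R => - ((x ^+ 2 + (x + x) + 2) * expR (- x))) (x ^+ 2 * expR (- x)).
  apply: is_derive_eq.
  change (- ((x ^+ 2 + (x + x) + 2) * (expR (- x) * -1) +
    expR (- x) * (x * 1 + x * 1 + (1 + 1) + 0)) = x ^+ 2 * expR (- x)).
  ring.
have c : continuous (fun x : R => x ^+ 2 * expR (- x)).
  move=> x; apply: cvgM; first exact: exprn_continuous.
  by apply: (cvg_comp (fun x : R => - x) expR); [apply: cvgN; exact: cvg_id|exact: continuous_expR].
have cF : continuous (fun x : R => - ((x ^+ 2 + (x + x) + 2) * expR (- x))).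
  move=> x; apply/differentiable_continuous/derivable1_diffP.
  by have [] := D x.
rewrite (@ge0_continuous_FTC2y _ _ (fun x : R => - ((x ^+ 2 + (x + x) + 2) * expR (- x))) 0 0).
- by rewrite -EFinB sub0r opprK expr0n/= !add0r oppr0 expR0 mulr1.
- by move=> x x0; rewrite mulr_ge0 ?expR_ge0 ?sqr_ge0.
- exact: continuous_subspaceT.
- rewrite -oppr0; apply: cvgN.
  have -> : (fun x : R => (x ^+ 2 + (x + x) + 2) * expR (- x)) =
      (fun x => x ^+ 2 * expR (- x) + 2 * (x ^+ 1 * expR (- x)) + 2 * (x ^+ 0 * expR (- x))).
    by apply/funext => x; rewrite expr1 expr0; ring.
  rewrite [X in _ --> X](_ : _ = 0 + 2 * 0 + 2 * 0); last by rewrite mulr0 !addr0.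
  by apply: cvgD; [apply: cvgD|]; [exact: cvg_expn_expRN|apply: cvgM..];
    [exact: cvg_cst|exact: cvg_expn_expRN|exact: cvg_cst|exact: cvg_expn_expRN].
- by move=> x _; have [] := D x.
- by apply: cvg_at_right_filter; exact: cF.
- by move=> x _; rewrite derive1E; have [_ ->] := D x.
Qed.

(** The variable is nonnegative only almost surely, so the absolute value keeps the first integrand
    nonnegative everywhere. *)
Lemma exponential_moments d (T : measurableType d) (Q : probability T R)
    (E : {RV Q >-> R}) : standard_exponential E ->
  [/\ (\int[Q]_w `|E w|%:E = 1)%E, (\int[Q]_w (E w ^+ 2)%:E = 2%:E)%E &
      {ae Q, forall w, 0 <= E w}].
Proof.
move=> eE.
have mE0 : measurable_fun setT (E : T -> R) by exact: measurable_funPT.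
have mE : @measurable_fun _ _ T (measurableTypeR R) setT E by exact: mE0.
pose X : {mfun T >-> measurableTypeR R} :=
  @mfun_Sub _ _ T (measurableTypeR R) E (mem_set mE).
pose nu : probability (measurableTypeR R) R := distribution Q X.
have key (g : R -> R) : measurable_fun setT g -> (forall x, 0 <= g x) ->
    (\int[Q]_w (g (E w))%:E = \int[mu]_(x in `[0%R, +oo[) (g x * expR (- x))%:E)%E.
  move=> mg g0.
  transitivity (\int[nu]_x (g x)%:E)%E.
    rewrite ge0_integral_distribution; first by [].
      exact/measurable_EFinP.
    by move=> y; rewrite lee_fin.
  rewrite (@ge0_integral_density _ (measurableTypeR R) R mu nu (exponential_pdf 1)).
  - rewrite [RHS]integral_mkcond; apply: eq_integral => x _.
    rewrite patchE mem_setE in_itv/= andbT; case: ifPn => x0.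
      by rewrite exponential_pdfE// -EFinM mul1r mulN1r.
    by rewrite lt0_exponential_pdf ?mule0// ltNge.
  - exact: measurable_exponential_pdf.
  - by move=> x; apply: exponential_pdf_ge0.
  - by move=> A mA; exact: eE.
  - exact/measurable_EFinP.
  - by move=> x; rewrite lee_fin.
split.
- rewrite (key (fun x => `|x|))//.
  rewrite -integral_mul_expRN; apply: eq_integral => x.
  by rewrite inE/= in_itv/= andbT => x0; rewrite ger0_norm.
- have m2 : measurable_fun setT (fun x : R => x ^+ 2) by exact: exprn_measurable.
  by rewrite (key _ m2 (fun x => sqr_ge0 x)) integral_sqr_expRN.
- exists (E @^-1` `]-oo, 0[); split.
  + by rewrite -[X in measurable X]setTI; exact: measurable_funPT.
  + have := eE `]-oo, 0[%classic; rewrite exponential_prob_ltr ltxx; apply.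
    exact: measurable_itv.
  + by move=> w /= /negP; rewrite -ltNge in_itv.
Qed.

End ExponentialMoments.

(** [ae_cvg_odd_series] wants nonnegativity everywhere, so it is applied to the absolute values;
    independence supplies the mixed moments. *)
Lemma ae_cvg_independent_odd_series (R : realType) d (T : measurableType d)
    (Q : probability T R) (Y : nat -> T -> R) (m q : R) :
  (forall j, measurable_fun setT (Y j)) -> mutually_independent Q Y ->
  (forall j, {ae Q, forall w, 0 <= Y j w}) ->
  (forall j, (\int[Q]_w `|Y j w|%:E = m%:E)%E) ->
  (forall j, (\int[Q]_w (Y j w ^+ 2)%:E = q%:E)%E) ->
  {ae Q, forall w, cvgn (fun n => \sum_(1 <= j < n) ((Y j w - m) / (2 * j + 1)%:R))}.
Proof.
move=> mY iY Y0 EY EY2.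
have mYn j : measurable_fun setT (fun w => `|Y j w|) by exact: measurableT_comp.
have h := @ae_cvg_odd_series R _ T Q (fun j w => `|Y j w|) m q mYn.
have {}h : {ae Q, forall w, cvgn (fun n =>
    \sum_(1 <= j < n) ((`|Y j w| - m) / (2 * j + 1)%:R))}.
  apply: h => // [j|i j ij].
    by under eq_integral do rewrite real_normK ?num_real//.
  have mf : measurable_fun setT (fun z : R * R => (`|z.1| * `|z.2|)%:E).
    by apply/measurable_EFinP; apply: measurable_funM; exact: measurableT_comp.
  have := @independent_integral _ T R Q (Y i) (Y j) _ (mY i) (mY j) _ mf.
  move=> -> //; last by move=> A B mA mB; exact: mutually_independent2.
  under eq_integral => w _.
    under eq_integral do rewrite /= EFinM.
    rewrite ge0_integralZl//; last exact/measurable_EFinP.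
    rewrite EY muleC.
    over.
  rewrite ge0_integralZl//; last 2 first.
  - exact/measurable_EFinP.
  - rewrite -(EY j); apply: integral_ge0 => w _; rewrite lee_fin; exact: normr_ge0.
  by rewrite EY -EFinM.
have Y0' : {ae Q, forall w, forall j, 0 <= Y j w} by apply/ae_foralln.
apply: filterS2 h Y0' => w h wY.
rewrite (_ : (fun n => _) = (fun n => \sum_(1 <= j < n) ((`|Y j w| - m) / (2 * j + 1)%:R)))//.
by apply/funext => n; apply: eq_bigr => j _; rewrite ger0_norm.
Qed.

(** * From partial sums to the two series *)

Lemma sum_ln_1Dinv (R : realType) (n : nat) : (0 < n)%N ->
  \sum_(1 <= j < n) ln (1 + (j%:R : R)^-1) = ln n%:R.
Proof.
case: n => // n _; elim: n => [|n IH]; first by rewrite big_geq// ln1.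
have n0 : (0 : R) < n.+1%:R by [].
rewrite big_nat_recr//= IH -lnM ?posrE ?addr_gt0 ?invr_gt0//.
by rewrite mulrDr mulr1 mulfV ?gt_eqF// natr1.
Qed.

(** Reconciles the two normalisations: ln(2n+1) comes from concentration, ln n from the telescoping
    logarithms. *)
Lemma cvg_ln_ratio (R : realType) :
  (fun n : nat => ln (2 * n).+1%:R - ln (n%:R : R)) @ \oo --> (ln 2 : R).
Proof.
have h : (fun n : nat => ln (2 + (n%:R : R)^-1)) @ \oo --> (ln 2 : R).
  have h2 : (fun n : nat => 2 + (n%:R : R)^-1) @ \oo --> (2 + 0 : R).
    apply: cvgD; first exact: cvg_cst.
    by rewrite -cvg_shiftS; exact: cvg_harmonic.
  rewrite addr0 in h2; apply: (cvg_comp _ (@ln R) h2).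
  exact: continuous_ln.
apply: cvg_trans h; apply: near_eq_cvg; near=> n.
have n0 : (0 : R) < n%:R by rewrite ltr0n; near: n; exact: nbhs_infty_gt.
rewrite -ln_div ?posrE//; congr ln.
by rewrite -[(2 * n).+1%:R]natr1 natrM mulrDl mulfK ?gt_eqF// mul1r.
Unshelve. all: by end_near. Qed.

Section SeriesRepresentation.
Context {R : realType} d (T : measurableType d) d' (T' : measurableType d').
Variables (P : probability T R) (Q : probability T' R).
Variables (Z : {RV P >-> R}) (E : nat -> {RV Q >-> R}).
Hypothesis nZ : standard_normal Z.
Hypothesis iE : mutually_independent Q (fun j => (E j : T' -> R)).
Hypothesis eE : forall j, standard_exponential (E j).

Local Notation s1 := (series1 (fun j => (E j : T' -> R))).
Local Notation s2 := (series2 (fun j => (E j : T' -> R))).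
Local Notation odd_sum n := (\sum_(1 <= j < n) ((2 * j + 1)%:R : R)^-1 - 2^-1 * ln n%:R).

Let mE j : measurable_fun setT (E j : T' -> R).
Proof. exact: measurable_funPT. Qed.

Lemma ae_cvg_series2 : {ae Q, forall w, cvgn (s2 w)}.
Proof.
apply: (@ae_cvg_independent_odd_series R _ T' Q (fun j => E j : T' -> R) 1 2) => //.
- by move=> j; have [] := exponential_moments (eE j).
- by move=> j; have [] := exponential_moments (eE j).
- by move=> j; have [] := exponential_moments (eE j).
Qed.

(** The logarithms telescope to ln n, so the two series differ by a deterministic sequence, which
    converges by [cvg_odd_harmonic_ln]. *)
Let series12 w n : (0 < n)%N -> s1 w n = s2 w n + odd_sum n.
Proof.
move=> n0; rewrite /series1 /series2 -(sum_ln_1Dinv _ n0) mulr_sumr -sumrB -big_split/=.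
by apply: eq_bigr => j _; rewrite mulrBl mul1r; ring.
Qed.

Let cvg_series1 w : cvgn (s2 w) ->
  s1 w @ \oo --> limn (s2 w) + (ln 2 + euler_gamma / 2 - 1).
Proof.
move=> c2.
have h : (fun n => s2 w n + odd_sum n) @ \oo --> limn (s2 w) + (ln 2 + euler_gamma / 2 - 1).
  by apply: cvgD => //; exact: cvg_odd_harmonic_ln.
apply: cvg_trans h; apply: near_eq_cvg; near=> n.
by rewrite series12//; near: n; exact: nbhs_infty_gt.
Unshelve. all: by end_near. Qed.

Lemma ae_cvg_series1 : {ae Q, forall w, cvgn (s1 w)}.
Proof.
apply: filterS ae_cvg_series2 => w c2; apply/cvg_ex.
by eexists; exact: cvg_series1.
Qed.

(** The limit is minus the right-hand side of either representation. The last term arises from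
    replacing ln(n)/2 by ln(2n+1)/2. *)
Let cvg_partial w : cvgn (s2 w) ->
  (fun n => \sum_(j < n) E j w / (2 * j).+1%:R - 2^-1 * ln (2 * n).+1%:R) @ \oo -->
  E 0 w + limn (s2 w) + (ln 2 + euler_gamma / 2 - 1) - 2^-1 * ln 2.
Proof.
move=> c2.
have h : (fun n => E 0 w + s2 w n + odd_sum n - 2^-1 * (ln (2 * n).+1%:R - ln n%:R)) @ \oo -->
    E 0 w + limn (s2 w) + (ln 2 + euler_gamma / 2 - 1) - 2^-1 * ln 2.
  apply: cvgB; last by apply: cvgM; [exact: cvg_cst|exact: cvg_ln_ratio].
  apply: cvgD; last exact: cvg_odd_harmonic_ln.
  by apply: cvgD => //; exact: cvg_cst.
apply: cvg_trans h; apply: near_eq_cvg; near=> n.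
have n0 : (0 < n)%N by near: n; exact: nbhs_infty_gt.
have -> : \sum_(j < n) E j w / (2 * j).+1%:R = E 0 w + s2 w n +
    \sum_(1 <= j < n) ((2 * j + 1)%:R : R)^-1.
  rewrite /series2 -addrA -big_split/= -(big_mkord xpredT (fun j => E j w / (2 * j).+1%:R)).
  rewrite big_ltn// muln0 divr1; congr (_ + _).
  by apply: eq_bigr => j _; rewrite addn1 mulrBl mul1r subrK.
ring.
Unshelve. all: by end_near. Qed.

Lemma eq_in_law_series1 : eq_in_law P Q (fun w => ln `|Z w|)
  (fun w => ln 2 / 2 - E 0%N w - limn (s1 w)).
Proof.
apply: (eq_in_law_limit nZ iE eE).
  apply: measurable_funB; first exact: measurable_funB.
  apply: (@measurable_fun_limn_real _ _ _ (fun n w => s1 w n)) => n.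
  apply: measurable_sum => j; apply: measurable_funB => //.
  exact: measurable_funM.
apply: filterS ae_cvg_series2 => w c2.
rewrite (cvg_lim _ (cvg_series1 c2))//.
have -> : - (ln 2 / 2 - E 0%N w - (limn (s2 w) + (ln 2 + euler_gamma / 2 - 1))) =
  E 0 w + limn (s2 w) + (ln 2 + euler_gamma / 2 - 1) - 2^-1 * ln 2 by ring.
exact: cvg_partial.
Qed.

Lemma eq_in_law_series2 : eq_in_law P Q (fun w => ln `|Z w|)
  (fun w => - ((euler_gamma + ln 2) / 2) - (E 0%N w - 1) - limn (s2 w)).
Proof.
apply: (eq_in_law_limit nZ iE eE).
  apply: measurable_funB.
    by apply: measurable_funB => //; exact: measurable_funB.
  apply: (@measurable_fun_limn_real _ _ _ (fun n w => s2 w n)) => n.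
  by apply: measurable_sum => j; apply: measurable_funM => //; exact: measurable_funB.
apply: filterS ae_cvg_series2 => w c2.
have -> : - (- ((euler_gamma + ln 2) / 2) - (E 0%N w - 1) - limn (s2 w)) =
  E 0 w + limn (s2 w) + (ln 2 + euler_gamma / 2 - 1) - 2^-1 * ln 2 by field.
exact: cvg_partial.
Qed.

End SeriesRepresentation.

(** * Independent identically distributed families *)

Section Affine.
Context {R : realType}.
Local Notation mu := (@lebesgue_measure R).

Let affine (a c : R) (u : measurableTypeR R) : measurableTypeR R := a * u + c.

Let measurable_affine a c : measurable_fun setT (affine a c).
Proof. by apply: measurable_funD => //; exact: measurable_funM. Qed.

(** The image measure scaled by [a] gives half-open intervals their length, which characterises
    Lebesgue measure. *)
Lemma lebesgue_measure_affine (a c : R) (A : set (measurableTypeR R)) : 0 < a ->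
  measurable A -> mu (affine a c @^-1` A) = (a^-1%:E * mu A)%E.
Proof.
move=> a0 mA.
pose pm : {measure set (measurableTypeR R) -> \bar R} := pushforward mu (affine a c).
pose m2 : {measure set (measurableTypeR R) -> \bar R} :=
  mscale (NngNum (ltW a0)) (pm (measurable_affine a c)).
suff -> : mu A = m2 A.
  by rewrite /m2 /pm /= /mscale /= /pushforward muleA -EFinM mulVf ?mul1e// gt_eqF.
apply: lebesgue_measure_unique mA => X [[x y] _ <-] /=.
rewrite /m2 /pm /= /mscale /= /pushforward.
have -> : affine a c @^-1` `]x, y] = `](x - c) / a, (y - c) / a]%classic.
  apply/seteqP; split=> u /=; rewrite !in_itv/= /affine => /andP[h1 h2].
    by rewrite ltr_pdivrMr// ler_pdivlMr// mulrC ltrBlDr h1 lerBrDr h2.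
  move: h1 h2; rewrite ltr_pdivrMr// ler_pdivlMr// ltrBlDr lerBrDr ![u * a]mulrC.
  by move=> -> ->.
rewrite !lebesgue_measure_itv/= !lte_fin ltr_pM2r ?invr_gt0// ltrD2r.
case: ifPn => _; last by rewrite mule0.
by rewrite -!EFinB -EFinM; congr EFin; field; rewrite gt_eqF.
Qed.

Lemma ge0_integral_affine (a c : R) (f : measurableTypeR R -> \bar R) : 0 < a ->
  measurable_fun setT f -> (forall x, 0 <= f x)%E ->
  (\int[mu]_u f (a * u + c)%R = a^-1%:E * \int[mu]_x f x)%E.
Proof.
move=> a0 mf f0.
have a1 : 0 <= a^-1 by rewrite invr_ge0 ltW.
pose pm : {measure set (measurableTypeR R) -> \bar R} := pushforward mu (affine a c).
transitivity (\int[pm (measurable_affine a c)]_x f x)%E.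
  by rewrite ge0_integral_pushforward.
rewrite -(@ge0_integral_mscale _ _ _ mu _ measurableT (NngNum a1) f)//.
apply: eq_measure_integral => A mA _.
exact: lebesgue_measure_affine.
Qed.

End Affine.

(** * Binary digits of a uniform variable *)

Section Bits.
Context {R : realType}.
Local Notation mu := (@lebesgue_measure R).
Local Notation U := (uniform_prob (@ltr01 R)).
Local Notation RT := (measurableTypeR R).

(** The half-open interval is chosen because the doubling map sends it into itself. *)
Lemma uniform_prob01E (A : set RT) : measurable A -> U A = mu (A `&` `[0, 1[).
Proof.
move=> mA.
have -> : U A = (\int[U]_x (\1_A x)%:E)%E by rewrite integral_indic// setIT.
rewrite integral_uniform//; last first.
  exact/measurable_EFinP/measurable_indic.
rewrite subr0 invr1 mul1e -integral_itv_bndo_bndc; last first.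
  by apply/measurable_funTS/measurable_EFinP/measurable_indic.
by rewrite integral_indic.
Qed.

Definition bit (u : RT) : R := if 2^-1 <= u then 1 else 0.

(** On [0, 1[ this is the shift of the binary expansion. *)
Definition double_mod1 (u : RT) : RT := if 2^-1 <= u then 2 * u - 1 else 2 * u.

Lemma measurable_bit : measurable_fun setT bit.
Proof.
by apply: measurable_fun_ifT => //; exact: measurable_fun_ler.
Qed.

Lemma measurable_double_mod1 : measurable_fun setT double_mod1.
Proof.
apply: measurable_fun_ifT.
- exact: measurable_fun_ler.
- by apply: measurable_funB => //; exact: measurable_funM.
- exact: measurable_funM.
Qed.

(** Either half of [0, 1[ is mapped onto [0, 1[ by an affine map of slope 2, which accounts for the
    factor 1/2. *)
Lemma uniform_bit_half (b : bool) (A : set RT) : measurable A ->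
  U ([set u | (2^-1 <= u) = b] `&` double_mod1 @^-1` A) = (2^-1%:E * U A)%E.
Proof.
move=> mA.
have mdA : measurable (double_mod1 @^-1` A).
  by rewrite -[X in measurable X]setTI; exact: measurable_double_mod1.
have mb : measurable [set u : RT | (2^-1 <= u) = b].
  have -> : [set u : RT | (2^-1 <= u) = b] = (fun u : RT => 2^-1 <= u) @^-1` [set b] by [].
  by rewrite -[X in measurable X]setTI; apply: measurable_fun_ler.
have mA01 : measurable (A `&` `[0, 1[%classic) by exact: measurableI.
rewrite !uniform_prob01E//; last exact: measurableI.
rewrite -(@lebesgue_measure_affine _ 2 (if b then -1 else 0))//; congr (mu _).
apply/seteqP; split=> u /=; rewrite !in_itv/= /double_mod1.
  move=> [[ub Au] /andP[u0 u1]]; move: ub Au; case: ifPn => ub <- Au.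
    by split=> //; lra.
  by rewrite addr0; split=> //; move: ub; rewrite -ltNge => ub; lra.
move=> [Au]; case: b {mb} Au => Au /andP[h1 h2].
  have ub : 2^-1 <= u by lra.
  by rewrite ub; split=> //; lra.
have ub : u < 2^-1 by lra.
by rewrite leNgt ub/=; rewrite addr0 in Au; split=> //; lra.
Qed.

Lemma uniform_bit (B : set R) (A : set RT) : measurable B -> measurable A ->
  U (bit @^-1` B `&` double_mod1 @^-1` A) = (U (bit @^-1` B) * U A)%E.
Proof.
move=> mB mA.
(* Only the membership of 0 and 1 in [B] matters. Both halves contribute a multiple of the same
   [U C], so the first digit is independent of the remaining ones. *)
have key C : measurable C -> U (bit @^-1` B `&` double_mod1 @^-1` C) =
    (((if pselect (B 1) then 2^-1 else 0) + (if pselect (B 0) then 2^-1 else 0))%:E * U C)%E.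
  move=> mC.
  have -> : bit @^-1` B `&` double_mod1 @^-1` C =
    (if pselect (B 1) then [set u : RT | (2^-1 <= u) = true] `&` double_mod1 @^-1` C else set0)
    `|` (if pselect (B 0) then [set u : RT | (2^-1 <= u) = false] `&` double_mod1 @^-1` C else set0).
    apply/seteqP; split=> u /=.
      rewrite /bit; case E : (2^-1 <= u) => -[Bu Cu].
        by left; case: pselect.
      by right; case: pselect.
    by case=> [|]; case: pselect => //= Bb [E Cu]; rewrite /bit E.
  have mb b : measurable ([set u : RT | (2^-1 <= u) = b] `&` double_mod1 @^-1` C).
    apply: measurableI.
      have -> : [set u : RT | (2^-1 <= u) = b] = (fun u : RT => 2^-1 <= u) @^-1` [set b] by [].
      by rewrite -[X in measurable X]setTI; apply: measurable_fun_ler.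
    by rewrite -[X in measurable X]setTI; exact: measurable_double_mod1.
  rewrite measureU; last 3 first.
  - by case: pselect => //= _; exact: (mb true).
  - by case: pselect => //= _; exact: (mb false).
  - rewrite -subset0 => u []; case: pselect => //= _; case: pselect => //= _.
    by move=> [-> _] [].
  rewrite EFinD ge0_muleDl ?lee_fin; last 2 first.
  - by case: pselect => //= _; rewrite ?invr_ge0.
  - by case: pselect => //= _; rewrite ?invr_ge0.
  congr (_ + _)%E; case: pselect => //= _; rewrite ?measure0 ?mul0e//; exact: uniform_bit_half.
rewrite key//; congr (_ * _)%E.
have := key setT measurableT; rewrite preimage_setT setIT => ->.
by rewrite probability_setT mule1.
Qed.

Definition nth_bit (k : nat) (u : RT) : R := bit (iter k double_mod1 u).

Lemma measurable_iter_double k : measurable_fun setT (iter k double_mod1).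
Proof.
elim: k => [|k IH]; first exact: measurable_id.
by apply: (measurableT_comp measurable_double_mod1).
Qed.

Lemma measurable_nth_bit k : measurable_fun setT (nth_bit k).
Proof. exact: measurableT_comp measurable_bit (measurable_iter_double k). Qed.

(** The set [A], which constrains the expansion after [m] digits, makes the induction work: peeling
    off the first digit leaves an event about the shifted point. *)
Lemma uniform_nth_bits (m : nat) (B : nat -> set R) (A : set RT) :
  (forall k, measurable (B k)) -> measurable A ->
  U ([set u | forall k, (k < m)%N -> B k (nth_bit k u)] `&`
     iter m double_mod1 @^-1` A) =
  ((\prod_(k < m) U (bit @^-1` B k)) * U A)%E.
Proof.
elim: m B A => [|m IH] B A mB mA.
  rewrite big_ord0 mul1e; congr (U _); apply/seteqP; split=> u /=; first by case.
  by move=> Au; split.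
have mD : measurable ([set u | forall k, (k < m)%N -> B k.+1 (nth_bit k u)] `&`
     iter m double_mod1 @^-1` A).
  apply: measurableI; last first.
    by rewrite -[X in measurable X]setTI; exact: measurable_iter_double.
  have -> : [set u | forall k, (k < m)%N -> B k.+1 (nth_bit k u)] =
      \bigcap_(k in [set k | (k < m)%N]) (nth_bit k @^-1` B k.+1) by [].
  apply: fin_bigcap_measurable; first exact: finite_II.
  move=> k _.
  by rewrite -[X in measurable X]setTI; exact: measurable_nth_bit.
have -> : [set u | forall k, (k < m.+1)%N -> B k (nth_bit k u)] `&`
     iter m.+1 double_mod1 @^-1` A = bit @^-1` B 0 `&` double_mod1 @^-1`
     ([set u | forall k, (k < m)%N -> B k.+1 (nth_bit k u)] `&`
     iter m double_mod1 @^-1` A).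
  apply/seteqP; split=> u /=; rewrite -iterS iterSr.
    move=> [h Au]; split; first exact: (h 0).
    by split=> // k km; rewrite /nth_bit -iterSr; exact: (h k.+1).
  by move=> [B0 [h Au]]; split=> // -[//|k] km; rewrite /nth_bit iterSr; exact: h.
rewrite uniform_bit// (IH (fun k => B k.+1))// big_ord_recl muleA; congr (_ * _ * _)%E.
Qed.

Lemma uniform_nth_bit_law k (B : set R) : measurable B ->
  U (nth_bit k @^-1` B) = U (bit @^-1` B).
Proof.
move=> mB; have := @uniform_nth_bits k (fun=> setT) (bit @^-1` B) (fun=> measurableT).
rewrite big1 ?mul1e; last by move=> i _; rewrite preimage_setT probability_setT.
move=> <-; last by rewrite -[X in measurable X]setTI; exact: measurable_bit.
by congr (U _); apply/seteqP; split=> u //=; case.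
Qed.

Lemma mutually_independent_bits : mutually_independent U nth_bit.
Proof.
move=> J B mB.
(* [J] is enlarged to an initial segment of digits, with [setT] imposed on those outside [J]. *)
pose m := (\max_(k <- J) k).+1.
have Jm k : k \in J -> (k < m)%N by move=> kJ; rewrite ltnS; exact: (leq_bigmax_seq _ kJ).
pose B' k := if k \in J then B k else setT.
have := @uniform_nth_bits m B' setT _ measurableT.
rewrite probability_setT mule1 preimage_setT setIT.
have -> : [set u | forall k, (k < m)%N -> B' k (nth_bit k u)] =
    \bigcap_(i in [set` J]) (nth_bit i @^-1` B i).
  apply/seteqP; split=> u /= h k.
    by move=> kJ; have := h k (Jm _ kJ); rewrite /B' kJ.
  by move=> _; rewrite /B'; case: ifPn => // kJ; exact: h.
move=> h; apply: (etrans (h _)); first by move=> k; rewrite /B'; case: ifP.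
rewrite -(big_mkord xpredT (fun k => U (bit @^-1` B' k))).
rewrite (bigID (mem J))/= [X in (_ * X)%E]big1 ?mule1; last first.
  by move=> k /negbTE kJ; rewrite /B' kJ preimage_setT probability_setT.
rewrite -big_filter.
have /(perm_big _) -> : perm_eq [seq k <- index_iota 0 m | k \in J] J.
  apply: uniq_perm; rewrite ?filter_uniq ?iota_uniq ?fset_uniq// => k.
  rewrite mem_filter mem_index_iota /=; case kJ : (k \in J) => //=.
  exact: Jm.
by apply: eq_fbigr => k kJ _; rewrite /B' kJ uniform_nth_bit_law.
Qed.

(** After n digits the remainder is the n-th iterate divided by 2^n, and the iterates stay in [0,
    1[. *)
Lemma cvg_nth_bits (u : RT) : 0 <= u < 1 ->
  (fun n => \sum_(k < n) nth_bit k u / 2 ^+ k.+1) @ \oo --> (u : R).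
Proof.
move=> u01.
have it n : 0 <= iter n double_mod1 u < 1.
  elim: n => //= n /andP[h0 h1]; rewrite /double_mod1; case: ifPn => h.
    by apply/andP; split; lra.
  by move: h; rewrite -ltNge => h; apply/andP; split; lra.
have E n : \sum_(k < n) nth_bit k u / 2 ^+ k.+1 = u - iter n double_mod1 u / 2 ^+ n.
  elim: n => [|n IH]; first by rewrite big_ord0 expr0 divr1 subrr.
  rewrite big_ord_recr/= IH /nth_bit /bit /double_mod1 exprS.
  have p0 : (2 : R) ^+ n != 0 by rewrite expf_neq0.
  by case: ifPn => _ /=; field.
suff h : (fun n => (u : R) - iter n double_mod1 u / 2 ^+ n) @ \oo --> ((u : R) - 0).
  rewrite subr0 in h; rewrite (_ : (fun n => _) = (fun n => (u : R) - iter n double_mod1 u / 2 ^+ n))//.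
  by apply/funext => n; exact: E.
apply: cvgB; first exact: cvg_cst.
apply: (squeeze_cvgr (f := cst 0) (h := fun n => (2^-1 : R) ^+ n)).
- apply: nearW => n; have /andP[h0 h1] := it n.
  rewrite divr_ge0 ?exprn_ge0//= exprVn ler_piMl ?invr_ge0 ?exprn_ge0// ltW//.
- exact: cvg_cst.
- by apply: cvg_expr; rewrite ger0_norm ?invr_ge0// invf_lt1// ltr1n.
Qed.

End Bits.

Section IID.
Context {R : realType}.
Local Notation mu := (@lebesgue_measure R).
Local Notation U := (uniform_prob (@ltr01 R)).
Local Notation RT := (measurableTypeR R).

Definition binary_value (f : nat -> R) : R :=
  limn (fun n => \sum_(k < n) f k / 2 ^+ k.+1).

(** On [0, 1[, which carries all the mass, recombining the digits gives back the point. *)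
Lemma uniform_prob_binary (B : set R) : measurable B ->
  U ((fun u => binary_value (fun k => nth_bit k u)) @^-1` B) = U B.
Proof.
move=> mB.
have mV : measurable_fun setT (fun u : RT => binary_value (fun k => nth_bit k u)).
  apply: (@measurable_fun_limn_real _ RT R
    (fun n u => \sum_(k < n) nth_bit k u / 2 ^+ k.+1)) => n.
  apply: measurable_sum => k; apply: measurable_funM => //.
  exact: measurable_nth_bit.
have mVB : measurable ((fun u : RT => binary_value (fun k => nth_bit k u)) @^-1` B).
  by rewrite -[X in measurable X]setTI; exact: mV.
rewrite !uniform_prob01E//; congr (mu _).
have VE (u : RT) : 0 <= u < 1 -> binary_value (fun k => nth_bit k u) = u.
  by move=> u01; apply/cvg_lim => //; exact: cvg_nth_bits.
apply/seteqP; split=> u /= [Bu]; rewrite in_itv/= => u01; split => //.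
  by rewrite -(VE u).
by rewrite VE.
Qed.

Section UniformSequence.
Context (I : countType).

(** The digits of a single point are dealt out along an encoding of pairs, so that each index [i]
    receives its own infinite sequence of independent digits. *)
Let eps (p : I * nat) : RT -> R := nth_bit (choice.pickle p).

Let indep_eps : mutually_independent U eps.
Proof.
apply: (@mutually_independent_inj R nat (I * nat)%type _ RT U nth_bit choice.pickle).
  exact: (pcan_inj choice.pickleK).
exact: mutually_independent_bits.
Qed.

Definition uniform_seq (i : I) (u : RT) : R := binary_value (fun k => eps (i, k) u).

Lemma measurable_uniform_seq i : measurable_fun setT (uniform_seq i).
Proof.
rewrite /uniform_seq /binary_value.
apply: (@measurable_fun_limn_real _ RT R
  (fun n u => \sum_(k < n) eps (i, k : nat) u / 2 ^+ k.+1)) => n.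
apply: measurable_sum => k; apply: measurable_funM => //.
exact: measurable_nth_bit.
Qed.

Lemma mutually_independent_uniform_seq : mutually_independent U uniform_seq.
Proof.
have meps p : measurable_fun setT (eps p) by exact: measurable_nth_bit.
apply: (@independent_groups R (I * nat)%type I _ RT U eps fst meps indep_eps
  (fun i f => binary_value (fun k => f (i, k)))) => i.
apply: (@measurable_fun_limn_real _ (pathType R (fst @^-1` [set i])) R
  (fun n f => \sum_(k < n) f (i, k : nat) / 2 ^+ k.+1)) => n.
by apply: measurable_sum => k; apply: measurable_funM => //; exact: measurable_coord.
Qed.

(** The digits received by [i] and the original digits are independent families with the same
    marginals, so their binary values have the same law. *)
Lemma uniform_seq_law i (B : set R) : measurable B -> U (uniform_seq i @^-1` B) = U B.
Proof.
move=> mB; rewrite -(uniform_prob_binary mB).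
apply: (@eq_in_law_path R nat _ RT _ RT U U (fun k => eps (i, k)) nth_bit
  binary_value) => //.
- by move=> k; exact: measurable_nth_bit.
- by move=> k; exact: measurable_nth_bit.
- apply: (@mutually_independent_inj R _ _ _ RT U eps (fun k => (i, k))).
    by move=> k l [].
  exact: indep_eps.
- exact: mutually_independent_bits.
- move=> k A mA; apply: (etrans (uniform_nth_bit_law _ mA)).
  exact: (esym (uniform_nth_bit_law _ mA)).
- apply: (@measurable_fun_limn_real _ (pathType R setT) R
    (fun n f => \sum_(k < n) f (k : nat) / 2 ^+ k.+1)) => n.
  by apply: measurable_sum => k; apply: measurable_funM => //; exact: measurable_coord.
Qed.

End UniformSequence.

(** * Inverse distribution function *)

Section Quantile.
Variable nu : probability RT R.

Let F (x : R) : R := fine (nu `]-oo, x]%classic).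

Let F_nd x y : x <= y -> F x <= F y.
Proof.
move=> xy; apply: fine_le; rewrite ?fin_num_measure//.
apply: le_measure; rewrite ?inE//.
by move=> z /=; rewrite !in_itv/= => /le_trans; apply.
Qed.

Let idX : {RV nu >-> R} := @mfun_Sub _ _ RT R (@id R) (mem_set (@measurable_id _ RT setT)).

Let cdfE x : cdf idX x = (F x)%:E.
Proof. by rewrite /F fineK ?fin_num_measure. Qed.

(** Outside ]0, 1[ the set may be empty or unbounded below, so a default is given; there the uniform
    law has no mass. *)
Definition quantile (u : R) : R :=
  if 0 < u < 1 then inf [set x | u <= F x] else 0.

(** The limits of [F] at both infinities make the infimum genuine, and right continuity puts it in
    the set. The resulting equivalence yields both measurability and the law of [quantile]. *)
Lemma quantile_le u x : 0 < u < 1 -> (quantile u <= x) = (u <= F x).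
Proof.
move=> u01; rewrite /quantile u01; move/andP: u01 => [u0 u1].
have ne : [set x | u <= F x] !=set0.
  have := @cvg_cdfy1 _ _ _ nu idX.
  rewrite (_ : cdf idX = EFin \o F); last by apply/funext => z; exact: cdfE.
  move/fine_cvgP => [_ c].
  have [M [_ HM]] := cvgr_gt _ c _ u1.
  exists (M + 1); rewrite /= ltW//; apply: HM.
  by rewrite ltrDl.
have lb : has_lbound [set x | u <= F x].
  have := @cvg_cdfNy0 _ _ _ nu idX.
  rewrite (_ : cdf idX = EFin \o F); last by apply/funext => z; exact: cdfE.
  move/fine_cvgP => [_ c].
  have [M [_ HM]] := cvgr_lt _ c _ u0.
  exists (M - 1) => z /= uz; rewrite leNgt; apply/negP => zM.
  have : F (M - 1) < u by apply: HM; rewrite ltrBlDr ltrDl.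
  by rewrite ltNge (le_trans uz)// F_nd// ltW.
apply/idP/idP => [qx|ux]; last exact: ge_inf.
suff : u <= F (inf [set x | u <= F x]) by move=> h; rewrite (le_trans h)// F_nd.
set q := inf _.
have rc : F z @[z --> q^'+] --> F q.
  have := @cdf_right_continuous _ _ _ nu idX q.
  rewrite (_ : cdf idX = EFin \o F); last by apply/funext => z; exact: cdfE.
  by move/fine_cvgP => [].
rewrite leNgt; apply/negP => Fqu.
have [e /= e0 He] := cvgr_lt _ rc _ Fqu.
have [z uz zq] := inf_adherent e0 (conj ne lb).
have qz : q <= z by apply: ge_inf.
have [qz'|] := ltP q z; last first.
  move=> zq'; have zE : z = q by apply/eqP; rewrite eq_le qz zq'.
  by move: uz; rewrite /= zE leNgt Fqu.
have : F z < u.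
  apply: He => //=; rewrite distrC ger0_norm ?subr_ge0//.
  by rewrite ltrBlDl.
by rewrite ltNge uz.
Qed.

Lemma measurable_quantile : measurable_fun setT quantile.
Proof.
suff h : @measurable_fun _ _ RT RT setT quantile by exact: h.
apply: (@measurability _ _ RT RT setT _ _ (RGenOInfty.measurableE R)).
move=> _ [_ [x ->] <-]; rewrite setTI.
have -> : quantile @^-1` `]x, +oo[ =
    (`]0, 1[ `&` `]F x, +oo[) `|` (if x < 0 then ~` `]0, 1[ else set0).
  apply/seteqP; split=> u /=; rewrite !in_itv/= !andbT.
    move=> xq; have [u01|u01] := boolP (0 < u < 1).
      by left; split=> //; rewrite ltNge -quantile_le// -ltNge.
    right; move: xq; rewrite /quantile (negbTE u01) => ->.
    by apply/negP; rewrite in_itv.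
  move=> [[u01 Fu]|].
    by rewrite ltNge quantile_le// -ltNge.
  case: ifPn => // x0 /negP; rewrite in_itv/= => u01.
  by rewrite /quantile (negbTE u01).
apply: measurableU; first exact: measurableI.
by case: ifPn => // _; exact: measurableC.
Qed.

Lemma quantile_law (B : set R) : measurable B -> U (quantile @^-1` B) = nu B.
Proof.
move=> mB.
apply: (@eq_in_law_tail R _ RT _ RT U nu quantile id measurable_quantile _ _ B mB).
  exact: measurable_id.
move=> s.
have m1 : measurable [set u : RT | s < quantile u].
  have -> : [set u : RT | s < quantile u] = quantile @^-1` `]s, +oo[.
    by apply/seteqP; split=> u; rewrite /= in_itv/= andbT.
  by rewrite -[X in measurable X]setTI; exact: measurable_quantile.
have F0 : 0 <= F s by rewrite fine_ge0.
have F1 : F s <= 1.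
  by rewrite -lee_fin fineK ?fin_num_measure//; exact: probability_le1.
apply: (etrans (uniform_prob01E m1)).
have -> : [set w | s < w] = ~` `]-oo, s]%classic.
  apply/seteqP; split=> u /=; rewrite in_itv/=; first by rewrite ltNge => /negP.
  by move/negP; rewrite -ltNge.
rewrite probability_setC// -(fineK (fin_num_measure nu _ _))// -/(F s).
transitivity (mu `]F s, 1[%classic); last first.
  rewrite lebesgue_measure_itv/= lte_fin; case: ltP => h; first by [].
  by have -> : F s = 1; [apply/eqP; rewrite eq_le F1 h|rewrite -EFinB subrr].
have e0 : mu [set 0 : R] = 0%E by exact: lebesgue_measure_set1.
have ms : measurable ([set u : RT | s < quantile u] `&` `[0, 1[).
  exact: measurableI.
(* At the left endpoint 0 the quantile takes its default value; this null point is discarded. *)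
transitivity (mu ([set u : RT | s < quantile u] `&` `]0, 1[)).
  have -> : [set u : RT | s < quantile u] `&` `[0, 1[ =
     ([set u : RT | s < quantile u] `&` `]0, 1[) `|`
     ([set u : RT | s < quantile u] `&` [set 0]).
    apply/seteqP; split=> u /=; rewrite !in_itv/=.
      move=> [su /andP[u0 u1]]; have [u0'|u0'] := ltP 0 (u : R).
        by left; split=> //; rewrite u1.
      by right; split=> //; apply/eqP; rewrite eq_le u0' u0.
    move=> [[su /andP[u0 u1]]|[su u0]]; first by rewrite su ltW//= u1.
    by move: su; rewrite u0 lexx ltr01.
  have m2 : measurable ([set u : RT | s < quantile u] `&` `]0, 1[) by exact: measurableI.
  have m3 : measurable ([set u : RT | s < quantile u] `&` [set 0]) by exact: measurableI.
  apply/eqP; rewrite eq_le; apply/andP; split.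
    apply: (le_trans (measureU2 _ m2 m3)).
    rewrite -[leRHS]adde0 leeD2l// -e0; apply: le_measure; rewrite ?inE//.
  by apply: le_measure; rewrite ?inE//; exact: measurableU.
congr (mu _); apply/seteqP; split=> u /=; rewrite !in_itv/=.
  move=> [su u01]; move: su; rewrite ltNge quantile_le// -ltNge => ->.
  by case/andP: u01.
move=> /andP[Fu u1]; have u01 : 0 < u < 1 by rewrite u1 (le_lt_trans F0).
by split=> //; rewrite ltNge quantile_le// -ltNge.
Qed.

End Quantile.

Lemma iid_exists (nu : probability RT R) (I : countType) :
  exists (d : measure_display) (T : measurableType d) (Q : probability T R)
    (X : I -> T -> R),
    [/\ forall i, measurable_fun setT (X i), mutually_independent Q X &
        forall i B, measurable B -> Q (X i @^-1` B) = nu B].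
Proof.
exists _, RT, U, (fun i u => quantile nu (uniform_seq i u)); split.
- move=> i; apply: measurableT_comp; first exact: measurable_quantile.
  exact: measurable_uniform_seq.
- move=> J B mB.
  apply: (@mutually_independent_uniform_seq I J (fun i => quantile nu @^-1` B i)) => i.
  by rewrite -[X in measurable X]setTI; exact: measurable_quantile.
- move=> i B mB; apply: (etrans _ (quantile_law nu mB)).
  apply: (@uniform_seq_law I i (quantile nu @^-1` B)).
  by rewrite -[X in measurable X]setTI; exact: measurable_quantile.
Qed.

End IID.

(** * Gamma laws *)

Section DensityMeasure.
Context d (T : measurableType d) (R : realType).
Variables (mu : {measure set T -> \bar R}) (p : T -> R).
Hypotheses (mp : measurable_fun setT p) (p0 : forall x, 0 <= p x).

(** The two conditions on [p] are arguments of the set function, so that the measure instance built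
    from them attaches to it. *)
Definition density_measure of measurable_fun setT p & (forall x, 0 <= p x) :=
  fun A : set T => (\int[mu]_(x in A) (p x)%:E)%E.

Local Notation dm := (density_measure mp p0).

Let dm0 : dm set0 = 0%E.
Proof. exact: integral_set0. Qed.

Let dm_ge0 A : (0 <= dm A)%E.
Proof. by apply: integral_ge0 => x _; rewrite lee_fin. Qed.

Let dm_sigma_additive : semi_sigma_additive dm.
Proof.
move=> F mF tF mUF; rewrite /density_measure ge0_integral_bigcup//.
- by apply: is_cvg_ereal_nneg_natsum_cond => n _ _; exact: dm_ge0.
- by apply/measurable_EFinP/measurable_funTS.
- by move=> x _; rewrite lee_fin.
Qed.

HB.instance Definition _ := isMeasure.Build _ _ _ dm dm0 dm_ge0 dm_sigma_additive.

Lemma density_probability : (\int[mu]_x (p x)%:E = 1)%E ->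
  exists nu : probability T R, forall A, nu A = (\int[mu]_(x in A) (p x)%:E)%E.
Proof.
move=> p1; have h : dm setT = 1%E by [].
pose h1 := Measure_isProbability.Build _ _ _ dm h.
pose nu : probability T R := HB.pack dm h1.
by exists nu.
Qed.

End DensityMeasure.

Section Gamma.
Context {R : realType}.
Local Notation mu := (@lebesgue_measure R).
Local Notation RT := (measurableTypeR R).

Definition gamma_fun (a : R) (x : RT) : R :=
  if 0 < x then x `^ (a - 1) * expR (- x) else 0.

Lemma gamma_fun_ge0 a x : 0 <= gamma_fun a x.
Proof. by rewrite /gamma_fun; case: ifPn => // _; rewrite mulr_ge0 ?powR_ge0 ?expR_ge0. Qed.

Lemma measurable_gamma_fun a : measurable_fun setT (gamma_fun a).
Proof.
apply: measurable_fun_ifT => //; first exact: measurable_fun_ltr.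
apply: measurable_funM; first exact: measurable_powR.
by apply: measurableT_comp.
Qed.

Let mgE a : measurable_fun setT (fun x : RT => (gamma_fun a x)%:E).
Proof. by apply/measurable_EFinP; exact: measurable_gamma_fun. Qed.

Let gE0 a x : (0 <= (gamma_fun a x)%:E)%E.
Proof. by rewrite lee_fin gamma_fun_ge0. Qed.

Definition gamma_mass (a : R) : \bar R := (\int[mu]_x (gamma_fun a x)%:E)%E.

Let integral_expRN1 : (\int[mu]_(x in `[1%R, +oo[) (expR (- x))%:E <= 1)%E.
Proof.
have D (x : R) : is_derive x 1 (fun x : R => - expR (- x)) (expR (- x)).
  by apply: is_derive_eq; rewrite mulrN1 opprK.
have c : continuous (fun x : R => expR (- x)).
  move=> x.
  by apply: (cvg_comp (fun x : R => - x) expR); [apply: cvgN; exact: cvg_id|exact: continuous_expR].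
rewrite (@ge0_continuous_FTC2y _ _ (fun x : R => - expR (- x)) 1 0).
- by rewrite -EFinB sub0r opprK lee_fin expR_le1 oppr_le0.
- by move=> x _; exact: expR_ge0.
- exact: continuous_subspaceT.
- by rewrite -oppr0; apply: cvgN; exact: cvgr_expR.
- by move=> x _; have [] := D x.
- by apply: cvg_at_right_filter; apply: cvgN; exact: c.
- by move=> x _; rewrite derive1E; have [_ ->] := D x.
Qed.

Let is_derive_powR_div (a x : R) : 0 < a -> 0 < x ->
  is_derive x 1 (fun y : R => y `^ a / a) (x `^ (a - 1)).
Proof.
move=> a0 x0; have [dx Dx] := is_derive1_powR a x0.
have -> : (fun y : R => y `^ a / a) = a^-1 \*: (fun y : R => y `^ a).
  by apply/funext => y /=; rewrite mulrC.
split; first exact: derivableZ.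
rewrite deriveZ// Dx; change (a^-1 * (a * x `^ (a - 1)) = x `^ (a - 1)).
by rewrite mulKf// gt_eqF.
Qed.

(** For a < 1 the integrand is singular at 0, so the interval is exhausted by [1/(k+1), 1], on which
    x^a/a is an antiderivative. *)
Let integral_powR01 (a : R) : 0 < a ->
  (\int[mu]_(x in `]0%R, 1%R]) (x `^ (a - 1))%:E <= (a^-1)%:E)%E.
Proof.
move=> a0.
pose F (k : nat) : set RT := `[k.+1%:R^-1, 1]%classic.
have FU : `]0%R, 1%R]%classic = \bigcup_k F k.
  apply/seteqP; split=> x /=.
    rewrite in_itv/= => /andP[x0 x1].
    have [k] := ltr_add_invr x0; rewrite add0r => kx.
    by exists k => //; rewrite /F/= in_itv/= x1 ltW.
  move=> [k _]; rewrite /F/= !in_itv/= => /andP[kx ->]; rewrite andbT.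
  by rewrite (lt_le_trans _ kx)// invr_gt0.
have ndF : nondecreasing_seq F.
  move=> m n mn; rewrite subsetEset => x; rewrite /F /= !in_itv/= => /andP[h ->].
  by rewrite andbT (le_trans _ h)// lef_pV2 ?posrE// ler_nat.
have mpow : measurable_fun setT (fun x : RT => (x `^ (a - 1))%:E).
  by apply/measurable_EFinP; exact: measurable_powR.
rewrite FU.
have := @ge0_nondecreasing_set_cvg_integral _ RT R F (fun x : RT => (x `^ (a - 1))%:E) mu ndF.
move=> /(_ (fun=> measurable_itv _)).
move=> /(_ (fun n => measurable_funTS mpow)).
move=> h.
have {}h := h (fun n x _ => ltac:(by rewrite lee_fin powR_ge0)).
rewrite -(cvg_lim _ h)//; apply: lime_le; first by apply/cvg_ex; eexists; exact: h.
apply: nearW => k; rewrite /F.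
(* At k = 0 the interval shrinks to the point 1 and is treated apart. *)
have [k1|k1] := ltP (k.+1%:R^-1) (1 : R); last first.
  rewrite (@integral_Sset1 _ _ _ 1) ?lee_fin ?invr_ge0 ?ltW//.
  move=> x /=; rewrite in_itv/= => /andP[h1 h2]; apply/eqP.
  by rewrite eq_le h2 (le_trans k1 h1).
have k0 : (0 : R) < k.+1%:R^-1 by rewrite invr_gt0.
have cp b (x : R) : 0 < x -> {for x, continuous (fun y : R => y `^ b)}.
  move=> x0; apply/differentiable_continuous/derivable1_diffP.
  by have [] := is_derive1_powR b x0.
rewrite (@continuous_FTC2 _ _ (fun y : R => y `^ a / a) _ _ k1).
- rewrite -EFinB lee_fin powR1 mul1r gerBl divr_ge0 ?powR_ge0// ltW//.
- apply: continuous_in_subspaceT => x; rewrite inE/= in_itv/= => /andP[kx _].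
  by apply: cp; rewrite (lt_le_trans k0).
- split.
  + move=> x; rewrite in_itv/= => /andP[kx _].
    by have [] := is_derive_powR_div a0 (lt_trans k0 kx).
  + apply: cvg_at_right_filter; apply: cvgM; last exact: cvg_cst.
    exact: cp.
  + apply: cvg_at_left_filter; apply: cvgM; last exact: cvg_cst.
    exact: cp.
- move=> x; rewrite in_itv/= => /andP[kx _].
  by rewrite derive1E; have [_ ->] := is_derive_powR_div a0 (lt_trans k0 kx).
Qed.


(** On ]0, 1[ the exponential is at most 1; from 1 on, the power is at most 1 because a <= 1. *)
Let gamma_fun_split a (x : RT) : a <= 1 ->
  ((gamma_fun a x)%:E <= ((fun x => (x `^ (a - 1))%:E) \_ `]0%R, 1%R]) x +
    ((fun x => (expR (- x))%:E) \_ `[1%R, +oo[) x)%E.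
Proof.
move=> a1; rewrite /gamma_fun !patchE; case: ifPn => [x0|_]; last first.
  by apply: adde_ge0; case: ifP => // _; rewrite lee_fin ?powR_ge0 ?expR_ge0.
have [x1|x1] := ltP x 1.
  rewrite mem_set/= ?in_itv/= ?x0 ?(ltW x1)// memNset/= ?in_itv/= ?andbT; last first.
    by apply/negP; rewrite -ltNge.
  by rewrite adde0 lee_fin ler_piMr ?powR_ge0// expR_le1 oppr_le0 ltW.
have -> : x \in `[1, +oo[%classic by rewrite mem_set//= in_itv/= x1.
apply: (@le_trans _ _ (expR (- x))%:E); last first.
  by rewrite leeDr//; case: ifP => // _; rewrite lee_fin powR_ge0.
rewrite lee_fin ler_piMl ?expR_ge0// -[leRHS](powRr0 x).
by apply: ler_powR => //; rewrite subr_le0.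
Qed.

Lemma gamma_mass_lty (a : R) : 0 < a -> a <= 1 -> (gamma_mass a < +oo)%E.
Proof.
move=> a0 a1.
have m1 : measurable_fun setT ((fun x : RT => (x `^ (a - 1))%:E) \_ `]0%R, 1%R]).
  apply/(measurable_restrictT _ _).1 => //; apply: measurable_funTS.
  by apply/measurable_EFinP; exact: measurable_powR.
have m2 : measurable_fun setT ((fun x : RT => (expR (- x))%:E) \_ `[1%R, +oo[).
  apply/(measurable_restrictT _ _).1 => //; apply: measurable_funTS.
  by apply/measurable_EFinP; exact: measurableT_comp.
apply: (@le_lt_trans _ _ ((a^-1)%:E + 1)%E); last by rewrite -EFinD ltry.
apply: (@le_trans _ _ (\int[mu]_(x in `]0%R, 1%R]) (x `^ (a - 1))%:E +
    \int[mu]_(x in `[1%R, +oo[) (expR (- x))%:E)%E); last first.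
  by apply: leeD; [exact: integral_powR01|exact: integral_expRN1].
rewrite [X in (_ <= X + _)%E]integral_mkcond [X in (_ <= _ + X)%E]integral_mkcond.
rewrite -ge0_integralD//.
- apply: ge0_le_integral => //.
  + exact: emeasurable_funD.
  + by move=> x _; exact: gamma_fun_split.
- by move=> x _; rewrite patchE; case: ifP => // _; rewrite lee_fin powR_ge0.
- by move=> x _; rewrite patchE; case: ifP => // _; rewrite lee_fin expR_ge0.
Qed.

Lemma gamma_mass_gt0 (a : R) : 0 < a -> (0 < gamma_mass a)%E.
Proof.
(* On [1, 2] the power x^(a-1) is at least 1/x, hence at least 1/2, and the exponential is at least
   exp(-2). *)
move=> a0; apply: (@lt_le_trans _ _ (\int[mu]_(x in `[1%R, 2%R]) (2^-1 * expR (- 2))%:E)%E).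
  rewrite integral_cst//= lebesgue_measure_itv/= lte_fin ltr1n -EFinB.
  by rewrite -EFinM lte_fin; rewrite mulr_gt0 ?mulr_gt0 ?expR_gt0// subr_gt0 ltr1n.
apply: (@le_trans _ _ (\int[mu]_(x in `[1%R, 2%R]) (gamma_fun a x)%:E)%E); last first.
  by apply: ge0_subset_integral => //.
apply: ge0_le_integral => //.
- exact: measurable_funTS.
move=> x /=; rewrite in_itv/= => /andP[x1 x2].
have x0 : 0 < x by rewrite (lt_le_trans _ x1).
rewrite lee_fin /gamma_fun x0 ler_pM ?invr_ge0 ?expR_ge0//; last by rewrite ler_expR lerN2.
apply: (@le_trans _ _ (x^-1)); first by rewrite lef_pV2 ?posrE.
by rewrite -(powR_inv1 (ltW x0)); apply: ler_powR => //; rewrite lerBrDr addNr ltW.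
Qed.

Definition gamma_pdf (a : R) (x : RT) : R := gamma_fun a x / fine (gamma_mass a).

Lemma gamma_pdf_ge0 a x : 0 <= gamma_pdf a x.
Proof.
by rewrite divr_ge0 ?gamma_fun_ge0// fine_ge0//; apply: integral_ge0 => y _.
Qed.

Lemma measurable_gamma_pdf a : measurable_fun setT (gamma_pdf a).
Proof. by apply: measurable_funM => //; exact: measurable_gamma_fun. Qed.

Lemma integral_gamma_pdf (a : R) : 0 < a -> a <= 1 ->
  (\int[mu]_x (gamma_pdf a x)%:E = 1)%E.
Proof.
move=> a0 a1; rewrite /gamma_pdf.
under eq_integral do rewrite EFinM.
have g0 := gamma_mass_gt0 a0; have gy := gamma_mass_lty a0 a1.
have gf : gamma_mass a \is a fin_num by rewrite ge0_fin_numE// ltW.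
have f0 : 0 < fine (gamma_mass a) by rewrite fine_gt0// g0.
rewrite ge0_integralZr//; last by rewrite lee_fin invr_ge0 ltW.
rewrite -/(gamma_mass a) -{1}(fineK gf) -EFinM divff// gt_eqF//.
Qed.

Definition beta_fun (a b : R) (y : RT) : R :=
  if (0 < y) && (y < 1) then y `^ (a - 1) * (1 - y) `^ (b - 1) else 0.

Lemma beta_fun_ge0 a b y : 0 <= beta_fun a b y.
Proof. by rewrite /beta_fun; case: ifPn => // _; rewrite mulr_ge0 ?powR_ge0. Qed.

Lemma measurable_beta_fun a b : measurable_fun setT (beta_fun a b).
Proof.
apply: measurable_fun_ifT => //.
  by apply: measurable_and; exact: measurable_fun_ltr.
apply: measurable_funM; first exact: measurable_powR.
apply: (measurableT_comp (f := fun y : R => y `^ (b - 1))) => //.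
exact: measurable_funB.
Qed.

Definition beta_mass (a b : R) : \bar R := (\int[mu]_y (beta_fun a b y)%:E)%E.

(* Scaling the convolution variable by [t] separates the dependence on [t],
   so that the value of the beta integral is never needed. *)
Lemma gamma_fun_convolution (a b : R) (t : RT) :
  (\int[mu]_x (gamma_fun a x * gamma_fun b (t - x)%R)%:E =
   (gamma_fun (a + b) t)%:E * beta_mass a b)%E.
Proof.
have [t0|t0] := leP t 0.
  rewrite [gamma_fun (a + b) t]/gamma_fun ltNge t0/= mul0e.
  apply: integral0_eq => x _; rewrite /gamma_fun.
  case: ifPn => x0; last by rewrite mul0r.
  rewrite ifF ?mulr0//; apply/negbTE; rewrite -leNgt subr_le0.
  by rewrite (le_trans t0)// ltW.
pose f (x : RT) := (gamma_fun a x * gamma_fun b (t - x)%R)%:E.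
have mf : measurable_fun setT f.
  apply/measurable_EFinP; apply: measurable_funM; first exact: measurable_gamma_fun.
  apply: (measurableT_comp (measurable_gamma_fun b)).
  exact: measurable_funB.
have f0 x : (0 <= f x)%E by rewrite lee_fin mulr_ge0 ?gamma_fun_ge0.
have := ge0_integral_affine 0 t0 mf f0.
move=> /(congr1 (fun z => t%:E * z)%E).
rewrite muleA -EFinM divff ?gt_eqF// mul1e => <-.
have fE (u : RT) : f (t * u + 0)%R =
    ((t `^ (a + b - 2) * expR (- t))%:E * (beta_fun a b u)%:E)%E.
  rewrite addr0 /f -EFinM; congr EFin.
  have -> : t - t * u = t * (1 - u) by ring.
  rewrite /gamma_fun /beta_fun !pmulr_rgt0// subr_gt0.
  case: ifPn => u0; last by rewrite /= mul0r mulr0.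
  case: ifPn => u1 /=; last by rewrite !mulr0.
  rewrite !powRM ?(ltW t0) ?(ltW u0) ?subr_ge0 ?(ltW u1)//.
  have -> : t `^ (a + b - 2) = t `^ (a - 1) * t `^ (b - 1).
    by rewrite -powRD ?(gt_eqF t0) ?implybT//; congr (_ `^ _); ring.
  have -> : expR (- t) = expR (- (t * u)) * expR (- (t * (1 - u))).
    by rewrite -expRD; congr expR; ring.
  ring.
under eq_integral do rewrite fE.
rewrite ge0_integralZl//; last 3 first.
- by apply/measurable_EFinP; exact: measurable_beta_fun.
- by move=> y _; rewrite lee_fin beta_fun_ge0.
- by rewrite lee_fin mulr_ge0 ?powR_ge0 ?expR_ge0.
rewrite muleA -EFinM -/(beta_mass a b); congr (_%:E * _)%E.
rewrite /gamma_fun t0 mulrA; congr (_ * _).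
rewrite -{1}(powRr1 (ltW t0)) -powRD ?(gt_eqF t0) ?implybT//.
by congr (_ `^ _); ring.
Qed.

Definition gamma_law d (T : measurableType d) (P : probability T R) (X : T -> R)
    (a : R) : Prop :=
  forall B : set R, measurable B ->
    P (X @^-1` B) = (\int[mu]_(x in B) (gamma_pdf a x)%:E)%E.

Lemma gamma_law_integral d (T : measurableType d) (P : probability T R)
    (X : T -> R) a (f : RT -> \bar R) :
  measurable_fun setT X -> gamma_law P X a ->
  measurable_fun setT f -> (forall x, 0 <= f x)%E ->
  (\int[P]_w f (X w) = \int[mu]_x (f x * (gamma_pdf a x)%:E))%E.
Proof.
move=> mX0 gX mf f0.
have mX : @measurable_fun _ _ T RT setT X by exact: mX0.
pose pm : {measure set RT -> \bar R} := pushforward P (X : T -> RT).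
rewrite -(@ge0_integral_density _ _ _ mu (pm mX) (gamma_pdf a))//.
- by rewrite ge0_integral_pushforward.
- exact: measurable_gamma_pdf.
- exact: gamma_pdf_ge0.
Qed.

(** By [gamma_fun_convolution] the sum has a density proportional to [gamma_fun (a + b)]; total mass
    1 then identifies the constant. *)
Lemma gamma_law_add d (T : measurableType d) (P : probability T R)
    (X Y : T -> R) (a b : R) :
  measurable_fun setT X -> measurable_fun setT Y ->
  (forall A B, measurable A -> measurable B ->
    P (X @^-1` A `&` Y @^-1` B) = (P (X @^-1` A) * P (Y @^-1` B))%E) ->
  0 < a -> 0 < b -> a + b <= 1 ->
  gamma_law P X a -> gamma_law P Y b -> gamma_law P (X \+ Y) (a + b).
Proof.
move=> mX mY XY a0 b0 ab1 gX gY.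
pose c := (fine (gamma_mass a) * fine (gamma_mass b))^-1.
have c0 : 0 <= c.
  by rewrite invr_ge0 mulr_ge0// fine_ge0//; apply: integral_ge0.
have pdfM (x y : RT) : ((gamma_pdf b y)%:E * (gamma_pdf a x)%:E =
    c%:E * (gamma_fun a x * gamma_fun b y)%:E)%E.
    have e (p q r s : R) : q / s * (p / r) = (r * s)^-1 * (p * q) by rewrite invfM; ring.
  by rewrite -!EFinM; exact: (congr1 EFin (e _ _ _ _)).
have conv (B : set R) : measurable B -> P ((X \+ Y) @^-1` B) =
    (c%:E * beta_mass a b * \int[mu]_(t in B) (gamma_fun (a + b) t)%:E)%E.
  move=> mB.
  have mXY : measurable_fun setT (X \+ Y) by exact: measurable_funD.
  have mB' : @measurable _ RT B by exact: mB.
  have mi : measurable_fun setT (fun z : RT => (\1_B z)%:E : \bar R).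
    by apply/measurable_EFinP; exact: measurable_indic.
  transitivity (\int[P]_w (\1_B (X w + Y w))%:E)%E.
    rewrite -[X in P X]setIT -(integral_indic P measurableT); last first.
      by rewrite -[_ @^-1` _]setTI; exact: mXY.
    by apply: eq_integral.
  rewrite (@independent_integral _ _ _ P X Y (fun z => (\1_B (z.1 + z.2))%:E))//; last first.
    apply: (measurableT_comp (f := fun z : R => (\1_B z)%:E : \bar R)) => //.
    exact: measurable_funD.
  have mshift (x : R) : measurable_fun setT (fun y : RT => (\1_B (x + y)%R)%:E : \bar R).
    apply: (measurableT_comp mi); exact: measurable_funD.
  have inner (x : R) : (\int[P]_v (\1_B (x + Y v)%R)%:E =
      \int[mu]_t ((\1_B t)%:E * (gamma_pdf b (t - x)%R)%:E))%E.
    apply: (etrans (gamma_law_integral mY gY (mshift x) _)) => [y|].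
      by rewrite lee_fin.
    have mF : measurable_fun setT
        (fun y : RT => ((\1_B (x + y)%R)%:E * (gamma_pdf b y)%:E)%E).
      apply: emeasurable_funM => //.
      by apply/measurable_EFinP; exact: measurable_gamma_pdf.
    have := ge0_integral_affine (- x) ltr01 mF.
    rewrite invr1 mul1e => <-; last first.
      by move=> y; rewrite mule_ge0// lee_fin// gamma_pdf_ge0.
    by apply: eq_integral => t _; rewrite mul1r subrKC.
  under eq_integral do rewrite /= inner.
  have mg2 : measurable_fun setT (fun z : RT * RT =>
      ((\1_B z.2)%:E * (gamma_pdf b (z.2 - z.1)%R)%:E)%E : \bar R).
    apply: emeasurable_funM; first exact: (measurableT_comp mi).
    apply/measurable_EFinP; apply: (measurableT_comp (measurable_gamma_pdf b)).
    exact: measurable_funB.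
  have g20 z : (0 <= (\1_B z.2)%:E * (gamma_pdf b (z.2 - z.1)%R)%:E :> \bar R)%E.
    by rewrite mule_ge0// lee_fin// gamma_pdf_ge0.
  pose h (x : RT) := (\int[mu]_t ((\1_B t)%:E * (gamma_pdf b (t - x)%R)%:E))%E.
  have mh : measurable_fun setT h.
    exact: (measurable_fun_fubini_tonelli_F _ mg2 g20).
  rewrite (gamma_law_integral (f := h) mX gX)//; last first.
    by move=> x; apply: integral_ge0 => t _; rewrite (g20 (x, t)).
  transitivity (\int[mu]_x \int[mu]_t
      ((\1_B t)%:E * (c%:E * (gamma_fun a x * gamma_fun b (t - x)%R)%:E)))%E.
    apply: eq_integral => x _; rewrite /h -ge0_integralZr//.
    - by apply: eq_integral => t _; rewrite -muleA pdfM.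
    - exact: (measurableT_comp mg2 (measurable_pair1 x)).
    - by move=> t _; exact: (g20 (x, t)).
    - by rewrite lee_fin gamma_pdf_ge0.
  have mgg : measurable_fun setT (fun z : RT * RT =>
      (gamma_fun a z.1 * gamma_fun b (z.2 - z.1)%R)%:E : \bar R).
    apply/measurable_EFinP; apply: measurable_funM.
      exact: (measurableT_comp (measurable_gamma_fun a)).
    apply: (measurableT_comp (measurable_gamma_fun b)).
    exact: measurable_funB.
  rewrite (@fubini_tonelli _ _ RT RT R mu mu (fun z => ((\1_B z.2)%:E *
    (c%:E * (gamma_fun a z.1 * gamma_fun b (z.2 - z.1)%R)%:E))%E)); last 2 first.
  - apply: emeasurable_funM; first exact: (measurableT_comp mi).
    exact: emeasurable_funM.
  - by move=> z; rewrite !mule_ge0// lee_fin// mulr_ge0 ?gamma_fun_ge0.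
  transitivity (\int[mu]_t (c%:E * beta_mass a b *
      ((fun t => (gamma_fun (a + b) t)%:E) \_ B) t))%E.
    apply: eq_integral => t _ /=.
    have mt : measurable_fun setT
        (fun x : RT => (gamma_fun a x * gamma_fun b (t - x)%R)%:E : \bar R).
      exact: (measurableT_comp mgg (measurable_pair2 t)).
    have t0 x : (0 <= (gamma_fun a x * gamma_fun b (t - x)%R)%:E :> \bar R)%E.
      by rewrite lee_fin mulr_ge0 ?gamma_fun_ge0.
    rewrite ge0_integralZl//; last 2 first.
    - exact: emeasurable_funM.
    - by move=> x _; rewrite mule_ge0.
    rewrite ge0_integralZl// gamma_fun_convolution patchE indicE.
    case: (t \in B) => /=; last by rewrite mul0e mule0.
    by rewrite mul1e -muleA [X in (_ * X)%E]muleC.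
  rewrite ge0_integralZl//; last 3 first.
  - apply/(measurable_restrictT _ _).1 => //; apply: measurable_funTS.
    exact: mgE.
  - by move=> x _; rewrite patchE; case: ifP.
  - rewrite mule_ge0//; apply: integral_ge0 => y _; by rewrite lee_fin beta_fun_ge0.
  by rewrite -integral_mkcond.
have ab0 : 0 < a + b by rewrite addr_gt0.
have g0 := gamma_mass_gt0 ab0; have gy := gamma_mass_lty ab0 ab1.
have gf : gamma_mass (a + b) \is a fin_num by rewrite ge0_fin_numE// ltW.
have f0 : 0 < fine (gamma_mass (a + b)) by rewrite fine_gt0// g0.
(* The case [B = setT] of [conv] evaluates the unknown beta integral. *)
have kE : (c%:E * beta_mass a b = ((fine (gamma_mass (a + b)))^-1)%:E)%E.
  have := conv setT measurableT; rewrite preimage_setT probability_setT -/(gamma_mass (a + b)).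
  move=> /(congr1 (fun z => z * ((fine (gamma_mass (a + b)))^-1)%:E)%E).
  rewrite mul1e -[gamma_mass (a + b)](fineK gf) -muleA -EFinM divff ?gt_eqF//.
  by rewrite mule1.
move=> B mB; rewrite conv// kE muleC -ge0_integralZr//.
- exact: measurable_funTS.
- by rewrite lee_fin invr_ge0 ltW.
Qed.

End Gamma.

Lemma ae_eq_preimage (R : realType) d (T : measurableType d) (Q : probability T R)
    (X Y : T -> R) (B : set R) :
  measurable_fun setT X -> measurable_fun setT Y -> measurable B ->
  {ae Q, forall w, X w = Y w} -> Q (X @^-1` B) = Q (Y @^-1` B).
Proof.
move=> mX mY mB XY.
have mXB : measurable (X @^-1` B) by rewrite -[X in measurable X]setTI; exact: mX.
have mYB : measurable (Y @^-1` B) by rewrite -[X in measurable X]setTI; exact: mY.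
rewrite -[X @^-1` B]setIT -[Y @^-1` B]setIT -!(integral_indic Q measurableT)//.
apply: ae_eq_integral => //; try by apply/measurable_EFinP; exact: measurable_indic.
apply: filterS XY => w XYw _; rewrite !indicE; congr (_%:R%:E).
by congr (nat_of_bool _); apply/idP/idP; rewrite !inE /preimage /= XYw.
Qed.

Section GammaSplitting.
Context {R : realType}.
Local Notation mu := (@lebesgue_measure R).
Local Notation RT := (measurableTypeR R).

Lemma gamma_pdf1 (B : set RT) : measurable B ->
  (\int[mu]_(x in B) (gamma_pdf 1 x)%:E = exponential_prob 1 B)%E.
Proof.
have mg : measurable_fun setT (fun x : RT => (gamma_fun 1 x)%:E).
  by apply/measurable_EFinP; exact: measurable_gamma_fun.
have gE (A : set RT) : measurable A ->
    (\int[mu]_(x in A) (gamma_fun 1 x)%:E = exponential_prob 1 A)%E.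
  move=> mA; apply: ae_eq_integral => //.
  - exact: measurable_funTS.
  - apply/measurable_EFinP; apply: measurable_funTS.
    exact: measurable_exponential_pdf.
  (* The two densities differ only at 0, where [gamma_fun] vanishes and the exponential density does
     not. *)
  exists [set (0 : R)]; split => //; first exact: lebesgue_measure_set1.
  move=> x /= h; apply: contra_notP h => /eqP x0 _; congr EFin.
  rewrite /gamma_fun subrr powRr0 mul1r; case: ltgtP x0 => // x0 _.
    by rewrite exponential_pdfE ?ltW// mul1r mulN1r.
  by rewrite lt0_exponential_pdf.
have g1 : gamma_mass (1 : R) = 1%E.
  rewrite /gamma_mass gE//; exact: (integral_exponential_pdf ltr01).
move=> mB; rewrite -gE//; apply: eq_integral => x _.
by rewrite /gamma_pdf g1 divr1.
Qed.

Section Sums.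
Context d (T : measurableType d) (Q : probability T R) (n : nat).

Lemma gamma_law_ge0 (X : T -> R) a : measurable_fun setT X ->
  gamma_law Q X a -> {ae Q, forall w, 0 <= X w}.
Proof.
move=> mX gX; exists (X @^-1` `]-oo, 0[); split.
- by rewrite -[X in measurable X]setTI; exact: mX.
- rewrite gX//; apply: integral0_eq => x /=; rewrite in_itv/= => x0.
  by rewrite /gamma_pdf /gamma_fun ltNge (ltW x0)/= mul0r.
- by move=> w /= /negP; rewrite -ltNge in_itv.
Qed.

(** Adding one variable at a time keeps the shape k/n at most 1, the range in which [gamma_law_add]
    applies; k = n gives the exponential law. *)
Lemma gamma_law_sum (H : nat -> T -> R) :
  (forall i, measurable_fun setT (H i)) -> mutually_independent Q H ->
  (forall i, gamma_law Q (H i) n%:R^-1) ->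
  forall k, (0 < k <= n)%N ->
  gamma_law Q (fun w => \sum_(i < k) H i w) (k%:R / n%:R).
Proof.
move=> mH iH gH; elim=> // -[_|k IH] /andP[_ kn].
  by move=> B mB; under eq_fun do rewrite big_ord1; rewrite mul1r; exact: gH.
have n0 : (0 : R) < n%:R^-1 by rewrite invr_gt0 ltr0n (leq_ltn_trans _ kn).
pose phi (b : bool) (f : nat -> R) := if b then \sum_(i < k.+1) f i else f k.+1.
have mphi b : measurable_fun
    [set: pathType R ((fun i => (i < k.+1)%N) @^-1` [set b])] (phi b).
  rewrite /phi; case: b; last by apply: measurable_coord; rewrite /preimage/= ltnn.
  apply: measurable_sum => i; apply: measurable_coord.
  by rewrite /preimage/= ltn_ord.
have ind := independent_groups mH iH mphi.
have -> : k.+2%:R / n%:R = k.+1%:R / n%:R + n%:R^-1 :> R.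
  by rewrite -[k.+2%:R]natr1 mulrDl mul1r.
have -> : (fun w => \sum_(i < k.+2) H i w) =
    (fun w => \sum_(i < k.+1) H i w) \+ H k.+1.
  by apply/funext => w; rewrite big_ord_recr.
apply: gamma_law_add => //.
- exact: measurable_sum.
- move=> A B mA mB; exact: (mutually_independent2 (i := true) (j := false) ind).
- by rewrite mulr_gt0.
- rewrite -{2}(mul1r n%:R^-1) -mulrDl natr1 ler_pdivrMr ?mul1r ?ler_nat//.
  by rewrite ltr0n (leq_ltn_trans _ kn).
- by apply: IH; rewrite /= (ltnW kn).
Qed.

End Sums.
End GammaSplitting.

(** * Infinite divisibility *)

Section InfiniteDivisibility.
Context {R : realType} d (T : measurableType d) (Q : probability T R).
Variables (n : nat) (G : nat * nat -> T -> R).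
Hypothesis n0 : (0 < n)%N.
Hypothesis mG : forall p, measurable_fun setT (G p).
Hypothesis iG : mutually_independent Q G.
Hypothesis gG : forall p, gamma_law Q (G p) n%:R^-1.

Local Notation mu := (@lebesgue_measure R).
Local Notation RT := (measurableTypeR R).

Let nR0 : (0 : R) < n%:R. Proof. by rewrite ltr0n. Qed.

Let row (j : nat) (w : T) : R := \sum_(i < n) G (j, i : nat) w.

Let mrow j : measurable_fun setT (row j).
Proof. exact: measurable_sum. Qed.

Let E (j : nat) : {RV Q >-> R} := mfun_Sub (mem_set (mrow j)).

Let eE j : standard_exponential (E j).
Proof.
move=> B mB; rewrite -gamma_pdf1//.
have iGj : mutually_independent Q (G \o pair j).
  by apply: mutually_independent_inj iG => i k [].
have := gamma_law_sum (fun i => mG (j, i)) iGj (fun i => gG (j, i)) (k := n).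
rewrite n0 leqnn => /(_ isT B mB); rewrite divff ?gt_eqF// => <-.
Qed.

Let iE : mutually_independent Q (fun j => (E j : T -> R)).
Proof.
apply: (independent_groups (h := fst)
  (phi := fun j f => \sum_(i < n) f (j, i : nat)) mG iG) => j.
by apply: measurable_sum => i; apply: measurable_coord.
Qed.

Let G0 : {ae Q, forall w, forall p, 0 <= G p w}.
Proof.
have h : {ae Q, forall w, forall j i, 0 <= G (j, i) w}.
  by apply/ae_foralln => j; apply/ae_foralln => i; exact: gamma_law_ge0 (gG _).
by apply: filterS h => w h [j i]; exact: h.
Qed.

(** All entries share one mean, and n of them add up to an exponential variable of mean 1. *)
Let G_mean p : (\int[Q]_w `|G p w|%:E = (n%:R^-1)%:E)%E.
Proof.
have mabs : measurable_fun setT (fun x : RT => `|x|%:E : \bar R).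
  by apply/measurable_EFinP; exact: normr_measurable.
have key q : (\int[Q]_w `|G q w|%:E =
    \int[mu]_x (`|x|%:E * (gamma_pdf n%:R^-1 x)%:E))%E.
  by apply: (gamma_law_integral (mG q) (gG q) mabs) => x; rewrite lee_fin.
rewrite key; set M := (X in X = _).
have M0 : (0 <= M)%E.
  by apply: integral_ge0 => x _; rewrite mule_ge0// lee_fin// gamma_pdf_ge0.
have [e1 _ _] := exponential_moments (eE 0).
have mGa q : measurable_fun setT (fun w => `|G q w|%:E : \bar R).
  by apply/measurable_EFinP; exact: measurableT_comp.
have : (\int[Q]_w `|E 0 w|%:E = \int[Q]_w \sum_(i < n) `|G (0%N, i : nat) w|%:E)%E.
  apply: ae_eq_integral => //.
  - by apply/measurable_EFinP; exact: measurableT_comp.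
  - exact: emeasurable_sum.
  apply: filterS G0 => w Gw _; rewrite sumEFin; congr EFin.
  change (`|row 0 w| = \sum_(i < n) `|G (0%N, i : nat) w|).
  rewrite ger0_norm; last exact: sumr_ge0.
  by apply: eq_bigr => i _; rewrite ger0_norm.
rewrite e1 ge0_integral_sum//; under eq_bigr do rewrite key -/M.
(* The common mean could a priori be infinite; a row sum of mean 1 excludes this. *)
clearbody M; case: M M0 => [r| |]// _.
- rewrite sumEFin sumr_const card_ord => -[r1]; congr EFin.
  have nn0 : (n%:R : R) != 0 by rewrite gt_eqF.
  by apply: (mulIf nn0); rewrite mulr_natr -r1 mulVf.
- rewrite (bigD1 (Ordinal n0))//= addye// -ltNye (lt_le_trans (ltNyr 0))//.
  exact: sume_ge0.
Qed.

(** Almost surely an entry is dominated by its row sum, whose second moment is 2; hence the common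
    second moment is finite. *)
Let G_square : exists q : R, forall p, (\int[Q]_w (G p w ^+ 2)%:E = q%:E)%E.
Proof.
have msq : measurable_fun setT (fun x : RT => (x ^+ 2)%:E : \bar R).
  by apply/measurable_EFinP; exact: exprn_measurable.
have key p : (\int[Q]_w (G p w ^+ 2)%:E =
    \int[mu]_x ((x ^+ 2)%:E * (gamma_pdf n%:R^-1 x)%:E))%E.
  apply: (gamma_law_integral (mG p) (gG p) msq) => x.
  by rewrite lee_fin sqr_ge0.
have [_ e2 _] := exponential_moments (eE 0).
exists (fine (\int[Q]_w (G (0%N, 0%N) w ^+ 2)%:E)) => p.
rewrite key -(key (0%N, 0%N)) fineK//.
rewrite ge0_fin_numE; last by apply: integral_ge0 => w _; rewrite lee_fin sqr_ge0.
apply: (@le_lt_trans _ _ (2 : R)%:E); last exact: ltry.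
rewrite -e2; apply: ae_ge0_le_integral => //.
- by move=> w _; rewrite lee_fin sqr_ge0.
- by apply/measurable_EFinP; exact: measurable_funX.
- by move=> w _; rewrite lee_fin sqr_ge0.
- by apply/measurable_EFinP; exact: measurable_funX.
apply: filterS G0 => w Gw _; rewrite lee_fin.
change (G (0, 0)%N w ^+ 2 <= row 0 w ^+ 2).
rewrite lerXn2r ?nnegrE ?sumr_ge0// /row (bigD1 (Ordinal n0))//= lerDl.
exact: sumr_ge0.
Qed.

(** One n-th of the second representation: the constant is shared equally and every entry is centred
    at 1/n. It is a functional of a path, so that independence and equality of laws of the columns
    carry over. *)
Let col (f : nat -> R) : R := - ((euler_gamma + ln 2) / 2) / n%:R
  - (f 0%N - n%:R^-1)
  - limn (fun m => \sum_(1 <= j < m) ((f j - n%:R^-1) / (2 * j + 1)%:R)).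

Let mcol d' (S : measurableType d') (H : nat -> S -> R) :
  (forall j, measurable_fun setT (H j)) ->
  measurable_fun setT (fun w => col (H ^~ w)).
Proof.
move=> mH; apply: measurable_funB; first by apply: measurable_funB => //; exact: measurable_funB.
apply: (@measurable_fun_limn_real _ _ _ (fun m w =>
  \sum_(1 <= j < m) ((H j w - n%:R^-1) / (2 * j + 1)%:R))) => m.
by apply: measurable_sum => j; apply: measurable_funM => //; exact: measurable_funB.
Qed.

Let Y0 (i : 'I_n) (w : T) : R := col (fun j => G (j, i : nat) w).

Let mY i : measurable_fun setT (Y0 i).
Proof. by apply: (mcol (H := fun j => G (j, i : nat))). Qed.

Let Y (i : 'I_n) : {RV Q >-> R} := mfun_Sub (mem_set (mY i)).

(** The array is grouped by its second index, and the family over all naturals is then restricted to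
    the first n columns. *)
Let iY : mutually_independent Q (fun i => (Y i : T -> R)).
Proof.
have h : mutually_independent Q (fun (i : nat) w => col (fun j => G (j, i) w)).
  apply: (independent_groups (h := snd)
    (phi := fun i f => col (fun j => f (j, i))) mG iG) => i.
  apply: (mcol (H := fun j (f : pathType R (snd @^-1` [set i])) => f (j, i))) => j.
  exact: measurable_coord.
have h2 := @mutually_independent_inj R nat 'I_n _ _ Q _ (fun i : 'I_n => i : nat) (@ord_inj n) h.
exact: h2.
Qed.

(** Any two columns are independent families with identical marginals, to which the same [col] is
    applied. *)
Let lawY (i k : 'I_n) (B : set R) : measurable B ->
  Q (Y i @^-1` B) = Q (Y k @^-1` B).
Proof.
move=> mB.
have ind (l : nat) : mutually_independent Q (fun j => G (j, l)).
  by apply: (mutually_independent_inj (g := fun j => (j, l)) _ iG) => ? ? [].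
apply: (eq_in_law_path (X := fun j => G (j, i : nat)) (X' := fun j => G (j, k : nat))
  (phi := col)) => //.
- by move=> j A mA; rewrite gG// gG.
- apply: (mcol (H := fun j (f : pathType R setT) => f j)) => j.
  exact: measurable_coord.
Qed.

(** The finite sum over columns passes through the limits only where every column converges, since
    [limn] is not additive on divergent sequences. The column constants and centrings add up to
    those of the row sums. *)
Let sumY : {ae Q, forall w, \sum_(i < n) Y i w =
  - ((euler_gamma + ln 2) / 2) - (E 0%N w - 1)
  - limn (series2 (fun j => (E j : T -> R)) w)}.
Proof.
have [q Gq] := G_square.
have ind (l : nat) : mutually_independent Q (fun j => G (j, l)).
  by apply: (mutually_independent_inj (g := fun j => (j, l)) _ iG) => ? ? [].
have cv : {ae Q, forall w, forall i, cvgn (fun m =>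
    \sum_(1 <= j < m) ((G (j, i) w - n%:R^-1) / (2 * j + 1)%:R))}.
  apply/ae_foralln => i.
  apply: (@ae_cvg_independent_odd_series _ _ _ Q (fun j => G (j, i)) _ q) => // j.
  exact: gamma_law_ge0 (gG _).
apply: filterS cv => w cv.
change (\sum_(i < n) Y0 i w = - ((euler_gamma + ln 2) / 2) - (row 0 w - 1)
  - limn (series2 row w)).
have nn0 : (n%:R : R) != 0 by rewrite gt_eqF.
have sumC (c : R) : \sum_(i < n) c / n%:R = c.
  by rewrite sumr_const card_ord -[LHS]mulr_natr divfK.
have sum1 : \sum_(i < n) (n%:R^-1 : R) = 1 by rewrite -[RHS]sumC mul1r.
rewrite /Y0 /col !sumrB sumC sum1; congr (_ - _ - _).
apply/esym/cvg_lim => //.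
rewrite (_ : series2 row w = fun m => \sum_(i < n) \sum_(1 <= j < m)
    ((G (j, i : nat) w - n%:R^-1) / (2 * j + 1)%:R)).
  by apply: cvg_big => [|i _]; [exact: add_continuous|exact: cv].
apply/funext => m; rewrite exchange_big/=; apply: eq_bigr => j _.
by rewrite -mulr_suml sumrB sum1.
Qed.

Lemma infinitely_divisible_gamma_array d' (T' : measurableType d')
    (P : probability T' R) (Z : {RV P >-> R}) : standard_normal Z ->
  exists Y : 'I_n -> {RV Q >-> R},
    [/\ mutually_independent Q (fun i => (Y i : T -> R)),
      (forall (i j : 'I_n) (B : set R), measurable B ->
         Q (Y i @^-1` B) = Q (Y j @^-1` B)) &
      (forall B : set R, measurable B ->
         Q ((fun w => \sum_(i < n) Y i w) @^-1` B) =
         P ((fun w => ln `|Z w|) @^-1` B))].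
Proof.
move=> nZ; exists Y; split; [exact: iY|exact: lawY|move=> B mB].
rewrite (eq_in_law_series2 nZ iE eE)//; apply: ae_eq_preimage => //.
- exact: measurable_sum.
- apply: measurable_funB; first by apply: measurable_funB => //; exact: measurable_funB.
  apply: (@measurable_fun_limn_real _ _ _ (fun m w => series2 row w m)) => m.
  by apply: measurable_sum => j; apply: measurable_funM => //; exact: measurable_funB.
Qed.

End InfiniteDivisibility.

Theorem mainTheorem1 :
  (* infinite divisibility of the law of ln|Z| *)
  (forall (R : realType) (d : measure_display) (T : measurableType d)
          (P : probability T R) (Z : {RV P >-> R}),
      standard_normal Z ->
      infinitely_divisible (fun B : set R => P ((fun w => ln `|Z w|) @^-1` B)))
  /\
  (* the series representations *)
  (forall (R : realType) (d : measure_display) (T : measurableType d)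
          (P : probability T R) (Z : {RV P >-> R})
          (d' : measure_display) (T' : measurableType d')
          (Q : probability T' R) (E : nat -> {RV Q >-> R}),
      standard_normal Z ->
      mutually_independent Q (fun j => (E j : T' -> R)) ->
      (forall j, standard_exponential (E j)) ->
      {ae Q, forall w, cvgn (series1 (fun j => (E j : T' -> R)) w)} /\
      {ae Q, forall w, cvgn (series2 (fun j => (E j : T' -> R)) w)} /\
      eq_in_law P Q (fun w => ln `|Z w|)
        (fun w => ln 2 / 2 - E 0%N w
                  - limn (series1 (fun j => (E j : T' -> R)) w)) /\
      eq_in_law P Q (fun w => ln `|Z w|)
        (fun w => - ((euler_gamma + ln 2) / 2) - (E 0%N w - 1)
                  - limn (series2 (fun j => (E j : T' -> R)) w))).
Proof.
split; last first.
  move=> R d T P Z d' T' Q E nZ iE eE; split; first exact: ae_cvg_series1.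
  split; first exact: ae_cvg_series2.
  by split; [exact: eq_in_law_series1|exact: eq_in_law_series2].
move=> R d T P Z nZ n n0.
have a0 : (0 : R) < n%:R^-1 by rewrite invr_gt0 ltr0n.
have a1 : (n%:R^-1 : R) <= 1 by rewrite invf_le1 ?ltr0n// ler1n.
have [nu nuE] := @density_probability _ _ R lebesgue_measure (gamma_pdf n%:R^-1)
  (measurable_gamma_pdf _) (gamma_pdf_ge0 _) (integral_gamma_pdf a0 a1).
(* A doubly indexed family is requested so that independence holds jointly across rows and
   columns. *)
have [d' [T' [Q [G [mG iG GE]]]]] := iid_exists nu (nat * nat)%type.
have gG p : gamma_law Q (G p) n%:R^-1 by move=> B mB; rewrite GE// nuE.
have [Y [iY lY sY]] := infinitely_divisible_gamma_array n0 mG iG gG nZ.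
by exists d', T', Q, Y.
Qed.
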